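(* Consider the space $\mathbb{C}^{18}$ of all triples $(v_1,v_2,v_3)$ of homogeneous polynomials $\mathbb{C}^3\to\mathbb{C}$ of degree $2$, and its subset of non-degenerate triples, i.e. those for which $v_1,v_2,v_3$ vanish simultaneously only at the origin. The Poincaré polynomial of the rational cohomology of the space of non-degenerate triples equals $(1+t)(1+t^3)(1+t^5)$. *)

(* Defs.v *)
From mathcomp Require Import all_boot all_order all_algebra.
From mathcomp Require Import all_classical all_reals all_analysis.
From mathcomp Require Import complex.
Import Order.TTheory GRing.Theory Num.Theory.
Import numFieldNormedType.Exports.
Local Open Scope classical_set_scope.
Local Open Scope ring_scope.
Local Open Scope complex_scope.

Unset Printing Implicit Defensive.

Section Defs.
Variable R : realType.

(* The ambient space C^18 is realised as R^36 = 'rV[R]_36 (real and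
   imaginary parts), with its usual (normed) topology. Coordinate
   (2*(6*i+m)) resp. (2*(6*i+m)+1) is the real resp. imaginary part of the
   coefficient of the m-th degree-2 monomial in v_(i+1). *)
Definition coef (v : 'rV[R]_36) (i : 'I_3) (m : 'I_6) : R[i] :=
  (v 0 (inord (2 * (6 * i + m)))) +i* (v 0 (inord (2 * (6 * i + m) + 1))).

Definition monomial (m : 'I_6) (z : 'I_3 -> R[i]) : R[i] :=
  match val m with
  | 0 => z (inord 0) * z (inord 0)
  | 1 => z (inord 1) * z (inord 1)
  | 2 => z (inord 2) * z (inord 2)
  | 3 => z (inord 0) * z (inord 1)
  | 4 => z (inord 0) * z (inord 2)
  | _ => z (inord 1) * z (inord 2)
  end.

Definition quad (v : 'rV[R]_36) (i : 'I_3) (z : 'I_3 -> R[i]) : R[i] :=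
  \sum_(m < 6) coef v i m * monomial m z.

Definition nondeg : set 'rV[R]_36 :=
  [set v | forall z : 'I_3 -> R[i], (forall i, quad v i z = 0) -> forall j, z j = 0].

Variable n : nat.
Variable X : set 'rV[R]_n.

Definition stdsimplex (k : nat) : set 'rV[R]_k.+1 :=
  [set x | (forall j, 0 <= x 0 j) /\ \sum_j x 0 j = 1].

(* singular k-simplices in X, each represented canonically by a function
   that is continuous on the standard simplex, maps it into X, and is 0
   outside it (so that singular simplices correspond bijectively to such
   functions). *)
Definition is_simplex (k : nat) (f : 'rV[R]_k.+1 -> 'rV[R]_n) : Prop :=
  [/\ {within stdsimplex k, continuous f},
      (forall x, stdsimplex k x -> X (f x)) &
      (forall x, ~ stdsimplex k x -> f x = 0)].

Definition face_incl (k : nat) (j : 'I_k.+2) (x : 'rV[R]_k.+1) : 'rV[R]_k.+2 :=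
  \row_l (match unlift j l with Some l' => x 0 l' | None => 0 end).

Definition face (k : nat) (j : 'I_k.+2) (f : 'rV[R]_k.+2 -> 'rV[R]_n)
  : 'rV[R]_k.+1 -> 'rV[R]_n :=
  fun x => if x \in stdsimplex k then f (face_incl k j x) else 0.

(* k-cochains (only their values on genuine simplices matter) *)
Definition cochain (k : nat) := ('rV[R]_k.+1 -> 'rV[R]_n) -> rat.

Definition cobound (k : nat) (c : cochain k) : cochain k.+1 :=
  fun f => \sum_(j < k.+2) (-1) ^+ j * c (face k j f).

Definition cocycle (k : nat) (c : cochain k) : Prop :=
  forall f, is_simplex k.+1 f -> cobound k c f = 0.

Definition coboundary (k : nat) : cochain k -> Prop :=
  match k with
  | 0 => fun c => forall f, is_simplex 0 f -> c f = 0
  | k'.+1 => fun c => exists b : cochain k',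
      forall f, is_simplex k'.+1 f -> c f = cobound k' b f
  end.

Definition betti_eq (k b : nat) : Prop :=
  exists c : 'I_b -> cochain k,
    [/\ (forall i, cocycle k (c i)),
        (forall z : cochain k, cocycle k z ->
           exists a : 'I_b -> rat,
             coboundary k (fun f => z f - \sum_i a i * c i f)) &
        (forall a : 'I_b -> rat,
           coboundary k (fun f => \sum_i a i * c i f) -> forall i, a i = 0)].

End Defs.

Definition poincare_poly_eq (R : realType) (n : nat) (X : set 'rV[R]_n)
  (p : {poly int}) : Prop :=
  forall k, exists b : nat, @betti_eq R n X k b /\ (b%:Z = p`_k)%R.

(* Main.v *)
(* Write a triple as [a x^2 + x L(y,z) + C(y,z)] with [a] in [C^3].  The space of
   non-degenerate triples has the rational cohomology of [(C^3 \ 0) x GL_2], by the map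
   [(v, h) |-> M(v) (x^2, h (y^2, z^2))] with [M(v) = v v^T + (conj v) x _] of determinant
   [|v|^4] and first entry of the first column [v_1^2].

   Such comparisons rest on one principle: a map [(w, u) |-> (g (w, u), u^d)] between open
   sets is a rational cohomology isomorphism as soon as its restrictions to [u = 0] and to
   [u <> 0] are (Mayer-Vietoris and excision for star-shaped neighbourhoods of [u = 0]; the
   power map is handled by transfer).  Stratifying by [a_1] and completing the square
   reduces the claim to triples [x^2 + c1, x (r1 . (y,z)) + c2, x (r2 . (y,z)) + c3].
   Stratifying by the rank of the rows [r1, r2], the strata become spaces of coprime pairs
   of binary forms [(A, B)] with [A] of degree 2, 3 or 4 and [B] quadratic; each has the
   cohomology of [(C^2 \ 0) x C^*] through two leading coefficients and the resultant.  Seen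
   there, the inclusions of the coprime pairs [(c2, c3)] with [c1 = 0] are the identity up to
   sign changes and squaring of coordinates.

   Cohomology is handled by cochains that are arbitrary functionals on arbitrary functions,
   equalities being tested on singular simplices only; "quasi-isomorphism" means that the
   mapping cone is acyclic.  The Betti numbers of [X x (R^(r+1) \ 0)] come from suspension. *)

From HB Require Import structures.
Require Import Defs.
From mathcomp Require Import all_boot all_order all_algebra.
From mathcomp Require Import all_classical all_reals all_analysis.
From mathcomp Require Import separable cyclotomic complex.
From mathcomp Require Import ring lra zify.
Import Order.TTheory GRing.Theory Num.Theory.
Import numFieldNormedType.Exports.
Local Open Scope classical_set_scope.
Local Open Scope ring_scope.
Unset Printing Implicit Defensive.
Set Implicit Arguments.
Unset Strict Implicit.

(** * Operators on functionals of affine simplices *)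

(** The polynomial is that of GL_3(C), which acts by recombining the three forms; the obstacle is to
    compare with it without fibrations or spectral sequences, by explicit continuous maps only. One
    cannot complete [v] continuously to an invertible matrix with first column [v], since SU(3) ->
    S^5 has no section. But the image of pi_5(SU(3)) in pi_5(S^5) has index 2, so a family of
    invertible matrices whose first column has degree 2 is possible, and v v^T + (conj v) x _ is
    one. The price is the entry v_1^2: normal to the stratum a_1 = 0 the comparison map is a
    squaring map, which is an isomorphism only rationally. The other squares have a similar origin:
    eliminating a variable between two forms squares a resultant. Isomorphisms are expressed by
    mapping cones because one statement then contains injectivity and surjectivity in all degrees,
    obeys two-out-of-three, and turns the five lemma into a single chase. The complement of a
    stratum is usually trivialised by solving one equation for a coordinate that occurs linearly;
    this is why the data are cut along leading coefficients. *)

(* An affine simplex is the sequence of its vertices; a chain operator is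
   represented by its transpose, acting on functionals [seq E -> rat].  The
   empty sequence plays the role of a (-1)-simplex. *)
Section Functionals.
Variable E : Type.
Implicit Types (F G : seq E -> rat) (l : seq E).

(** The transpose of the augmented simplicial boundary. Recursion on the first vertex matches the
    recursions of cones and prisms, so that chain homotopy identities follow by induction without
    signed double sums. *)
Fixpoint bdf F l : rat :=
  if l is v :: l' then F l' - bdf (fun s => F (v :: s)) l' else 0.

Definition remn (j : nat) l := take j l ++ drop j.+1 l.

Lemma eq_bdf F G l : (forall j, (j < size l)%N -> F (remn j l) = G (remn j l)) ->
  bdf F l = bdf G l.
Proof.
elim: l F G => [//|v l IHl] F G FG /=; congr (_ - _).
  by have := FG 0 isT; rewrite /remn /= drop0.
by apply: IHl => j jl; have := FG j.+1 jl.
Qed.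

Lemma bdfE F l : bdf F l = \sum_(j < size l) (-1) ^+ j * F (remn j l).
Proof.
elim: l F => [|v l IHl] F /=; first by rewrite big_ord0.
rewrite big_ord_recl /= expr0 mul1r /remn /= drop0; congr (_ + _).
rewrite IHl -sumrN; apply: eq_bigr => j _.
by rewrite /bump /= add1n exprS mulN1r mulNr.
Qed.

Lemma size_remn j l : (j < size l)%N -> size (remn j l) = (size l).-1.
Proof. by move=> jl; rewrite size_cat size_take size_drop jl; lia. Qed.

Lemma remn_sub j l (C : set E) : (forall a, List.In a l -> C a) ->
  forall a, List.In a (remn j l) -> C a.
Proof.
elim: l j => [|v l IHl] j Cl a; first by rewrite /remn /= ?cats0; case: j.
case: j => [|j]; rewrite /remn /=.
  by rewrite drop0 => al; apply: Cl; right.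
case=> [<-|al]; first by apply: Cl; left.
by apply: (IHl j) => // b bl; apply: Cl; right.
Qed.

Lemma bdfB F G l : bdf (fun s => F s - G s) l = bdf F l - bdf G l.
Proof.
by rewrite !bdfE -sumrB; apply: eq_bigr => j _; rewrite mulrBr.
Qed.

Lemma bdfD F G l : bdf (fun s => F s + G s) l = bdf F l + bdf G l.
Proof.
by rewrite !bdfE -big_split; apply: eq_bigr => j _; rewrite mulrDr.
Qed.

Lemma bdf0 l : bdf (fun=> 0) l = 0.
Proof. by rewrite bdfE big1 // => j _; rewrite mulr0. Qed.

Lemma bdf_bdf F l : bdf (bdf F) l = 0.
Proof.
elim: l F => [//|v l IHl] F /=.
by rewrite bdfB IHl subr0 subrr.
Qed.

Definition allin (C : set E) l := forall a, List.In a l -> C a.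

Lemma allin_cons (C : set E) a l : C a -> allin C l -> allin C (a :: l).
Proof. by move=> Ca Cl b /= [<-//|/Cl]. Qed.

End Functionals.

Lemma bdf_map (E E' : Type) (h : E -> E') (F : seq E' -> rat) l :
  bdf F (map h l) = bdf (fun s => F (map h s)) l.
Proof. by elim: l F => [//|v l IHl] F /=; rewrite IHl. Qed.

(** * Barycentric subdivision of affine simplices *)

Section Subdivision.
Variables (R : realType) (E : lmodType R).
Implicit Types (F G : seq E -> rat) (l : seq E) (C : set E).

Definition bary l : E := (size l)%:R^-1 *: \sum_(a <- l) a.

(** The transpose of Sd s = b.Sd(d s), the cone from the barycentre over the subdivided boundary.
    The counter stands for the number of vertices and makes the recursion structural, faces not
    being subterms of [l]. *)
Fixpoint sdn n F l : rat :=
  if n is m.+1 then bdf (sdn m (fun s => F (bary l :: s))) l else F l.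

Definition sdf F l := sdn (size l) F l.

(** The transpose of T s = b.(s - T(d s)), the classical homotopy with d T + T d = 1 - Sd. *)
Fixpoint htn n F l : rat :=
  if n is m.+1 then
    F (bary l :: l) - bdf (htn m (fun s => F (bary l :: s))) l
  else 0.

Definition htf F l := htn (size l) F l.

Definition cvx C := forall a b (t : R), C a -> C b -> 0 <= t -> t <= 1 ->
  C (t *: a + (1 - t) *: b).

Lemma cvx_comb C (I : Type) (r : seq I) (w : I -> R) (v : I -> E) : cvx C ->
  (forall i, List.In i r -> 0 <= w i) -> (forall i, List.In i r -> C (v i)) ->
  0 < \sum_(i <- r) w i ->
  C ((\sum_(i <- r) w i)^-1 *: \sum_(i <- r) w i *: v i).
Proof.
move=> cC; elim: r => [|i r IHr] w0 Cv; first by rewrite big_nil ltxx.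
rewrite !big_cons.
have wi0 : 0 <= w i by apply: w0; left.
have Ci : C (v i) by apply: Cv; left.
have wr0 : forall j, List.In j r -> 0 <= w j by move=> j jr; apply: w0; right.
have : 0 <= \sum_(i <- r) w i.
  elim: (r) wr0 => [|j s IHs] ws; first by rewrite big_nil.
  rewrite big_cons addr_ge0 //; first by apply: ws; left.
  by apply: IHs => k ks; apply: ws; right.
(* A tail of total weight zero has no normalised combination, so the induction hypothesis says
   nothing about it; in that case all its weights are zero. *)
rewrite le0r => /predU1P[s0|s_gt0] pos; last first.
  have := cC _ _ (w i / (w i + \sum_(i <- r) w i)) Ci
    (IHr wr0 (fun j jr => Cv j (or_intror jr)) s_gt0).
  set s := \sum_(i <- r) w i in s_gt0 pos *; set x := \sum_(i <- r) _.
  move=> /(_ (divr_ge0 wi0 (ltW pos))).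
  rewrite ler_pdivrMr // mul1r lerDl => /(_ (ltW s_gt0)).
  congr C; rewrite scalerDr !scalerA mulrC; congr (_ + _ *: _).
  by field; rewrite !gt_eqF.
have w00 : forall j, List.In j r -> w j = 0.
  elim: (r) wr0 s0 => [//|j s IHs] ws; rewrite big_cons => /eqP.
  have wj : 0 <= w j by apply: ws; left.
  have wss : forall k, List.In k s -> 0 <= w k by move=> k ks; apply: ws; right.
  have ss : 0 <= \sum_(k <- s) w k.
    elim: (s) wss => [|k s' IHs'] ws'; first by rewrite big_nil.
    rewrite big_cons addr_ge0 //; first by apply: ws'; left.
    by apply: IHs' => m ms; apply: ws'; right.
  rewrite paddr_eq0 // => /andP[/eqP wj0 /eqP ss0] k /= [<-//|ks].
  exact: IHs.
have -> : \sum_(j <- r) w j *: v j = 0.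
  elim: (r) w00 => [|j s IHs] ws; first by rewrite big_nil.
  rewrite big_cons ws ?scale0r ?add0r; last by left.
  by apply: IHs => k ks; apply: ws; right.
by rewrite s0 !addr0 scalerA mulVf ?scale1r//; move: pos; rewrite s0 addr0 lt0r => /andP[].
Qed.

Lemma cvx_bary C l : cvx C -> allin C l -> l <> [::] -> C (bary l).
Proof.
move=> cC Cl l0; have s0 : 0 < \sum_(a <- l) (1 : R).
  rewrite big_const_seq count_predT iter_addr_0.
  by case: (l) l0 => // a l'; rewrite pmulrn_lgt0.
have := cvx_comb (v := id) cC (fun _ _ => ler01) Cl s0.
rewrite /bary (eq_bigr id) => [|i _]; last exact: scale1r.
by rewrite big_const_seq count_predT iter_addr_0.
Qed.

Lemma bdf_allin F G l C : allin C l ->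
  (forall s, size s = (size l).-1 -> allin C s -> F s = G s) -> bdf F l = bdf G l.
Proof.
move=> Cl FG; apply: eq_bdf => j jl; apply: FG; first exact: size_remn.
exact: remn_sub.
Qed.

Lemma eq_sdn n F G l C : cvx C -> size l = n -> allin C l ->
  (forall s, size s = n -> allin C s -> F s = G s) -> sdn n F l = sdn n G l.
Proof.
elim: n F G l => [|n IHn] F G l cC sl Cl FG /=; first exact: FG.
apply: (bdf_allin Cl) => s; rewrite sl => /= ss Cs; apply: IHn => // s' ss' Cs'.
apply: FG; first by rewrite /= ss'.
by apply: allin_cons => //; apply: (cvx_bary cC Cl) => l0; rewrite l0 in sl.
Qed.

Lemma eq_htn n F G l C : cvx C -> size l = n -> allin C l ->
  (forall s, size s = n.+1 -> allin C s -> F s = G s) -> htn n F l = htn n G l.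
Proof.
elim: n F G l => [//|n IHn] F G l cC sl Cl FG /=.
have Cb : C (bary l) by apply: (cvx_bary cC Cl) => l0; rewrite l0 in sl.
rewrite FG /= ?sl //; last exact: allin_cons.
congr (_ - _); apply: (bdf_allin Cl) => s; rewrite sl => /= ss Cs.
apply: IHn => // s' ss' Cs'; apply: FG; first by rewrite /= ss'.
exact: allin_cons.
Qed.

Lemma sdnB n F G l : sdn n (fun s => F s - G s) l = sdn n F l - sdn n G l.
Proof.
elim: n F G l => [//|n IHn] F G l /=; rewrite -bdfB.
by apply: eq_bdf => j _; rewrite IHn.
Qed.

Lemma htnB n F G l : htn n (fun s => F s - G s) l = htn n F l - htn n G l.
Proof.
elim: n F G l => [|n IHn] F G l /=; first by rewrite subrr.
rewrite (@eq_bdf _ _ (fun s => htn n (fun s => F (bary l :: s)) s -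
   htn n (fun s => G (bary l :: s)) s)); last by move=> j _; rewrite IHn.
rewrite bdfB; ring.
Qed.

Lemma sdn_bdf n F l : size l = n -> sdn n (bdf F) l = bdf (sdn n.-1 F) l.
Proof.
elim: n F l => [|n IHn] F l sl /=; first by rewrite (size0nil sl).
set b := bary l; rewrite (@eq_bdf _ _ (fun s => sdn n F s -
   bdf (sdn n.-1 (fun s => F (b :: s))) s)).
  by rewrite bdfB bdf_bdf subr0.
move=> j jl; rewrite sdnB IHn // size_remn // sl //.
Qed.

Lemma sdf_bdf F l : sdf (bdf F) l = bdf (sdf F) l.
Proof.
rewrite /sdf sdn_bdf //; apply: eq_bdf => j jl.
by rewrite size_remn.
Qed.

Lemma htn_bdf n F l : size l = n ->
  htn n (bdf F) l = F l - sdn n F l - bdf (htn n.-1 F) l.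
Proof.
elim: n F l => [|n IHn] F l sl /=; first by rewrite (size0nil sl) /=; ring.
set b := bary l.
rewrite (@eq_bdf _ (htn n (fun s => F s - bdf (fun s0 => F (b :: s0)) s)) (fun s => (htn n F s - (F (b :: s) - sdn n (fun s => F (b :: s)) s))
   + bdf (htn n.-1 (fun s => F (b :: s))) s)); last first.
  move=> j jl; rewrite (htnB n F (bdf (fun s => F (b :: s)))) IHn /=; [ring|by rewrite size_remn // sl].
rewrite bdfD !bdfB bdf_bdf; ring.
Qed.

Lemma htf_bdf F l : htf (bdf F) l = F l - sdf F l - bdf (htf F) l.
Proof.
rewrite /htf htn_bdf //; congr (_ - _); apply: eq_bdf => j jl.
by rewrite size_remn.
Qed.

End Subdivision.

Section SubdivisionMap.
Variables (R : realType) (E E' : lmodType R) (h : {linear E -> E'}).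

Lemma bary_map l : h (bary l) = bary (map h l).
Proof. by rewrite /bary linearZ /= linear_sum size_map big_map. Qed.

Lemma sdn_map n F l : sdn n F (map h l) = sdn n (fun s => F (map h s)) l.
Proof.
elim: n F l => [//|n IHn] F l /=; rewrite bdf_map; apply: eq_bdf => j _.
by rewrite IHn -bary_map.
Qed.

Lemma htn_map n F l : htn n F (map h l) = htn n (fun s => F (map h s)) l.
Proof.
elim: n F l => [//|n IHn] F l /=; rewrite bdf_map -bary_map; congr (_ - _).
by apply: eq_bdf => j _; rewrite IHn.
Qed.

End SubdivisionMap.

(** * The prism operator *)

Section Prism.
Variables (E : Type) (R : realType).
Implicit Types (F G : seq (E * R) -> rat) (l : seq E).

Definition at0 (v : E) : E * R := (v, 0).
Definition at1 (v : E) : E * R := (v, 1).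

(** The transpose of the sum of (-1)^i [v_0 .. v_i, w_i .. w_n], with the v_i on the bottom and the
    w_i on the top of the prism. *)
Fixpoint prf F l : rat :=
  if l is v :: l' then
    F (at0 v :: map at1 l) - prf (fun s => F (at0 v :: s)) l'
  else 0.

Lemma prfB F G l : prf (fun s => F s - G s) l = prf F l - prf G l.
Proof. by elim: l F G => [|v l IHl] F G /=; rewrite ?subrr // IHl; ring. Qed.

Lemma eq_prf F G l (C : set E) : allin C l ->
  (forall s, size s = (size l).+1 ->
     allin [set p | C p.1 /\ 0 <= p.2 /\ p.2 <= 1] s -> F s = G s) ->
  prf F l = prf G l.
Proof.
move=> Cl FG; elim: l F G Cl FG => [//|v l IHl] F G Cl FG /=.
have Cv : C v by apply: Cl; left.
have Cl' : allin C l by move=> a al; apply: Cl; right.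
congr (_ - _).
  apply: FG => [|a /=]; first by rewrite /= size_map.
  case=> [<-|[<-|]] /=; rewrite ?lexx ?ler01 //.
  by move/List.in_map_iff => [x [<- /Cl' Cx]] /=; rewrite ?lexx ?ler01; auto.
apply: IHl => // s ss Cs; apply: FG => [|a /=]; first by rewrite /= ss.
by case=> [<-|/Cs//] /=; rewrite lexx ler01.
Qed.

Lemma prf_bdf F l :
  prf (bdf F) l = F (map at1 l) - F (map at0 l) - bdf (prf F) l.
Proof.
elim: l F => [|v l IHl] F /=; first ring.
rewrite prfB IHl bdf_map bdfB.
rewrite (@eq_bdf _ (fun s => F (at0 v :: at1 v :: [seq at1 i | i <- s]))
  (fun s => F (at0 v :: map at1 (v :: s)))) //.
ring.
Qed.

End Prism.

Lemma prf_map (E E' : Type) (R : realType) (h : E -> E') (F : seq (E' * R) -> rat) l :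
  prf F (map h l) = prf (fun s => F (map (fun p => (h p.1, p.2)) s)) l.
Proof.
elim: l F => [//|v l IHl] F /=; rewrite IHl -!map_comp; congr (_ - _).
Qed.

(** * Singular cochains *)

Lemma within_contP (S U : topologicalType) (A : set S) (f : S -> U) :
  {within A, continuous f} <->
  (forall x, A x -> forall B, nbhs (f x) B -> \forall y \near x, A y -> B (f y)).
Proof.
split; first by move=> /subspace_continuousP fc x Ax B /(fc x Ax).
by move=> fc; apply/subspace_continuousP => x Ax B /(fc x Ax).
Qed.

Section Singular.
Variable R : realType.
Notation Delta k := (stdsimplex R k).

(* Precomposing with [clamp] makes the values outside the simplex irrelevant. *)
Definition clamp k (x : 'rV[R]_k.+1) : 'rV[R]_k.+1 :=
  if `[< Delta k x >] then x else delta_mx 0 ord0.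

Lemma Delta_vert k (i : 'I_k.+1) : Delta k (delta_mx 0 i).
Proof.
split=> [j|]; first by rewrite mxE ler0n.
rewrite (bigD1 i) //= mxE !eqxx big1 ?addr0 // => j ji.
by rewrite mxE (negbTE ji) andbF.
Qed.

Lemma clamp_in k x : Delta k (clamp x).
Proof. by rewrite /clamp; case: (asboolP (Delta k x)) => // _; exact: Delta_vert. Qed.

Lemma clamp_id k x : Delta k x -> clamp x = x.
Proof. by move=> Dx; rewrite /clamp; case: (asboolP (Delta k x)). Qed.

Lemma cvx_Delta k : cvx (Delta k).
Proof.
move=> a b t [a0 a1] [b0 b1] t0 t1; split=> [j|].
  by rewrite !mxE addr_ge0 // mulr_ge0 // subr_ge0.
rewrite (eq_bigr (fun j => t * a 0 j + (1 - t) * b 0 j)).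
  by rewrite big_split /= -!mulr_sumr a1 b1; ring.
by move=> j _; rewrite !mxE.
Qed.

Lemma Delta_face k j (x : 'rV[R]_k.+1) : Delta k x -> Delta k.+1 (face_incl R k j x).
Proof.
move=> [x0 x1]; split=> [i|].
  by rewrite mxE; case: unlift.
rewrite (bigD1_ord j) //= mxE unlift_none add0r -[RHS]x1.
by apply: eq_bigr => i _; rewrite mxE liftK.
Qed.

Definition comb (E : lmodType R) m (l : seq E) (x : 'rV[R]_m) : E :=
  \sum_(j < m) x 0 j *: l`_j.

Lemma comb_is_linear (E : lmodType R) m (l : seq E) : linear (@comb E m l).
Proof.
move=> a x y; rewrite /comb scaler_sumr -big_split; apply: eq_bigr => j _ /=.
by rewrite !mxE scalerDl scalerA.
Qed.
HB.instance Definition _ (E : lmodType R) m (l : seq E) :=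
  GRing.isLinear.Build R 'rV[R]_m E _ (@comb E m l) (@comb_is_linear E m l).

Lemma comb_map (E E' : lmodType R) (h : {linear E -> E'}) m (l : seq E) (x : 'rV[R]_m) :
  h (comb l x) = comb (map h l) x.
Proof.
rewrite linear_sum; apply: eq_bigr => j _; rewrite linearZ /=.
case: (ltnP j (size l)) => jl; first by rewrite (nth_map 0).
by rewrite !nth_default ?size_map // linear0.
Qed.

Lemma allin_nth (E : zmodType) (C : set E) (l : seq E) j :
  allin C l -> (j < size l)%N -> C l`_j.
Proof.
move=> Cl jl; apply: Cl; elim: l j jl => [//|a l IHl] [|j] /= jl; [by left|right].
exact: IHl.
Qed.

Lemma comb_in (E : lmodType R) m (l : seq E) (x : 'rV[R]_m.+1) (C : set E) : cvx C ->
  size l = m.+1 -> allin C l -> Delta m x -> C (comb l x).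
Proof.
move=> cC sl Cl [x0 x1].
have Cn (i : 'I_m.+1) : List.In i (index_enum 'I_m.+1) -> C l`_i.
  by move=> _; apply: allin_nth; rewrite ?sl.
have := @cvx_comb R E C _ (index_enum 'I_m.+1) (fun j => x 0 j) (fun j => l`_j) cC
  (fun i _ => x0 i) Cn.
by rewrite x1 invr1 scale1r; apply.
Qed.

Lemma comb_face (E : lmodType R) m (l : seq E) (j : 'I_m.+2) (x : 'rV[R]_m.+1) :
  size l = m.+2 -> comb l (face_incl R m j x) = comb (remn j l) x.
Proof.
move=> sl; rewrite /comb (bigD1_ord j) //= mxE unlift_none scale0r add0r.
apply: eq_bigr => i _; rewrite mxE liftK; congr (_ *: _).
rewrite /remn nth_cat size_take sl ltn_ord /= /bump leqNgt.
case: ltnP => ij /=; first by rewrite add0n nth_take.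
by rewrite add1n nth_drop; congr nth; lia.
Qed.

Section Cochains.
Variable T : Type.

Definition sface k (j : 'I_k.+2) (f : 'rV[R]_k.+2 -> T) : 'rV[R]_k.+1 -> T :=
  fun x => f (face_incl R k j (clamp x)).

Definition cochains := forall k, ('rV[R]_k.+1 -> T) -> rat.

Definition cob (c : cochains) : cochains := fun k =>
  match k with
  | 0 => fun=> 0
  | k'.+1 => fun f => \sum_(j < k'.+2) (-1) ^+ j * c k' (sface j f)
  end.

Definition asx (E : lmodType R) (h : E -> T) (l : seq E) m : 'rV[R]_m.+1 -> T :=
  fun x => h (comb l (clamp x)).

(** Turns a cochain into a functional on vertex sequences, where [bdf] applies. The value 0 on the
    empty sequence cancels the augmentation. *)
Definition evc (E : lmodType R) (c : cochains) (h : E -> T) (l : seq E) : rat :=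
  match size l with 0 => 0 | m.+1 => c m (asx h l (m := m)) end.

Lemma sface_asx (E : lmodType R) (h : E -> T) l m (j : 'I_m.+2) : size l = m.+2 ->
  sface j (asx h l (m := m.+1)) = asx h (remn j l) (m := m).
Proof.
move=> sl; apply/funext => x; rewrite /sface /asx clamp_id ?comb_face //.
exact/Delta_face/clamp_in.
Qed.

Lemma bdf_evc (E : lmodType R) c (h : E -> T) l : bdf (evc c h) l = evc (cob c) h l.
Proof.
rewrite bdfE /evc; case sl : (size l) => [|m]; first by rewrite big_ord0.
case: m sl => [|m] sl.
  by rewrite big_ord1 size_remn ?sl //= mulr0.
apply: eq_bigr => j _; rewrite size_remn ?sl //=; congr (_ * _).
by rewrite sface_asx.
Qed.

Lemma asx_asx (E : lmodType R) (h : E -> T) l k l' m : size l' = m.+1 ->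
  allin (Delta k) l' ->
  asx (asx h l (m := k)) l' (m := m) = asx h (map (comb l) l') (m := m).
Proof.
move=> sl' Dl'; apply/funext => x; rewrite /asx clamp_id ?(comb_map (comb l)) //.
by apply: comb_in => //; [exact: cvx_Delta|exact: clamp_in].
Qed.

Lemma evc_asx (E : lmodType R) c (h : E -> T) l k l' : allin (Delta k) l' ->
  evc c (asx h l (m := k)) l' = evc c h (map (comb l) l').
Proof.
move=> Dl'; rewrite /evc size_map; case sl' : (size l') => [//|m].
by rewrite asx_asx.
Qed.

Definition verts k : seq 'rV[R]_k.+1 := [seq delta_mx 0 i | i <- enum 'I_k.+1].

Lemma size_verts k : size (verts k) = k.+1.
Proof. by rewrite size_map size_enum_ord. Qed.

Lemma nth_verts k (j : 'I_k.+1) : (verts k)`_j = delta_mx 0 j.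
Proof. by rewrite (nth_map ord0) ?size_enum_ord // nth_ord_enum. Qed.

Lemma allin_verts k : allin (Delta k) (verts k).
Proof.
move=> a /List.in_map_iff [i [<- _]]; exact: Delta_vert.
Qed.

Lemma comb_verts k x : comb (verts k) x = x.
Proof.
apply/rowP => j; rewrite summxE (bigD1 j) //= nth_verts !mxE !eqxx mulr1.
rewrite big1 ?addr0 // => i ij; rewrite nth_verts !mxE.
by rewrite eq_sym (negbTE ij) andbF mulr0.
Qed.

Lemma map_comb_verts (E : lmodType R) (l : seq E) m : size l = m.+1 ->
  map (comb l) (verts m) = l.
Proof.
move=> sl; apply: (@eq_from_nth _ 0) => [|i]; rewrite size_map size_verts // => im.
rewrite (nth_map 0) ?size_verts // (nth_verts (Ordinal im)) /comb.
rewrite (bigD1 (Ordinal im)) //= mxE !eqxx scale1r big1 ?addr0 // => j ji.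
by rewrite mxE (negbTE ji) andbF scale0r.
Qed.

Lemma asx_verts k (f : 'rV[R]_k.+1 -> T) : (forall x, f (clamp x) = f x) ->
  asx f (verts k) (m := k) = f.
Proof. by move=> fc; apply/funext => x; rewrite /asx comb_verts. Qed.

End Cochains.

Section Simplices.
Variable T : topologicalType.

(** Invariance under [clamp] makes a singular simplex determined by its values on the standard
    simplex, so that equality of simplices is equality of functions. *)
Definition sing (X : set T) k (f : 'rV[R]_k.+1 -> T) :=
  [/\ forall x, f (clamp x) = f x, forall x, Delta k x -> X (f x) &
      {within Delta k, continuous f}].

Lemma sing_sub (X Y : set T) k (f : 'rV[R]_k.+1 -> T) : X `<=` Y -> sing X f -> sing Y f.
Proof. by move=> XY [fc fX fC]; split=> // x /fX /XY. Qed.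

Lemma sing_all (X : set T) k (f : 'rV[R]_k.+1 -> T) x : sing X f -> X (f x).
Proof. by move=> [fc fX _]; rewrite -fc; apply/fX/clamp_in. Qed.

Lemma continuous_comb (E : normedModType R) m (l : seq E) : continuous (@comb E m l).
Proof.
apply: continuous_big => [|j _ x]; first exact: add_continuous.
by apply: (@continuousZr_tmp R E); exact: coord_continuous.
Qed.

Lemma sing_asx (E : normedModType R) (X : set T) (C : set E) (h : E -> T) l m :
  cvx C -> size l = m.+1 -> allin C l -> {within C, continuous h} ->
  (forall e, C e -> X (h e)) -> sing X (asx h l (m := m)).
Proof.
move=> cC sl Cl hc hX; split=> [x|x Dx|].
- by rewrite /asx (clamp_id (clamp_in x)).
- by apply: hX; apply: comb_in (clamp_in _).
- apply/within_contP => x Dx A; rewrite /asx clamp_id // => fA.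
  have /within_contP/(_ _ (comb_in cC sl Cl Dx) _ fA) HA := hc.
  have Hx : nbhs x (fun y => C (comb l y) -> A (h (comb l y))).
    exact: (@continuous_comb E m.+1 l x _ HA).
  apply: (@filterS _ (nbhs x) _ _ _ _ Hx) => y /= Hy Dy.
  by rewrite clamp_id //; apply: Hy; apply: comb_in Dy.
Qed.

Lemma sing_face (X : set T) k (j : 'I_k.+2) (f : 'rV[R]_k.+2 -> T) :
  sing X f -> sing X (sface j f).
Proof.
move=> [fc fX fC]; rewrite -[f](asx_verts fc) sface_asx ?size_verts //.
apply: (sing_asx (C := Delta k.+1)) => //; first exact: cvx_Delta.
  by rewrite size_remn size_verts.
by apply: (@remn_sub _ j _ (Delta k.+1)); exact: allin_verts.
Qed.

End Simplices.

End Singular.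

(** * Mesh of iterated subdivisions *)

Section Mesh.
Variables (R : realType) (E : normedModType R).
Implicit Types (F : seq E -> rat) (l s : seq E) (C : set E).

Definition diam l (d : R) := forall a b, List.In a l -> List.In b l -> `|a - b| <= d.

Lemma cvx_ball (b : E) (r : R) : cvx [set w : E | `|b - w| <= r].
Proof.
move=> x y t /= xr yr t0 t1.
have -> : b - (t *: x + (1 - t) *: y) = t *: (b - x) + (1 - t) *: (b - y).
  rewrite !scalerBr addrACA -scalerDl (_ : t + (1 - t) = 1) ?scale1r ?opprD //; ring.
rewrite (le_trans (ler_normD _ _)) // !normrZ !ger0_norm ?subr_ge0 //.
have h : 0 <= 1 - t by rewrite subr_ge0.
by have := ler_wpM2l t0 xr; have := ler_wpM2l h yr; lra.
Qed.

Lemma cvxI (C D : set E) : cvx C -> cvx D -> cvx (C `&` D).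
Proof. by move=> cC cD a b t [Ca Da] [Cb Db] t0 t1; split; [exact: cC|exact: cD]. Qed.

(** The difference [bary l - w] is the mean of the [n.+1] differences [a - w]; the one with [a = w]
    vanishes and the others have norm at most [d]. *)
Lemma bary_dist n l d w : size l = n.+1 -> diam l d -> List.In w l ->
  `|bary l - w| <= n%:R / n.+1%:R * d.
Proof.
move=> sl dl wl.
have n0 : n.+1%:R != 0 :> R by rewrite pnatr_eq0.
have -> : bary l - w = (n.+1%:R)^-1 *: \sum_(a <- l) (a - w).
  rewrite sumrB big_const_seq count_predT iter_addr_0 sl scalerBr -[w *+ _]scaler_nat.
  by rewrite scalerA mulVf // scale1r /bary sl.
rewrite normrZ ger0_norm ?invr_ge0 ?ler0n // [n%:R / _]mulrC -mulrA.
rewrite ler_wpM2l ?invr_ge0 ?ler0n // (le_trans (ler_norm_sum _ _ _)) //.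
have d0 : 0 <= d by apply: le_trans (dl w w wl wl); rewrite normr_ge0.
suff H (s : seq E) : (forall a, List.In a s -> `|a - w| <= d) ->
    \sum_(a <- s) `|a - w| <= (size s)%:R * d /\
    (List.In w s -> \sum_(a <- s) `|a - w| <= (size s).-1%:R * d).
  by have [_ /(_ wl)] := H l (fun a al => dl a w al wl); rewrite sl.
elim: s => [|a s IHs] sd; first by rewrite big_nil mul0r.
have [|s1 s2] := IHs; first by move=> b bs; apply: sd; right.
have da : `|a - w| <= d by apply: sd; left.
rewrite big_cons /=; split; first by rewrite -natr1 mulrDl mul1r addrC lerD.
case=> [aw|ws]; first by rewrite aw subrr normr0 add0r.
have := s2 ws; case: (s) ws => [//|b s'] _ /= ss.
by rewrite -natr1 mulrDl mul1r addrC lerD.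
Qed.

Lemma rho_le n (d : R) : 0 <= d -> n.-1%:R / n%:R * d <= n%:R / n.+1%:R * d.
Proof.
move=> d0; rewrite ler_wpM2r //; case: n => [|n] /=; first by rewrite mul0r.
rewrite ler_pdivrMr ?ltr0n // mulrAC ler_pdivlMr ?ltr0n // -!natrM ler_nat; lia.
Qed.

Lemma sdn_mesh n F l d C : cvx C -> size l = n -> allin C l -> 0 <= d ->
  diam l d ->
  (forall s, size s = n -> allin C s -> diam s (n.-1%:R / n%:R * d) -> F s = 0) ->
  sdn n F l = 0.
Proof.
elim: n F l C => [|n IHn] F l C cC sl Cl d0 dl F0 /=.
  by apply: F0 => //; rewrite (size0nil sl).
(* The ball around the barycentre is convex and contains the vertices of [l], hence also every
   vertex produced by subdividing the faces; this bounds the distances to the new cone point. *)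
pose D := C `&` [set w : E | `|bary l - w| <= n%:R / n.+1%:R * d].
have Dl : allin D l.
  by move=> w wl; split; [exact: Cl|exact: bary_dist].
rewrite -(bdf0 l); apply: eq_bdf => j jl.
have sub : forall a, List.In a (remn j l) -> List.In a l.
  exact: (@remn_sub _ j l (fun a => List.In a l)).
apply: (IHn _ _ D) => //.
- by apply: cvxI => //; exact: cvx_ball.
- by rewrite size_remn // sl.
- exact: (@remn_sub _ j l D).
- by move=> a b /sub al /sub bl; exact: dl.
move=> s ss Ds ds; apply: F0; first by rewrite /= ss.
  apply: allin_cons => [|a /Ds[]//].
  by apply: (cvx_bary cC Cl) => l0; rewrite l0 in sl.
have rn := rho_le n d0.
move=> a b /= [<-|/[dup] sa /Ds[_ /= ab]] [<-|/[dup] sb /Ds[_ /= bb]] //.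
- by rewrite subrr normr0 mulr_ge0 // divr_ge0.
- by rewrite distrC.
- exact: le_trans (ds _ _ sa sb) rn.
Qed.

Lemma iter_sdf_mesh m n F l d C : cvx C -> size l = n.+1 -> allin C l -> 0 <= d ->
  diam l d ->
  (forall s, size s = n.+1 -> allin C s ->
     diam s ((n%:R / n.+1%:R) ^+ m * d) -> F s = 0) ->
  iter m (@sdf R E) F l = 0.
Proof.
elim: m F l d => [|m IHm] F l d cC sl Cl d0 dl F0.
  by apply: F0; rewrite ?expr0 ?mul1r.
rewrite iterS /sdf; apply: (sdn_mesh cC _ Cl d0 dl) => // s.
rewrite sl /= => ss Cs ds; apply: (IHm _ _ (n%:R / n.+1%:R * d)) => //.
  by rewrite mulr_ge0 // divr_ge0.
by move=> s' ss' Cs'; rewrite mulrA -exprSr; exact: F0.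
Qed.

End Mesh.

(** * The singular cochain complex and subdivision of cochains *)

Section Complex.
Variable R : realType.
Notation Delta k := (stdsimplex R k).

Section OneSpace.
Variable T : topologicalType.
Implicit Types (X Y : set T) (c : cochains R T).

Definition ceq X c c' := forall k (f : 'rV[R]_k.+1 -> T), sing X f -> c k f = c' k f.
Definition coch0 : cochains R T := fun _ _ => 0.
Definition cochD c c' : cochains R T := fun k f => c k f + c' k f.
Definition cochB c c' : cochains R T := fun k f => c k f - c' k f.
Definition cochZ (q : rat) c : cochains R T := fun k f => q * c k f.
Definition cocyc X c := ceq X (cob c) coch0.

Lemma ceq_sub X Y c c' : X `<=` Y -> ceq Y c c' -> ceq X c c'.
Proof. by move=> XY cc k f /(sing_sub XY) /cc. Qed.

Lemma ceq_cob X c c' : ceq X c c' -> ceq X (cob c) (cob c').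
Proof.
move=> cc [//|k] f Xf /=; apply: eq_bigr => j _.
by rewrite cc //; exact: sing_face.
Qed.

Lemma cobD c c' k (f : 'rV[R]_k.+1 -> T) : cob (cochD c c') f = cob c f + cob c' f.
Proof.
case: k f => [|k] f /=; first by rewrite addr0.
by rewrite -big_split; apply: eq_bigr => j _ /=; rewrite -mulrDr.
Qed.

Lemma cobB c c' k (f : 'rV[R]_k.+1 -> T) : cob (cochB c c') f = cob c f - cob c' f.
Proof.
case: k f => [|k] f /=; first by rewrite subr0.
by rewrite -sumrB; apply: eq_bigr => j _; rewrite -mulrBr.
Qed.

Lemma cobZ q c k (f : 'rV[R]_k.+1 -> T) : cob (cochZ q c) f = q * cob c f.
Proof.
case: k f => [|k] f /=; first by rewrite mulr0.
by rewrite mulr_sumr; apply: eq_bigr => j _; rewrite mulrCA.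
Qed.

Lemma cob0 k (f : 'rV[R]_k.+1 -> T) : cob coch0 f = 0.
Proof. by case: k f => [|k] f //=; rewrite big1 // => j _; rewrite mulr0. Qed.

Lemma cob_bdf X c k (f : 'rV[R]_k.+1 -> T) : sing X f ->
  cob c f = bdf (evc c f) (verts R k).
Proof.
move=> [fc _ _]; rewrite bdf_evc /evc size_verts.
by rewrite asx_verts.
Qed.

Lemma evc_verts X c k (f : 'rV[R]_k.+1 -> T) : sing X f -> evc c f (verts R k) = c k f.
Proof. by move=> [fc _ _]; rewrite /evc size_verts asx_verts. Qed.

Lemma cob_cob X c : ceq X (cob (cob c)) coch0.
Proof.
move=> k f Xf; rewrite (cob_bdf _ Xf) (_ : evc (cob c) f = bdf (evc c f)).
  exact: bdf_bdf.
by apply/funext => l; rewrite bdf_evc.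
Qed.

Lemma evc_ceq X c c' k (f : 'rV[R]_k.+1 -> T) l : sing X f -> ceq X c c' ->
  allin (Delta k) l -> evc c f l = evc c' f l.
Proof.
move=> [fc fX fC] cc Dl; rewrite /evc; case sl : (size l) => [//|m].
by apply: cc; apply: (sing_asx _ sl Dl) => //; exact: cvx_Delta.
Qed.

(** A singular simplex is regarded as a map out of the affine simplex with vertices [verts], where
    the operators on functionals are available. *)
Definition sdc c : cochains R T := fun k f => sdf (evc c f) (verts R k).
Definition htc c : cochains R T := fun k f => htf (evc c f) (verts R k).

Lemma evc_sdc c k (f : 'rV[R]_k.+1 -> T) l : allin (Delta k) l ->
  evc (sdc c) f l = sdf (evc c f) l.
Proof.
move=> Dl; rewrite /evc /sdc; case sl : (size l) => [|m].
  by rewrite (size0nil sl) /sdf /=.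
rewrite -[in RHS](map_comb_verts sl) /sdf size_map size_verts sdn_map.
apply: (eq_sdn (@cvx_Delta R m)); rewrite ?size_verts //; first exact: allin_verts.
by move=> s _ Ds; rewrite evc_asx.
Qed.

Lemma evc_htc c k (f : 'rV[R]_k.+1 -> T) l : allin (Delta k) l ->
  evc (htc c) f l = htf (evc c f) l.
Proof.
move=> Dl; rewrite /evc /htc; case sl : (size l) => [|m].
  by rewrite (size0nil sl) /htf /=.
rewrite -[in RHS](map_comb_verts sl) /htf size_map size_verts htn_map.
apply: (eq_htn (@cvx_Delta R m)); rewrite ?size_verts //; first exact: allin_verts.
by move=> s _ Ds; rewrite evc_asx.
Qed.

Lemma sdc_ceq X c c' : ceq X c c' -> ceq X (sdc c) (sdc c').
Proof.
move=> cc k f Xf; apply: (eq_sdn (@cvx_Delta R k)) => //; first exact: allin_verts.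
by move=> s _ Ds; exact: evc_ceq Xf cc Ds.
Qed.

Lemma htc_ceq X c c' : ceq X c c' -> ceq X (htc c) (htc c').
Proof.
move=> cc k f Xf; apply: (eq_htn (@cvx_Delta R k)) => //; first exact: allin_verts.
by move=> s _ Ds; exact: evc_ceq Xf cc Ds.
Qed.

Lemma evc0 (E : lmodType R) (h : E -> T) : evc coch0 h = fun=> 0.
Proof. by apply/funext => l; rewrite /evc; case: (size l). Qed.

Lemma sdn0 (E : lmodType R) n (l : seq E) : sdn n (fun=> 0) l = 0.
Proof. by have := sdnB n (fun=> 0) (fun=> 0) l; rewrite subrr => ->; rewrite subrr. Qed.

Lemma htc0 k (f : 'rV[R]_k.+1 -> T) : htc coch0 f = 0.
Proof.
rewrite /htc evc0 /htf.
have := htnB (size (verts R k)) (fun=> 0) (fun=> 0) (verts R k).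
by rewrite subrr => ->; rewrite subrr.
Qed.

Lemma cob_sdc X c : ceq X (cob (sdc c)) (sdc (cob c)).
Proof.
move=> k f Xf; rewrite (cob_bdf _ Xf) /sdc.
rewrite (_ : evc (cob c) f = bdf (evc c f)); last first.
  by apply/funext => l; rewrite bdf_evc.
rewrite sdf_bdf; apply: (bdf_allin (@allin_verts R k)) => s _ Ds.
exact: evc_sdc.
Qed.

Lemma cob_htc X c : ceq X (cob (htc c)) (cochB (cochB c (sdc c)) (htc (cob c))).
Proof.
move=> k f Xf; rewrite /cochB (cob_bdf _ Xf) -(evc_verts c Xf) /htc.
rewrite (_ : evc (cob c) f = bdf (evc c f)); last first.
  by apply/funext => l; rewrite bdf_evc.
rewrite htf_bdf /sdc (_ : bdf (evc (htc c) f) _ = bdf (htf (evc c f)) (verts R k)).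
  ring.
by apply: (bdf_allin (@allin_verts R k)) => s _ Ds; exact: evc_htc.
Qed.

Lemma evc_iter m c k (f : 'rV[R]_k.+1 -> T) l : allin (Delta k) l ->
  evc (iter m sdc c) f l = iter m (@sdf R _) (evc c f) l.
Proof.
elim: m l => [//|m IHm] l Dl; rewrite iterS evc_sdc // /sdf.
by apply: (eq_sdn (@cvx_Delta R k) _ Dl) => // s _ Ds; exact: IHm.
Qed.

Lemma iter_sdc_ceq m X c c' : ceq X c c' -> ceq X (iter m sdc c) (iter m sdc c').
Proof. by move=> cc; elim: m => [//|m IHm]; apply: sdc_ceq. Qed.

End OneSpace.
End Complex.

(** * Small simplices *)

Section Small.
Variable R : realType.
Notation Delta k := (stdsimplex R k).

Lemma norm_Delta k (x : 'rV[R]_k.+1) : Delta k x -> `|x| <= 1.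
Proof.
move=> [x0 x1]; rewrite [leLHS]/Num.Def.normr/= mx_normrE.
apply: bigmax_le => //= -[i j] _ /=; rewrite ord1 ger0_norm // -x1.
by rewrite (bigD1 j) //= lerDl sumr_ge0.
Qed.

Lemma continuous_coord_sum k : continuous (fun x : 'rV[R]_k.+1 => \sum_j x 0 j : R).
Proof.
apply: continuous_big => [|j _ x]; first exact: add_continuous.
exact: coord_continuous.
Qed.

Lemma compact_Delta k : compact (Delta k).
Proof.
apply: bounded_closed_compact.
  exists 1; split; first exact: num_real.
  by move=> M M1 x /norm_Delta xM; apply: le_trans xM (ltW M1).
have -> : Delta k = \bigcap_(j in [set: 'I_k.+1]) [set x : 'rV[R]_k.+1 | 0 <= x 0 j]
    `&` [set x | \sum_j x 0 j = 1].
  apply/seteqP; split=> x [x0 x1]; split=> //; first by move=> j _; exact: x0.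
  by move=> j; exact: x0.
apply: closedI; last first.
  apply: (@preimage_closed _ _ _ [set y : R | y = 1]); last exact: closed_eq.
  by move=> x _; exact: continuous_coord_sum.
apply: closed_bigI => j _.
apply: (@preimage_closed _ _ _ [set y : R | 0 <= y]); last exact: closed_ge.
by move=> x _; exact: coord_continuous.
Qed.

Variable T : topologicalType.
Implicit Types (X Y : set T) (c : cochains R T).

Section Cover.
Variables (X : set T) (U : set (set T)).
Hypothesis Uo : forall O, U O -> open O.
Hypothesis UX : forall x, X x -> exists2 O, U O & O x.

(** The Lebesgue number of the cover pulled back to the simplex. It is obtained from the
    near-covering form of compactness, applied to radii tending to 0 from the right. *)
Lemma lebesgue_cover k (f : 'rV[R]_k.+1 -> T) : sing X f ->
  exists2 e : R, 0 < e & forall x, Delta k x ->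
    exists2 O, U O & forall y, Delta k y -> `|x - y| < e -> O (f y).
Proof.
move=> [fc fX fC].
have cov : near_covering (Delta k).
  exact: (iffLR (compact_near_coveringP _)) (@compact_Delta k).
have := cov R (0^'+)
  (fun e x => exists2 O, U O & forall y, Delta k y -> `|x - y| < e -> O (f y)).
case=> [x Dx|e /= e0 He].
  have [W UW Wfx] := UX (fX x Dx).
  move/within_contP: fC => /(_ x Dx W (open_nbhs_nbhs (conj (Uo UW) Wfx))).
  move=> /nbhs_ballP[d /= d0 Hd].
  exists (ball x (d / 2), [set e | e < d / 2]) => /=.
    split; first by apply: nbhsx_ballx; rewrite divr_gt0.
    by apply: nbhs_right_lt; rewrite divr_gt0.
  move=> [x' e] /= [xx' ed]; exists W => // y Dy xy; apply: Hd => //.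
  rewrite -ball_normE /= in xx' *.
  rewrite (le_lt_trans (ler_distD x' _ _)) // (splitr d) ltrD //.
  exact: lt_trans xy ed.
have e2 : 0 < e / 2 by rewrite divr_gt0.
exists (e / 2) => //.
apply: He => //; rewrite /= sub0r normrN gtr0_norm //.
by rewrite ltr_pdivrMr // ltr_pMr // ltrDl.
Qed.

Definition small k (f : 'rV[R]_k.+1 -> T) :=
  exists2 O, U O & forall x, Delta k x -> O (f x).

Lemma sdc_eventually_small c k (f : 'rV[R]_k.+1 -> T) : sing X f ->
  (forall m (g : 'rV[R]_m.+1 -> T), sing X g -> small g -> c m g = 0) ->
  exists M, forall m, (M <= m)%N -> iter m (@sdc R T) c k f = 0.
Proof.
move=> Xf c0; have [e e0 He] := lebesgue_cover Xf.
have r1 : `|k%:R / k.+1%:R : R| < 1.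
  rewrite ger0_norm ?divr_ge0 // ltr_pdivrMr ?ltr0n // mul1r ltr_nat; lia.
have : nbhs (0 : R) [set t : R | `|t| * 2 < e].
  apply/nbhs_ballP; exists (e / 2); rewrite /= ?divr_gt0 //.
  by move=> t; rewrite -ball_normE /= sub0r normrN ltr_pdivlMr.
move=> /(cvg_expr r1)[M _ HM]; exists M => m Mm.
rewrite -(evc_verts _ Xf) evc_iter; last exact: allin_verts.
have Hm : (k%:R / k.+1%:R : R) ^+ m * 2 < e.
  by have /= := HM m Mm; rewrite ger0_norm // exprn_ge0 // divr_ge0.
apply: (iter_sdf_mesh (d := 2) (n := k) (@cvx_Delta R k)) => //.
- exact: size_verts.
- exact: allin_verts.
- move=> a b /allin_verts/norm_Delta a1 /allin_verts/norm_Delta b1.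
  by rewrite (le_trans (ler_normB _ _)) // (_ : 2 = 1 + 1) ?lerD.
case=> [//|v s] ss Ds ds.
have Dv : Delta k v by apply: Ds; left.
have [W UW HW] := He v Dv.
(* All vertices, hence the whole affine simplex, stay in the ball around the first vertex [v], and
   [f] maps that ball into the single open set [W]. *)
pose C := Delta k `&` [set w | `|v - w| <= (k%:R / k.+1%:R) ^+ m * 2].
have cC : cvx C by apply: cvxI; [exact: cvx_Delta|exact: cvx_ball].
have Cs : allin C (v :: s).
  by move=> w ws; split; [exact: Ds|apply: ds => //; left].
have [fc fX fC] := Xf.
rewrite /evc ss; apply: c0.
  by apply: (sing_asx (@cvx_Delta R k) ss Ds).
exists W => // x Dx; rewrite /asx clamp_id //.
have [D1 D2] := comb_in cC ss Cs Dx.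
by apply: HW => //; apply: le_lt_trans Hm.
Qed.

Lemma small_sub W c : U W -> (forall m (g : 'rV[R]_m.+1 -> T), sing X g -> small g -> c m g = 0) ->
  ceq (X `&` W) c (@coch0 R T).
Proof.
move=> UW c0 k f Xf; apply: c0; first by apply: sing_sub Xf => x [].
by exists W => // x Dx; have [_ fX _] := Xf; have [] := fX x Dx.
Qed.

Lemma sing_small k (f : 'rV[R]_k.+1 -> T) : sing X f -> small f ->
  exists2 W, U W & sing (X `&` W) f.
Proof.
move=> [fc fX fC] [W UW fW]; exists W => //; split=> // x Dx.
by split; [exact: fX|exact: fW].
Qed.

(* The corrections vanish on a given simplex after enough subdivisions, so
   their infinite sum makes sense and bounds [c]. *)
Lemma small_acyclic c : cocyc X c ->
  (forall m (g : 'rV[R]_m.+1 -> T), sing X g -> small g -> c m g = 0) ->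
  exists2 e : cochains R T, ceq X c (cob e) &
    (forall m (g : 'rV[R]_m.+1 -> T), sing X g -> small g -> e m g = 0).
Proof.
move=> cc c0.
have h0 m (g : 'rV[R]_m.+1 -> T) : sing X g -> small g -> htc c g = 0.
  move=> Xg sg; have [W UW Wg] := sing_small Xg sg.
  by rewrite (htc_ceq (small_sub UW c0) Wg) htc0.
have it0 i m (g : 'rV[R]_m.+1 -> T) : sing X g -> small g -> iter i (@sdc R T) (htc c) m g = 0.
  move=> Xg sg; have [W UW Wg] := sing_small Xg sg.
  rewrite (iter_sdc_ceq i (small_sub UW h0) Wg).
  by elim: i m g {Xg sg Wg} => [//|i IHi] m g; rewrite iterS /sdc (_ : evc _ g = fun=> 0) ?[LHS]sdn0 //;
    apply/funext => l; rewrite /evc; case: (size l).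
(* For a cocycle the coboundary of [htc c] is [c - sdc c]; summing the subdivided copies of this
   identity telescopes to [c] minus its [M]-fold subdivision. *)
pose e_ M : cochains R T := fun k f => \sum_(i < M) iter i (@sdc R T) (htc c) k f.
have stab k (f : 'rV[R]_k.+1 -> T) : exists M, sing X f ->
    forall m, (M <= m)%N -> iter m (@sdc R T) (htc c) k f = 0.
  have [Xf|nXf] := pselect (sing X f); last by exists 0%N.
  by have [M HM] := sdc_eventually_small Xf h0; exists M.
pose N k f := xget 0%N [set M | sing X f ->
    forall m, (M <= m)%N -> iter m (@sdc R T) (htc c) k f = 0].
have NP k f : sing X f -> forall m, (N k f <= m)%N -> iter m (@sdc R T) (htc c) k f = 0.
  exact: (xgetPex 0%N (stab k f)).
pose e : cochains R T := fun k f => e_ (N k f) k f.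
have eE k f M : sing X f -> (N k f <= M)%N -> e k f = e_ M k f.
  move=> Xf NM; rewrite /e /e_ -(subnKC NM) big_split_ord /=.
  by rewrite [X in _ + X]big1 ?addr0 // => i _; apply: NP => //; rewrite leq_addr.
exists e; last first.
  by move=> m g Xg sg; rewrite /e /e_ big1 // => i _; exact: it0.
have cob_e M k f : sing X f -> cob (e_ M) f = c k f - iter M (@sdc R T) c k f.
  elim: M k f => [|M IHM] k f Xf.
    rewrite /= subrr; case: k f Xf => [//|k] f Xf /=.
    by rewrite big1 // => j _; rewrite /e_ big_ord0 mulr0.
  have -> : e_ M.+1 = cochD (e_ M) (iter M (@sdc R T) (htc c)).
    by apply: functional_extensionality_dep => m; apply/funext => g; rewrite /e_ big_ord_recr.
  rewrite cobD IHM // iterSr.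
  have -> : cob (iter M (@sdc R T) (htc c)) f = iter M (@sdc R T) (cochB c (sdc c)) k f.
    have HM : ceq X (cob (htc c)) (cochB c (sdc c)).
      move=> m g Xg; rewrite (cob_htc _ Xg) /cochB (htc_ceq cc Xg) htc0 subr0 //.
    rewrite -(iter_sdc_ceq M HM Xf).
    elim: M k f Xf {IHM} => [//|M IHM] k f Xf /=.
    by rewrite (cob_sdc _ Xf); apply: sdc_ceq Xf => m g; exact: IHM.
  have -> : iter M (@sdc R T) (cochB c (sdc c)) k f = iter M (@sdc R T) c k f - iter M (@sdc R T) (sdc c) k f.
    elim: M k f Xf {IHM} => [//|M IHM] k f Xf; rewrite !iterS.
    rewrite /sdc -sdnB; apply: (eq_sdn (@cvx_Delta R k) _ (@allin_verts R k)) => // l sl Dl.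
    rewrite /evc; case sl' : (size l) => [|m]; first by rewrite subrr.
    by apply: IHM; have [fc fX fC] := Xf; apply: (sing_asx (@cvx_Delta R k) sl' Dl).
  ring.
move=> k f Xf.
have [M0 HM0] := sdc_eventually_small Xf c0.
case: k f Xf M0 HM0 => [|k] f Xf M0 HM0.
  by have := cob_e M0 _ _ Xf; rewrite HM0 // subr0 => <-.
(* [M] is beyond the stabilisation index of every face, so that [e] may be replaced by one and the
   same partial sum on all of them. *)
pose M := (M0 + \sum_(j < k.+2) N k (sface j f))%N.
have := cob_e M _ _ Xf; rewrite HM0 ?leq_addr // subr0 => <- /=.
apply: eq_bigr => j _; rewrite (eE _ _ M) //; first exact: sing_face.
by rewrite /M (bigD1 j) //=; lia.
Qed.
End Cover.
End Small.

(** * Continuity of explicit formulas *)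

Section Contat.
Definition contat (T U : topologicalType) (x : T) (f : T -> U) := {for x, continuous f}.

Variables (T : topologicalType) (x : T).

Lemma ca_id : contat x id. Proof. exact: cvg_id. Qed.
Lemma ca_cst (U : topologicalType) (c : U) : contat x (fun=> c).
Proof. exact: cvg_cst. Qed.
Lemma ca_pair (U V : topologicalType) (f : T -> U) (g : T -> V) :
  contat x f -> contat x g -> contat x (fun p => (f p, g p)).
Proof. by move=> fc gc; exact: (cvg_pair fc gc). Qed.
Lemma ca_comp (U V : topologicalType) (f : T -> U) (g : U -> V) :
  contat x f -> contat (f x) g -> contat x (fun p => g (f p)).
Proof. exact: continuous_comp. Qed.
Lemma ca_fst (U V : topologicalType) (f : T -> U * V) :
  contat x f -> contat x (fun p => (f p).1).
Proof. by move=> fc; apply: (ca_comp fc); exact: cvg_fst. Qed.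
Lemma ca_snd (U V : topologicalType) (f : T -> U * V) :
  contat x f -> contat x (fun p => (f p).2).
Proof. by move=> fc; apply: (ca_comp fc); exact: cvg_snd. Qed.

Section Field.
Variables (F : numFieldType) (V : normedModType F).
Lemma ca_add (f g : T -> V) : contat x f -> contat x g -> contat x (fun p => f p + g p).
Proof. by move=> *; apply: (@continuousD F). Qed.
Lemma ca_opp (f : T -> V) : contat x f -> contat x (fun p => - f p).
Proof. by move=> *; apply: (@continuousN F). Qed.
Lemma ca_scale (f : T -> F) (g : T -> V) : contat x f -> contat x g ->
  contat x (fun p => f p *: g p).
Proof. by move=> *; apply: (@continuousZ F). Qed.
Lemma ca_mul (f g : T -> F) : contat x f -> contat x g -> contat x (fun p => f p * g p).
Proof. by move=> *; apply: (@continuousM F). Qed.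
Lemma ca_inv (f : T -> F) : f x != 0 -> contat x f -> contat x (fun p => (f p)^-1).
Proof. by move=> *; apply: (@continuousV F). Qed.
Lemma ca_exp (f : T -> F) n : contat x f -> contat x (fun p => f p ^+ n).
Proof.
move=> fc; elim: n => [|n IHn]; first exact: ca_cst.
rewrite (_ : (fun p => _) = fun p => f p * f p ^+ n); first exact: ca_mul.
by apply/funext => p; rewrite exprS.
Qed.
End Field.
End Contat.

Ltac ca_step :=
  match goal with
  | H : contat ?x ?f |- contat ?x ?f => exact H
  | |- contat _ (fun p => p) => exact: ca_id
  | |- contat _ id => exact: ca_id
  | |- contat _ fst => exact: (ca_fst (@ca_id _ _))
  | |- contat _ snd => exact: (ca_snd (@ca_id _ _))
  | |- contat _ (fun _ => ?c) => exact: ca_cst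
  | |- contat ?x (fun p => (@?f p, @?g p)) => apply: (@ca_pair _ x _ _ f g)
  | |- contat ?x (fun p => fst (@?f p)) => apply: (@ca_fst _ x _ _ f)
  | |- contat ?x (fun p => snd (@?f p)) => apply: (@ca_snd _ x _ _ f)
  | |- contat ?x (fun p => @?f p + @?g p) => apply: (@ca_add _ x _ _ f g)
  | |- contat ?x (fun p => - @?f p) => apply: (@ca_opp _ x _ _ f)
  | |- contat ?x (fun p => @?f p * @?g p) => apply: (@ca_mul _ x _ f g)
  | |- contat ?x (fun p => @?f p *: @?g p) => apply: (@ca_scale _ x _ _ f g)
  | |- contat ?x (fun p => @?f p ^+ ?n) => apply: (@ca_exp _ x _ f n)
  | |- contat ?x (fun p => (@?f p)^-1) => apply: (@ca_inv _ x _ f)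
  end.
Ltac ca_tac := repeat (cbn beta; ca_step); cbn beta.
Ltac cont := ca_tac.

(** * Homotopy invariance *)

Section Homotopy.
Variable R : realType.
Notation Delta k := (stdsimplex R k).

Definition hprod (E E' : lmodType R) (h : E -> E') (p : E * R) : E' * R := (h p.1, p.2).

Lemma hprod_is_linear (E E' : lmodType R) (h : {linear E -> E'}) : linear (hprod h).
Proof. by move=> a x y; rewrite /hprod /= linearP. Qed.
HB.instance Definition _ (E E' : lmodType R) (h : {linear E -> E'}) :=
  GRing.isLinear.Build R (E * R)%type (E' * R)%type _ (hprod h) (hprod_is_linear h).

Lemma comb_fst (E : lmodType R) m (s : seq (E * R)) (x : 'rV[R]_m) :
  (comb s x).1 = comb (map fst s) x.
Proof. exact: (comb_map (@fst E R)). Qed.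

Lemma comb_snd (E : lmodType R) m (s : seq (E * R)) (x : 'rV[R]_m) :
  (comb s x).2 = comb (map snd s) x.
Proof. exact: (comb_map (@snd E R)). Qed.

Definition unitI : set R := [set t | 0 <= t /\ t <= 1].

Lemma cvx_unitI : cvx unitI.
Proof.
move=> a b t [a0 a1] [b0 b1] t0 t1; rewrite /unitI /= /GRing.scale /=.
have t1' : 0 <= 1 - t by rewrite subr_ge0.
split; first by rewrite addr_ge0 // mulr_ge0.
have := ler_wpM2l t0 a1; have := ler_wpM2l t1' b1; lra.
Qed.

Lemma cvxX (E : lmodType R) (C : set E) :
  cvx C -> cvx [set p : E * R | C p.1 /\ 0 <= p.2 /\ p.2 <= 1].
Proof.
move=> cC [a s] [b u] t /= [Ca sI] [Cb uI] t0 t1; split; first exact: cC.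
exact: (@cvx_unitI s u t).
Qed.

Variables T T' : topologicalType.
Implicit Types (H : R -> T -> T').

Definition prc H (c : cochains R T') : cochains R T := fun k f =>
  prf (evc c (fun p : 'rV[R]_k.+1 * R => H p.2 (f p.1))) (verts R k).

Lemma evc_prc H c k (f : 'rV[R]_k.+1 -> T) l : allin (Delta k) l ->
  evc (prc H c) f l = prf (evc c (fun p => H p.2 (f p.1))) l.
Proof.
move=> Dl; rewrite {1}/evc /prc; case sl : (size l) => [|m].
  by rewrite (size0nil sl).
rewrite -[in RHS](map_comb_verts sl) prf_map.
apply: (eq_prf (@allin_verts R m)) => s _ Ds.
rewrite /evc size_map; case ss : (size s) => [//|n]; congr (c n _).
apply/funext => x; rewrite /asx.
rewrite -[X in H X.2 (f X.1)](comb_map (hprod (comb l))) /hprod /=.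
have [D _] := comb_in (cvxX (@cvx_Delta R m)) ss Ds (clamp_in x).
by rewrite (clamp_id D).
Qed.

Lemma prc_homotopy H c (X : set T) :
  ceq X (fun k f => c k (H 1 \o f) - c k (H 0 \o f))
    (cochD (cob (prc H c)) (prc H (cob c))).
Proof.
move=> k f Xf; have [fc _ _] := Xf.
set G := evc c (fun p : 'rV[R]_k.+1 * R => H p.2 (f p.1)).
have at_ (t : R) : G (map (pair^~ t) (verts R k)) = c k (H t \o f).
  rewrite /G /evc size_map size_verts; congr (c k _); apply/funext => x.
  rewrite /asx /=.
  have -> : comb [seq (v, t) | v <- verts R k] (clamp x) = (clamp x, t).
    apply: injective_projections; rewrite ?comb_fst ?comb_snd -map_comp.
      by rewrite map_id comb_verts.
    have [_ x1] := clamp_in x; rewrite /= -[RHS]mul1r -x1 mulr_suml.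
    apply: eq_bigr => j _; rewrite (nth_map 0) // size_verts //.
  by rewrite /= fc.
have := prf_bdf G (verts R k); rewrite !at_ /cochD => E.
rewrite (cob_bdf _ Xf) /prc -/G.
rewrite (_ : evc (cob c) _ = bdf G); last first.
  by apply/funext => l; rewrite bdf_evc.
rewrite E (_ : bdf (evc (prc H c) f) _ = bdf (prf G) (verts R k)); first ring.
by apply: (bdf_allin (@allin_verts R k)) => s _ Ds; rewrite evc_prc.
Qed.

Definition homot (X : set T) (Y : set T') H := forall t x, unitI t -> X x ->
  Y (H t x) /\ contat (t, x) (fun p : R * T => H p.1 p.2).

Lemma prc_ceq H X Y c c' : homot X Y H -> ceq Y c c' -> ceq X (prc H c) (prc H c').
Proof.
move=> hH cc k f Xf; have [fc fX fC] := Xf.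
apply: (eq_prf (@allin_verts R k)) => s ss Ds; rewrite /evc ss.
apply: cc; apply: (sing_asx (cvxX (@cvx_Delta R k)) ss Ds).
  apply/within_contP => -[x t] [Dx tI] B HB.
  have [_ Hc] := hH t (f x) tI (fX x Dx).
  have [[A1 A2] [/= A1t A2x] A12] := Hc B HB.
  move/within_contP: fC => /(_ x Dx A2 A2x) NA2.
  exists ([set y | Delta k y -> A2 (f y)], A1) => //= -[y s'] /= [Hy Hs] [Dy _].
  by apply: (A12 (s', f y)); split=> //=; exact: Hy.
by move=> [x t] [Dx tI]; have [] := hH t (f x) tI (fX x Dx).
Qed.

End Homotopy.

(** * Cohomology isomorphisms as acyclic mapping cones *)

Section Qis.
Variable R : realType.

Definition pull (T T' : topologicalType) (f : T -> T') (c : cochains R T') :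
  cochains R T := fun k s => c k (f \o s).

Definition maps (T T' : topologicalType) (f : T -> T') (X : set T) (Y : set T') :=
  forall x, X x -> Y (f x) /\ contat x f.

Lemma sing_comp (T T' : topologicalType) (f : T -> T') X Y k (s : 'rV[R]_k.+1 -> T) :
  maps f X Y -> sing X s -> sing Y (f \o s).
Proof.
move=> fXY [sc sX sC]; split=> [x /=|x Dx /=|]; first by rewrite sc.
  by have [] := fXY _ (sX x Dx).
apply/within_contP => x Dx B fB; have [_ fc] := fXY _ (sX x Dx).
by move/within_contP: sC => /(_ x Dx (f @^-1` B)); apply; exact: fc.
Qed.

Lemma pull_ceq (T T' : topologicalType) (f : T -> T') X Y c c' :
  maps f X Y -> ceq Y c c' -> ceq X (pull f c) (pull f c').
Proof. by move=> fXY cc k s Xs; apply: cc; exact: sing_comp Xs. Qed.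

Lemma cob_pull (T T' : topologicalType) (f : T -> T') c :
  cob (pull f c) = pull f (cob c).
Proof.
by apply: functional_extensionality_dep => -[|k]; apply/funext => s.
Qed.

(* The mapping cone of the restriction [C*(Y) -> C*(X)] is acyclic. *)
Definition qis (T T' : topologicalType) (f : T -> T') (X : set T) (Y : set T') :=
  forall (a : cochains R T') (b : cochains R T), cocyc Y a -> ceq X (pull f a) (cob b) ->
  exists (a' : cochains R T') (b' : cochains R T),
    ceq Y a (cob a') /\ ceq X b (cochD (pull f a') (cob b')).

Section Composition.
Variables (T T' T'' : topologicalType) (f : T -> T') (g : T' -> T'').
Variables (X : set T) (Y : set T') (Z : set T'').
Hypotheses (mf : maps f X Y) (mg : maps g Y Z).

Lemma maps_comp : maps (g \o f) X Z.
Proof.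
move=> x Xx; have [Yf fc] := mf Xx; have [Zg gc] := mg Yf; split=> //.
exact: continuous_comp.
Qed.

Lemma qis_comp : qis f X Y -> qis g Y Z -> qis (g \o f) X Z.
Proof.
move=> qf qg a b ca ab.
have [||a1 [b1 [aa1 bb1]]] := qf (pull g a) b; rewrite ?/cocyc ?cob_pull //.
  exact: pull_ceq ca.
have [a2 [b2 [aa2 ab2]]] := qg a a1 ca aa1.
exists a2, (cochD (pull f b2) b1); split=> // k s Xs.
rewrite bb1 // /cochD cobD cob_pull addrA; congr (_ + _).
exact: (ab2 _ _ (sing_comp mf Xs)).
Qed.

Lemma qis_cancel_r : qis f X Y -> qis (g \o f) X Z -> qis g Y Z.
Proof.
move=> qf qgf a b ca ab.
have [|a' [b' [aa' bb']]] := qgf a (pull f b) ca.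
  by rewrite cob_pull; exact: (pull_ceq mf ab).
have [||a2 [b2 [aa2 bb2]]] := qf (cochB b (pull g a')) b'.
- move=> k s Ys; rewrite cobB cob_pull -ab // /coch0.
  by rewrite /pull (aa' _ _ (sing_comp mg Ys)) subrr.
- move=> k s Xs; rewrite /pull /cochB -[b k _]/(pull f b s) bb' //.
  by rewrite /cochD addrC addKr.
exists a', a2; split=> // k s Ys; rewrite /cochD -aa2 // /cochB; ring.
Qed.

Lemma qis_cancel_l : qis g Y Z -> qis (g \o f) X Z -> qis f X Y.
Proof.
move=> qg qgf a b ca ab.
(* The pair [(0, a)] is a cocycle of the cone of [g]; its primitive writes [a] as the pullback of a
   cocycle plus a coboundary. *)
have [||z [a2 [z0 az]]] := qg (@coch0 R T'') a.
- by move=> k s _; rewrite cob0.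
- by move=> k s Ys; rewrite ca.
have [||z' [b' [zz' bb']]] := qgf z (cochB b (pull f a2)).
- by move=> k s Zs; rewrite -z0.
- move=> k s Xs; rewrite cobB cob_pull -ab // /pull.
  by rewrite az ?/cochD ?addrK //; exact: sing_comp Xs.
exists (cochD (pull g z') a2), b'; split=> [k s Ys|k s Xs].
  rewrite az // cobD cob_pull /cochD /pull; congr (_ + _).
  by apply: zz'; exact: sing_comp Ys.
have := bb' _ _ Xs; rewrite /cochB /cochD /pull /= => /(canRL (subrK _)) ->; ring.
Qed.

End Composition.

Lemma qis_id (T : topologicalType) (X : set T) : qis id X X.
Proof.
move=> a b ca ab; exists b, (@coch0 R T); split=> // k s Xs.
by rewrite /cochD cob0 addr0.
Qed.

Lemma qis_homot (T T' : topologicalType) X Y (H : R -> T -> T') :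
  homot X Y H -> qis (H 0) X Y -> qis (H 1) X Y.
Proof.
move=> hH q0 a b ca ab.
have pr0 : ceq X (prc H (cob a)) (@coch0 R T).
  move=> k s Xs; rewrite (prc_ceq hH ca Xs) /prc.
  have -> : evc (@coch0 R T') (fun p : 'rV[R]_k.+1 * R => H p.2 (s p.1)) = fun=> 0.
    exact: evc0.
  have := prfB (fun=> 0) (fun=> 0) (verts R k); rewrite subrr => ->.
  by rewrite subrr.
have [|a' [b' [aa' bb']]] := q0 a (cochB b (prc H a)) ca.
  move=> k s Xs; rewrite cobB -ab //.
  have := prc_homotopy H a Xs; rewrite /cochD pr0 // addr0 => <-.
  by rewrite opprB addrC subrK.
exists a', (cochB b' (prc H a')); split=> // k s Xs.
have := bb' _ _ Xs; rewrite /cochB /cochD cobB => /(canRL (subrK _)) ->.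
have := prc_homotopy H a' Xs; rewrite /cochD -(prc_ceq hH aa' Xs) /pull.
lra.
Qed.

End Qis.

(** * Mayer-Vietoris and excision *)

Section MayerVietoris.
Variable R : realType.
Notation Delta k := (stdsimplex R k).
Notation qis := (qis R).

Section Gluing.
Variable T : topologicalType.
Implicit Types (X O : set T) (c : cochains R T).

Lemma singI X O k (s : 'rV[R]_k.+1 -> T) :
  sing (X `&` O) s <-> sing X s /\ forall x, Delta k x -> O (s x).
Proof.
split=> [[sc sX sC]|[[sc sX sC] sO]].
  by split=> [|x /sX[]//]; split=> // x /sX[].
by split=> // x Dx; split; [exact: sX|exact: sO].
Qed.

Lemma ceq_sym X c c' : ceq X c c' -> ceq X c' c.
Proof. by move=> cc k s /cc. Qed.

Lemma ceq_trans X c c' c'' : ceq X c c' -> ceq X c' c'' -> ceq X c c''.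
Proof. by move=> cc cc' k s Xs; rewrite cc // cc'. Qed.

(** Cochains, being arbitrary functionals, can be spliced by cases. A simplex contained in neither
    set of a cover gets a junk value, which [mv_acyclic] serves to correct. *)
Definition cglue O c c' : cochains R T := fun k s =>
  if `[< forall x, Delta k x -> O (s x) >] then c k s else c' k s.

Lemma cglue_in X O c c' : ceq (X `&` O) (cglue O c c') c.
Proof. by move=> k s /singI[_ sO]; rewrite /cglue; case: asboolP. Qed.

Lemma cglue_out X O O' c c' : ceq (X `&` (O `&` O')) c c' ->
  ceq (X `&` O') (cglue O c c') c'.
Proof.
move=> cc k s /singI[Xs sO']; rewrite /cglue; case: asboolP => // sO.
by apply: cc; apply/singI; split=> // x Dx; split; [exact: sO|exact: sO'].
Qed.

Variables (X O1 O2 : set T).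
Hypotheses (o1 : open O1) (o2 : open O2) (XO : X `<=` O1 `|` O2).

(** Small simplices for a cover by two sets. As the primitive vanishes on both parts, it corrects a
    spliced cochain without changing it there. *)
Lemma mv_acyclic c : cocyc X c -> ceq (X `&` O1) c (@coch0 R T) ->
  ceq (X `&` O2) c (@coch0 R T) -> exists e : cochains R T,
  [/\ ceq X c (cob e), ceq (X `&` O1) e (@coch0 R T) & ceq (X `&` O2) e (@coch0 R T)].
Proof.
move=> cc c1 c2; pose U : set (set T) := [set O1; O2].
have Uo O : U O -> open O by move=> [->|->].
have UX x : X x -> exists2 W, U W & W x.
  by move=> /XO[x1|x2]; [exists O1 => //; left|exists O2 => //; right].
have U1 : U O1 by left.
have U2 : U O2 by right.
have [k g Xg [W [->|->] gW]|e ce e0] := small_acyclic Uo UX cc.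
- by apply: c1; apply/singI.
- by apply: c2; apply/singI.
exists e; split=> // k s /singI[Xs sO]; first by apply: e0 => //; exists O1.
by apply: e0 => //; exists O2.
Qed.

Lemma mv_cob a a1 a2 : cocyc X a -> ceq (X `&` O1) a (cob a1) ->
  ceq (X `&` O2) a (cob a2) -> ceq (X `&` (O1 `&` O2)) a1 a2 ->
  exists a' : cochains R T, [/\ ceq X a (cob a'), ceq (X `&` O1) a' a1 & ceq (X `&` O2) a' a2].
Proof.
move=> ca e1 e2 e12; pose g := cglue O1 a1 a2.
have g1 : ceq (X `&` O1) g a1 := @cglue_in _ _ _ _.
have g2 : ceq (X `&` O2) g a2 := cglue_out e12.
have [|||e [ae e1' e2']] := @mv_acyclic (cochB a (cob g)).
- by move=> k s Xs; rewrite cobB ca // (cob_cob g Xs) subrr.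
- by move=> k s Xs; rewrite /cochB e1 // (ceq_cob g1 Xs) subrr.
- by move=> k s Xs; rewrite /cochB e2 // (ceq_cob g2 Xs) subrr.
exists (cochD g e); split=> k s Xs.
- by rewrite cobD -ae // /cochB addrC subrK.
- by rewrite /cochD g1 // e1' // addr0.
- by rewrite /cochD g2 // e2' // addr0.
Qed.

Lemma mv_cocyc a1 a2 : cocyc (X `&` O1) a1 -> cocyc (X `&` O2) a2 ->
  ceq (X `&` (O1 `&` O2)) a1 a2 ->
  exists a : cochains R T, [/\ cocyc X a, ceq (X `&` O1) a a1 & ceq (X `&` O2) a a2].
Proof.
move=> c1 c2 e12; pose g := cglue O1 a1 a2.
have g1 : ceq (X `&` O1) g a1 := @cglue_in _ _ _ _.
have g2 : ceq (X `&` O2) g a2 := cglue_out e12.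
have [|||e [ae e1' e2']] := @mv_acyclic (cob g).
- exact: cob_cob.
- exact: ceq_trans (ceq_cob g1) c1.
- exact: ceq_trans (ceq_cob g2) c2.
exists (cochB g e); split=> k s Xs.
- by rewrite cobB ae // subrr.
- by rewrite /cochB g1 // e1' // subr0.
- by rewrite /cochB g2 // e2' // subr0.
Qed.

(** A cocycle on [O1] that is the coboundary of [b] on the overlap is glued with the coboundary of
    an extension of [b] over [O2]. The hypothesis applies to the resulting cocycle of [X]. *)
Lemma qis_excision : qis id (X `&` O2) X -> qis id (X `&` (O1 `&` O2)) (X `&` O1).
Proof.
move=> q a b ca ab; pose b2 := cglue O1 b (@coch0 R T).
have b2b : ceq (X `&` (O1 `&` O2)) b2 b.
  move=> k s /singI[_ sO]; rewrite /b2 /cglue; case: asboolP => // -[] x Dx.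
  by have [] := sO x Dx.
have [|||c [cc c1 c2]] := @mv_cocyc a (cob b2) => //.
- exact: cob_cob.
- exact: ceq_trans ab (ceq_sym (ceq_cob b2b)).
have [c' [b' [cc' bb']]] := q c b2 cc c2.
have s1 : X `&` (O1 `&` O2) `<=` X `&` O1 by move=> x [Xx []].
have s2 : X `&` (O1 `&` O2) `<=` X `&` O2 by move=> x [Xx []].
have s3 : X `&` O1 `<=` X by move=> x [].
exists c', b'; split; first exact: ceq_trans (ceq_sym c1) (ceq_sub s3 cc').
exact: ceq_trans (ceq_sym b2b) (ceq_sub s2 bb').
Qed.

End Gluing.

Section Maps.
Variables (T T' : topologicalType) (f : T -> T').
Variables (X O1 O2 : set T) (Y P1 P2 : set T').
Hypotheses (o1 : open O1) (o2 : open O2) (XO : X `<=` O1 `|` O2).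
Hypotheses (p1 : open P1) (p2 : open P2) (YP : Y `<=` P1 `|` P2).
Hypotheses (m1 : maps f (X `&` O1) (Y `&` P1)) (m2 : maps f (X `&` O2) (Y `&` P2)).

(** The five lemma for two Mayer-Vietoris sequences, carried out as one chase in the cones. *)
Lemma qis_mv : qis f (X `&` O1) (Y `&` P1) -> qis f (X `&` O2) (Y `&` P2) ->
  qis f (X `&` (O1 `&` O2)) (Y `&` (P1 `&` P2)) -> qis f X Y.
Proof.
move=> q1 q2 q12 a b ca ab.
have sI (S : topologicalType) (A B : set S) : A `&` B `<=` A by move=> ? [].
have s1 (S : topologicalType) (A B C : set S) : A `&` (B `&` C) `<=` A `&` B by move=> x [? []].
have s2 (S : topologicalType) (A B C : set S) : A `&` (B `&` C) `<=` A `&` C by move=> x [? []].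
have m12 : maps f (X `&` (O1 `&` O2)) (Y `&` (P1 `&` P2)).
  move=> x [Xx [x1 x2]]; have [[Yf P1f] fc] := m1 (conj Xx x1).
  by have [[_ P2f] _] := m2 (conj Xx x2).
have [a1 [b1 [aa1 bb1]]] := q1 a b (ceq_sub (sI _ _ _) ca) (ceq_sub (sI _ _ _) ab).
have [a2 [b2 [aa2 bb2]]] := q2 a b (ceq_sub (sI _ _ _) ca) (ceq_sub (sI _ _ _) ab).
(* The two local solutions differ on the overlap by a cocycle of the cone; its primitive, extended
   by zero, corrects the first solution so that the two can be glued. *)
have [||e [e' [ee bee]]] := q12 (cochB a1 a2) (cochB b2 b1).
- move=> k s Ys; rewrite cobB -(aa1 _ _ (sing_sub (s1 _ _ _ _) Ys)).
  by rewrite -(aa2 _ _ (sing_sub (s2 _ _ _ _) Ys)) subrr.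
- move=> k s Xs; have := bb1 _ _ (sing_sub (s1 _ _ _ _) Xs).
  rewrite (bb2 _ _ (sing_sub (s2 _ _ _ _) Xs)) /cochD /pull /cochB cobB; lra.
pose eU := cglue P1 e (@coch0 R T').
have eUe : ceq (Y `&` P1) eU e := @cglue_in _ _ _ _ _.
pose a1' := cochB a1 (cob eU).
have agree : ceq (Y `&` (P1 `&` P2)) a1' a2.
  move=> k s Ys; rewrite /a1' /cochB (ceq_cob eUe (sing_sub (s1 _ _ _ _) Ys)).
  by rewrite -ee // /cochB; ring.
have [|A [aA A1 A2]] := mv_cob p1 p2 YP ca _ aa2 agree.
  move=> k s Ys; rewrite cobB (cob_cob eU Ys) subr0 aa1 //.
pose eX := cglue O1 e' (@coch0 R T).
have eXe : ceq (X `&` O1) eX e' := @cglue_in _ _ _ _ _.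
pose b1' := cochD (cochD b1 (pull f eU)) (cob eX).
have agree' : ceq (X `&` (O1 `&` O2)) b1' b2.
  move=> k s Xs; rewrite /b1' /cochD (ceq_cob eXe (sing_sub (s1 _ _ _ _) Xs)) /pull.
  rewrite (eUe _ _ (sing_comp m1 (sing_sub (s1 _ _ _ _) Xs))).
  by have := bee _ _ Xs; rewrite /cochB /cochD /pull; lra.
have [|||B [bB _ _]] := mv_cob o1 o2 XO (a := cochB b (pull f A)) _ _ _ agree'.
- move=> k s Xs; rewrite cobB -ab // cob_pull /pull.
  have mf : maps f X Y.
    by move=> x Xx; have [/(conj Xx)/m1|/(conj Xx)/m2] := XO Xx => -[[]].
  by rewrite (aA _ _ (sing_comp mf Xs)) subrr.
- move=> k s Xs; rewrite /cochB bb1 // /pull (A1 _ _ (sing_comp m1 Xs)).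
  have Xs' := sing_sub (sI _ _ _) Xs; rewrite /b1' !cobD (cob_cob eX Xs) cob_pull /a1' /cochB /cochD /pull /coch0; ring.
- move=> k s Xs; rewrite /cochB bb2 // /pull (A2 _ _ (sing_comp m2 Xs)).
  by rewrite /cochD /pull; ring.
by exists A, B; split=> // k s Xs; rewrite /cochD -bB // /cochB addrC subrK.
Qed.

End Maps.
End MayerVietoris.

(** * Homotopy equivalences and comparison squares *)

Section QisTools.
Variable R : realType.
Notation qis := (qis R).

Section Two.
Variables (T T' : topologicalType) (X : set T) (Y : set T').
Implicit Types (f g : T -> T') (H : R -> T -> T').

Lemma qis_ext f g : (forall x, X x -> f x = g x) -> qis f X Y -> qis g X Y.
Proof.
move=> fg q a b ca ab.
have pE c : ceq X (pull f c) (pull g c : cochains R T).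
  move=> k s Xs; congr (c k _); apply/funext => x /=.
  by apply: fg; exact: sing_all Xs.
have [|a' [b' [aa' bb']]] := q a b ca; first exact: ceq_trans (pE a) ab.
exists a', b'; split=> // k s Xs; rewrite bb' // /cochD.
by rewrite (pE _ _ _ Xs).
Qed.

Definition homotopic f g := exists H : R -> T -> T', [/\ homot X Y H,
  (forall x, X x -> H 0 x = f x) & (forall x, X x -> H 1 x = g x)].

Lemma homotopic_sym f g : homotopic f g -> homotopic g f.
Proof.
move=> [H [hH H0 H1]]; exists (fun t => H (1 - t)); split=> [t x [t0 t1] Xx|x Xx|x Xx].
- have [|Yx Hc] := hH (1 - t) x _ Xx; first by split; lra.
  split=> //.
  have c1 : contat (t, x) (fun p : R * T => (1 - p.1, p.2)).
    apply: ca_pair; last exact/ca_snd/ca_id.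
    by apply: (@ca_add _ _ R R); [exact: ca_cst|apply: ca_opp; exact/ca_fst/ca_id].
  exact: (ca_comp c1 (g := fun p => H p.1 p.2) Hc).
- by rewrite subr0 H1.
- by rewrite subrr H0.
Qed.

Lemma qis_homotopic f g : homotopic f g -> qis f X Y <-> qis g X Y.
Proof.
suff imp f' g' : homotopic f' g' -> qis f' X Y -> qis g' X Y.
  by move=> h; split; apply: imp => //; exact: homotopic_sym.
move=> [H [hH H0 H1]] q; apply: (qis_ext H1); apply: (qis_homot hH).
by apply: qis_ext q => x Xx; rewrite H0.
Qed.

End Two.

Section Equiv.
Variables (T T' : topologicalType) (X : set T) (Y : set T').
Variables (f : T -> T') (g : T' -> T).
Hypotheses (mf : maps f X Y) (mg : maps g Y X).

Lemma qis_hequiv : homotopic X X (g \o f) id -> homotopic Y Y (f \o g) id ->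
  qis f X Y.
Proof.
move=> hX hY; have qX := iffRL (qis_homotopic hX) (@qis_id R _ X).
have qY := iffRL (qis_homotopic hY) (@qis_id R _ Y).
move=> a b ca ab.
have [|a' [b' [aa' bb']]] := qY a (pull g b) ca.
  by rewrite cob_pull; exact: (pull_ceq mg ab).
have [||a2 [b2 [aa2 bb2]]] := qX (cochB b (pull f a')) (pull f b').
- move=> k s Xs; rewrite cobB cob_pull -ab // /pull.
  by rewrite (aa' _ _ (sing_comp mf Xs)) subrr.
- rewrite cob_pull => k s Xs.
  by have := bb' _ _ (sing_comp mf Xs); rewrite /pull /cochB /cochD => ->; rewrite addrC addKr.
exists a', a2; split=> // k s Xs; rewrite /cochD -aa2 // /cochB; ring.
Qed.

Lemma maps_idK : (forall x, X x -> g (f x) = x) -> homotopic X X (g \o f) id.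
Proof.
move=> gf; exists (fun _ x => x); split=> // [t x _ Xx|x Xx]; last by rewrite /= gf.
by split=> //; exact: cvg_snd.
Qed.

End Equiv.

Lemma qis_homeo (T T' : topologicalType) (X : set T) (Y : set T') f g :
  maps f X Y -> maps g Y X -> (forall x, X x -> g (f x) = x) ->
  (forall y, Y y -> f (g y) = y) -> qis f X Y.
Proof.
by move=> mf mg gf fg; apply: (qis_hequiv mf mg); apply: maps_idK.
Qed.

Section Square.
Variables (S S' T T' : topologicalType).
Variables (X : set S) (X' : set S') (Y : set T) (Y' : set T').
Variables (f : S -> T) (f' : S' -> T') (u : S -> S') (v : T -> T').
Hypotheses (mf : maps f X Y) (mf' : maps f' X' Y') (mu : maps u X X') (mv : maps v Y Y').
Hypotheses (qu : qis u X X') (qv : qis v Y Y').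
Hypothesis comm : forall x, X x -> v (f x) = f' (u x).

Lemma qis_square : qis f X Y <-> qis f' X' Y'.
Proof.
split=> q.
  apply: (qis_cancel_r mu mf' qu); apply: (qis_ext comm).
  exact: (qis_comp mf mv q qv).
apply: (qis_cancel_l mf mv qv); apply: (qis_ext (f := f' \o u)).
  by move=> x Xx /=; rewrite comm.
exact: (qis_comp mu mf' qu q).
Qed.

End Square.

Lemma qis_empty (T T' : topologicalType) (f : T -> T') (X : set T) (Y : set T') :
  X `<=` set0 -> Y `<=` set0 -> qis f X Y.
Proof.
move=> X0 Y0 a b ca ab; exists (@coch0 R T'), (@coch0 R T); split.
  by move=> k s Ys; case: (Y0 _ (sing_all (clamp 0) Ys)).
by move=> k s Xs; case: (X0 _ (sing_all (clamp 0) Xs)).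
Qed.

End QisTools.

(* A numerically closed field with continuous real and imaginary parts over a
   complete real field; the only instance is [R[i]].  Its norm topology is
   inferred only for an abstract field. *)
Record cplx (R : realType) (K : numClosedFieldType) := Cplx {
  toC : {rmorphism R -> K};
  re : K -> R;
  im : K -> R;
  toC_cont : continuous toC;
  re_cont : continuous re;
  im_cont : continuous im;
  reD : forall a b x y, re (toC a * x + toC b * y) = a * re x + b * re y;
  imD : forall a b x y, im (toC a * x + toC b * y) = a * im x + b * im y;
  re1 : re 1 = 1; im1 : im 1 = 0; rei : re 'i = 0; imi : im 'i = 1;
  reim : forall z, z = toC (re z) + 'i * toC (im z);
  norm_re : forall z, toC `|re z| <= `|z|;
  norm_im : forall z, toC `|im z| <= `|z|;
  toC_le : forall a b, (toC a <= toC b) = (a <= b) }.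

(** * Products with punctured vector spaces *)

Section Products.
Variables (R : realType) (K : numClosedFieldType) (C : cplx R K).
Notation qis := (qis R).
Notation homotopic := (homotopic R).

Definition fxid (T T' E : Type) (f : T -> T') (p : T * E) : T' * E := (f p.1, p.2).

(** A substitute for the Künneth formula, phrased for maps so that it can be proved by
    Mayer-Vietoris in the factor [D]. *)
Definition good (E : topologicalType) (D : set E) :=
  forall (T T' : topologicalType) (X : set T) (Y : set T') (f : T -> T'),
  maps f X Y -> qis f X Y -> qis (fxid f (E := E)) (X `*` D) (Y `*` D).

Section Any.
Variable E : topologicalType.
Implicit Types (D O : set E).

Lemma maps_fxid (T T' : topologicalType) (X : set T) (Y : set T') (f : T -> T') D :
  maps f X Y -> maps (fxid f (E := E)) (X `*` D) (Y `*` D).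
Proof.
move=> mf [x e] [/= Xx De]; have [Yf fc] := mf x Xx; split=> //.
apply: ca_pair; last exact/ca_snd/ca_id.
by apply: (@ca_comp _ (x, e) _ _ fst f); [exact/ca_fst/ca_id|].
Qed.

Lemma maps_fst (T : topologicalType) (X : set T) D : maps fst (X `*` D) X.
Proof. by move=> [x e] [/= Xx De]; split=> //; exact/ca_fst/ca_id. Qed.

Lemma maps_slice (T : topologicalType) (X : set T) D v : D v ->
  maps (fun x => (x, v)) X (X `*` D).
Proof.
by move=> Dv x Xx; split=> //; apply: ca_pair; [exact: ca_id|exact: ca_cst].
Qed.

Lemma qis_fst (T : topologicalType) (X : set T) D v : D v ->
  homotopic D D (fun=> v) id -> qis fst (X `*` D) X /\ qis (fun x => (x, v)) X (X `*` D).
Proof.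
move=> Dv [H [hH H0 H1]].
have h : homotopic (X `*` D) (X `*` D) ((fun x => (x, v)) \o fst) id.
  exists (fun t p => (p.1, H t p.2)); split=> [t [x e] tI [/= Xx De]|[x e] [/= _ De]|[x e] [/= _ De]].
  - have [De' Hc] := hH t e tI De; split=> //.
    apply: (@ca_pair _ (t, (x, e)) _ _ (fun p : R * (T * E) => p.2.1) (fun p => H p.1 p.2.2)).
      exact/ca_fst/ca_snd/ca_id.
    apply: (@ca_comp _ (t, (x, e)) _ _ (fun p : R * (T * E) => (p.1, p.2.2)) (fun p => H p.1 p.2)) => //.
    by apply: ca_pair; [exact/ca_fst/ca_id|exact/ca_snd/ca_snd/ca_id].
  - by rewrite H0.
  - by rewrite H1.
have m1 := @maps_fst T X D; have m2 := @maps_slice T X D v Dv.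
by split; [apply: (qis_hequiv m1 m2)|apply: (qis_hequiv m2 m1)] => //;
  apply: maps_idK => // x Xx.
Qed.

Lemma good_contr D v : D v -> homotopic D D (fun=> v) id -> good D.
Proof.
move=> Dv hD T T' X Y f mf q.
apply/(qis_square (maps_fxid mf) mf (@maps_fst _ _ _) (@maps_fst _ _ _)
  (qis_fst X Dv hD).1 (qis_fst Y Dv hD).1) => //.
Qed.

Lemma good_set0 : good (@set0 E).
Proof. by move=> T T' X Y f _ _; apply: qis_empty => -[x e] []. Qed.

Lemma openX (T : topologicalType) O : open O -> open (setT `*` O : set (T * E)).
Proof.
move=> oO; rewrite (_ : _ `*` _ = snd @^-1` O); last first.
  by apply/seteqP; split=> [p []|p Op].
by apply: open_comp => // p _; exact: cvg_snd.
Qed.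

Lemma setX_TI (T : topologicalType) (X : set T) D O :
  (X `*` D) `&` (setT `*` O) = X `*` (D `&` O).
Proof. by apply/seteqP; split=> -[x e] /=; [move=> [[? ?] [? ?]]|move=> [? [? ?]]]. Qed.

Lemma good_mv D O1 O2 : open O1 -> open O2 -> D `<=` O1 `|` O2 ->
  good (D `&` O1) -> good (D `&` O2) -> good (D `&` (O1 `&` O2)) -> good D.
Proof.
move=> o1 o2 DO g1 g2 g12 T T' X Y f mf q.
have eI (S : topologicalType) : (setT `*` O1 : set (S * E)) `&` (setT `*` O2) = setT `*` (O1 `&` O2).
  by rewrite setX_TI.
apply: (qis_mv (O1 := setT `*` O1) (O2 := setT `*` O2) (P1 := setT `*` O1) (P2 := setT `*` O2)).
- exact: openX.
- exact: openX.
- by move=> [x e] [/= _ /DO[?|?]]; [left|right].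
- exact: openX.
- exact: openX.
- by move=> [x e] [/= _ /DO[?|?]]; [left|right].
- by rewrite !setX_TI; exact: maps_fxid.
- by rewrite !setX_TI; exact: maps_fxid.
- by rewrite !setX_TI; exact: g1.
- by rewrite !setX_TI; exact: g2.
- by rewrite !eI !setX_TI; exact: g12.
Qed.

End Any.

Section Spheres.
Variable E : normedModType K.

Definition lineto (v : E) (t : R) (e : E) : E := toC C (1 - t) *: v + toC C t *: e.

Lemma star_contr (D : set E) v :
  (forall e t, D e -> unitI t -> D (lineto v t e)) -> homotopic D D (fun=> v) id.
Proof.
move=> sD; exists (lineto v); split=> [t e tI De|e De|e De].
- split; first exact: sD.
  rewrite /lineto; cont.
    apply: (@ca_comp _ (t, e) _ _ (fun p : R * E => 1 - p.1) (toC C)); last exact: toC_cont.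
    by cont.
  by apply: (@ca_comp _ (t, e) _ _ fst (toC C)); [cont|exact: toC_cont].
- by rewrite /lineto subr0 rmorph1 rmorph0 scale1r scale0r addr0.
- by rewrite /lineto subrr rmorph1 rmorph0 scale1r scale0r add0r.
Qed.

(* [frame] lists real coordinate forms together with vectors dual to them in
   a triangular way; [nz] says that some coordinate is nonzero. *)
Definition rform (l : E -> R) := continuous l /\
  forall a b x y, l (toC C a *: x + toC C b *: y) = a * l x + b * l y.

Fixpoint nz (fr : seq ((E -> R) * E)) : set E :=
  if fr is (l, v) :: fr' then nz fr' `|` [set e | l e <> 0] else set0.

Fixpoint frame (fr : seq ((E -> R) * E)) : Prop :=
  if fr is (l, v) :: fr' then [/\ rform l, l v = 1,
    List.Forall (fun q => q.1 v = 0) fr' & frame fr'] else True.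

Lemma nz_scale fr v a b e : frame fr -> List.Forall (fun q => q.1 v = 0) fr ->
  b <> 0 -> nz fr e -> nz fr (toC C a *: v + toC C b *: e).
Proof.
move=> + + b0; elim: fr => [//|[l w] fr IHfr] /= [[lc lD] _ _ ffr] v0.
have [lv vfr] : l v = 0 /\ List.Forall (fun q => q.1 v = 0) fr.
  by inversion v0.
move=> [/(IHfr ffr vfr)|le]; [by left|right].
by rewrite lD lv mulr0 add0r => /eqP; rewrite mulf_eq0 => /orP[/eqP|/eqP].
Qed.

Lemma open_gt0 (l : E -> R) : continuous l -> open [set e | 0 < l e].
Proof.
move=> lc; apply: (@open_comp _ _ l [set x | 0 < x]); last exact: open_gt.
by move=> x _; exact: lc.
Qed.

Lemma open_nz fr : frame fr -> open (nz fr).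
Proof.
elim: fr => [_|[l v] fr IHfr /= [[lc _] _ _ /IHfr ofr]]; first exact: open0.
apply: openU => //; apply: (@open_comp _ _ l [set x | x <> 0]).
  by move=> x _; exact: lc.
rewrite (_ : [set x | x <> 0] = ~` [set x | x = 0]); last by apply/seteqP; split.
exact/closed_openC/closed_eq.
Qed.

(** An open hemisphere thickened by the complement of the axis: the versions for [l] and [- l] are
    star-shaped and meet exactly in [nz fr], the equator. *)
Definition upper (l : E -> R) fr : set E := nz fr `|` [set e | 0 < l e].

Lemma upper_star l v fr : rform l -> l v = 1 -> frame fr ->
  List.Forall (fun q => q.1 v = 0) fr ->
  homotopic (upper l fr) (upper l fr) (fun=> v) id.
Proof.
move=> [lc lD] lv ffr v0; apply: star_contr => e t De [t0 t1]; rewrite /upper /=.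
(* The centre [v] lies in the open half-space. For other [t] each of the two pieces is preserved
   separately: the forms in [fr] vanish at [v], and [l v] is positive. *)
have [->|tN0] := eqVneq t 0.
  by right; rewrite /= lD lv mul0r subr0 mulr1 addr0.
case: De => [ne|le]; [left|right].
  by apply: nz_scale => //; exact/eqP.
rewrite /= lD lv mulr1; have tp : 0 < t by rewrite lt_def tN0.
by have := mulr_gt0 tp le; lra.
Qed.

Lemma rformN (l : E -> R) : rform l -> rform (fun e => - l e).
Proof.
move=> [lc lD]; split=> [e|a b x y]; last by rewrite lD; ring.
by apply: (@continuousN R R); exact: lc.
Qed.

Lemma frameN (l : E -> R) v fr : rform l -> List.Forall (fun q => q.1 v = 0) fr ->
  frame fr -> List.Forall (fun q => q.1 (- v) = 0) fr.
Proof.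
move=> _; elim: fr => [_ _|[l' w] fr IHfr /= v0 [[_ lD] _ _ ffr]]; first by constructor.
inversion_clear v0; constructor; last exact: IHfr.
rewrite /=; have := lD (-1) 0 v 0; rewrite rmorph0 scale0r addr0 rmorphN rmorph1 scaleN1r => ->.
by rewrite /= in H; rewrite H mulr0 mul0r addr0.
Qed.

Lemma rform_opp (l : E -> R) v : rform l -> l (- v) = - l v.
Proof.
move=> [_ lD]; have := lD (-1) 0 v 0.
by rewrite rmorph0 scale0r addr0 rmorphN rmorph1 scaleN1r mul0r addr0 mulN1r.
Qed.

Lemma upper_cover l fr : nz ((l, 0) :: fr) = upper l fr `|` upper (fun e => - l e) fr.
Proof.
apply/seteqP; split=> e /=.
  case=> [ne|/eqP]; first by left; left.
  by rewrite neq_lt => /orP[l0|l0]; [right|left]; right; rewrite /= ?oppr_gt0.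
case=> -[ne|/= l0]; [by left|right|by left|right]; move=> /= le; move: l0; rewrite le ?oppr0 ltxx //.
Qed.

Lemma upperI l fr : upper l fr `&` upper (fun e => - l e) fr = nz fr.
Proof.
apply/seteqP; split=> e; last by move=> ne; split; left.
by move=> [[//|/= l0] [//|/=]]; rewrite oppr_gt0 => /(lt_trans l0); rewrite ltxx.
Qed.

Lemma open_upper l fr : rform l -> frame fr -> open (upper l fr).
Proof. by move=> [lc _] ffr; apply: openU; [exact: open_nz|exact: open_gt0]. Qed.

(** Each further real coordinate suspends the sphere: two contractible hemispheres whose
    intersection is the previous stage. *)
Lemma good_nz fr : frame fr -> good (nz fr).
Proof.
elim: fr => [_|[l v] fr IHfr /= [fl lv v0 ffr]]; first exact: good_set0.
have := upper_cover l fr; rewrite /= => ->.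
have fl' := rformN fl; have v0' := frameN fl v0 ffr.
have lv' : - l (- v) = 1 by rewrite rform_opp // opprK.
apply: (good_mv (O1 := upper l fr) (O2 := upper (fun e => - l e) fr)) => //.
- exact: open_upper.
- exact: open_upper.
- rewrite setUK; apply: (good_contr (v := v)); last exact: upper_star.
  by right; rewrite /= lv ltr01.
- rewrite setUC setUK; apply: (good_contr (v := - v)); last exact: upper_star.
  by right; rewrite /= lv' ltr01.
- rewrite upperI; have -> : (upper l fr `|` upper (fun e => - l e) fr) `&` nz fr = nz fr.
    by apply/setIidPr => e ne; left; left.
  exact: IHfr.
Qed.

End Spheres.
End Products.

(** * Comparison along the zero locus of a coordinate *)

Section Strata.
Variables (R : realType) (K : numClosedFieldType) (C : cplx R K).
Notation qis := (qis R).
Notation unitI := (@unitI R).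

Lemma ca_toC (T : topologicalType) (x : T) (f : T -> R) :
  contat x f -> contat x (fun p => toC C (f p)).
Proof. by move=> fc; apply: (ca_comp fc); exact: toC_cont. Qed.

Lemma ca_near (T U : topologicalType) (x : T) (f : T -> U) (O : set U) :
  contat x f -> open O -> O (f x) -> \forall y \near x, O (f y).
Proof. by move=> fc oO Ofx; apply: fc; exact: open_nbhs_nbhs. Qed.

Lemma open_near (T : topologicalType) (O : set T) :
  (forall x, O x -> \forall y \near x, O y) -> open O.
Proof. by move=> H; rewrite openE => x /H. Qed.

Lemma open_forall (S T : topologicalType) (A : set S) (P : S -> T -> Prop) : compact A ->
  (forall s x, A s -> (forall s, A s -> P s x) ->
     \forall p \near (s, x), P p.1 p.2) ->
  open [set x | forall s, A s -> P s x].
Proof.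
move=> cA H; apply: open_near => x Px.
have cov : near_covering A by exact: (iffLR (compact_near_coveringP _)) cA.
apply: (cov T (nbhs x) (fun x s => P s x)) => s As.
have [[A1 A2] [/= NA1 NA2] A12] := H s x As Px.
by exists (A1, A2) => // -[s' x'] /= [? ?]; exact: (A12 (s', x')).
Qed.

Lemma open_neq0 (U : normedModType K) : open [set u : U | u != 0].
Proof.
rewrite (_ : [set u : U | u != 0] = ~` [set 0]); last first.
  by apply/seteqP; split=> u /= /eqP.
apply: closed_openC; apply: accessible_closed_set1.
exact/hausdorff_accessible/norm_hausdorff.
Qed.

Lemma open_neq0X (T : topologicalType) (U : normedModType K) :
  open [set p : T * U | p.2 != 0].
Proof.
apply: open_near => p p0; apply: (ca_near _ (@open_neq0 U) p0); cont.
Qed.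

Lemma unitI_compact : compact unitI.
Proof.
rewrite (_ : unitI = `[0, 1]%classic); first exact: segment_compact.
by apply/seteqP; split=> t; rewrite /= in_itv /= => /andP.
Qed.

Lemma unitI0 : unitI 0. Proof. by rewrite /unitI /=; split; lra. Qed.
Lemma unitI1 : unitI 1. Proof. by rewrite /unitI /=; split; lra. Qed.
Lemma unitIM s t : unitI s -> unitI t -> unitI (s * t).
Proof.
move=> [s0 s1] [t0 t1]; split; first exact: mulr_ge0.
by rewrite -[1]mul1r ler_pM.
Qed.

(* The properties of [id] and of [u |-> u^n] needed to compare strata: [psi] maps
   rays into rays, and products of cohomology isomorphisms with it are again such. *)
Definition powlike (U' U : normedModType K) (psi : U' -> U) :=
  [/\ continuous psi, forall u, psi u = 0 <-> u = 0,
      (forall t u, unitI t -> exists2 r, unitI r & psi (toC C t *: u) = toC C r *: psi u) &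
      forall (T T' : topologicalType) (X : set T) (Y : set T') (f : T -> T'),
        maps f X Y -> qis f X Y ->
        qis (fun p => (f p.1, psi p.2)) (X `*` [set u | u != 0]) (Y `*` [set u | u != 0])].

Section Stratum.
Variables (T' T : topologicalType) (U' U : normedModType K).
Variables (X' : set (T' * U')) (X : set (T * U)).
Variables (g : T' * U' -> T) (psi : U' -> U).
Let f (p : T' * U') := (g p, psi p.2).
Hypotheses (oX' : open X') (oX : open X).
Hypotheses (cg : forall p, X' p -> contat p g) (fX : forall p, X' p -> X (f p)).
Hypothesis pw : powlike psi.

Let shr (V : normedModType K) (W : topologicalType) (s : R) (p : W * V) : W * V :=
  (p.1, toC C s *: p.2).

Let ca_shr (V : normedModType K) (W : topologicalType) (q : R * (W * V)) :
  contat q (fun q => shr q.1 q.2).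
Proof. by rewrite /shr; cont; apply: ca_toC; cont. Qed.

(** The points joined to the zero section by a segment inside [X]. It is open since the parameter
    interval is compact, and it contracts onto the zero section. *)
Let core : set (T * U) := [set p | forall s, unitI s -> X (shr s p)].

(** The two parameters are independent. Shrinking the value of [psi] makes [f] map [core'] into
    [core]; shrinking the argument of [g] yields the homotopy from [f] to a product map. *)
Let core' : set (T' * U') := [set p | forall q : R * R, (unitI `*` unitI) q ->
  X' (shr q.1 p) /\ X (g (shr q.1 p), toC C q.2 *: psi p.2)].

Let open_core : open core.
Proof.
apply: (open_forall unitI_compact (P := fun s p => X (shr s p))) => s p sI Xp.
exact: (ca_near (f := fun q : R * (T * U) => shr q.1 q.2)) (Xp s sI).
Qed.

Let open_core' : open core'.
Proof.
have cI : compact (unitI `*` unitI) by apply: compact_setX; exact: unitI_compact.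
apply: (open_forall cI (P := fun q p => X' (shr q.1 p) /\ X (g (shr q.1 p), toC C q.2 *: psi p.2))).
move=> q p qI Xp; have [X1 X2] := Xp q qI.
have c1 : contat (q, p) (fun z : (R * R) * (T' * U') => shr z.1.1 z.2).
  by rewrite /shr; cont; apply: ca_toC; cont.
have c2 : contat (q, p) (fun z : (R * R) * (T' * U') => (g (shr z.1.1 z.2), toC C z.1.2 *: psi z.2.2)).
  cont; first by apply: (ca_comp c1 (g := g)); exact: cg.
    by apply: ca_toC; cont.
  apply: (@ca_comp _ (q, p) _ _ (fun z : (R * R) * (T' * U') => z.2.2) psi); first by cont.
  by have [pc _ _ _] := pw; exact: pc.
by apply: filterI; [exact: (ca_near c1)|exact: (ca_near c2)].
Qed.

Let shr1 (V : normedModType K) (W : topologicalType) (p : W * V) : shr 1 p = p.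
Proof. by rewrite /shr rmorph1 scale1r; case: p. Qed.

Let shr0 (V : normedModType K) (W : topologicalType) (p : W * V) : shr 0 p = (p.1, 0).
Proof. by rewrite /shr rmorph0 scale0r. Qed.

Let shrM (V : normedModType K) (W : topologicalType) s t (p : W * V) : shr s (shr t p) = shr (s * t) p.
Proof. by rewrite /shr /= scalerA rmorphM. Qed.

Let core_sub p : core p -> X p.
Proof. by move=> /(_ 1 unitI1); rewrite shr1. Qed.

Let core'_sub p : core' p -> X' p.
Proof. by move=> /(_ (1, 1) (conj unitI1 unitI1)) []; rewrite shr1. Qed.

Let Z := [set w | X (w, 0)].
Let Z' := [set w | X' (w, 0)].
Let psi0 : psi 0 = 0. Proof. by have [_ H _ _] := pw; apply/H. Qed.

Let core_shr t p : unitI t -> core p -> core (shr t p).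
Proof. by move=> tI cp s sI; rewrite shrM; apply: cp; exact: unitIM. Qed.

Let core'_shr t p : unitI t -> core' p -> core' (shr t p).
Proof.
move=> tI cp [s r] [/= sI rI]; rewrite shrM /=.
have [_ _ pM _] := pw; have [r' r'I ->] := pM t p.2 tI.
have [X1 _] := cp (s * t, 0) (conj (unitIM sI tI) unitI0).
have [_ X2] := cp (s * t, r * r') (conj (unitIM sI tI) (unitIM rI r'I)).
by split=> //; rewrite scalerA -rmorphM.
Qed.

Let core_fst p : core p -> Z p.1.
Proof. by move=> /(_ 0 unitI0); rewrite shr0. Qed.

Let core'_fst p : core' p -> Z' p.1.
Proof. by move=> /(_ (0, 0) (conj unitI0 unitI0)) []; rewrite shr0. Qed.

Let core_zero w : Z w -> core (w, 0).
Proof. by move=> Zw s _; rewrite /shr /= scaler0. Qed.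

Let core'_zero w : Z' w -> core' (w, 0).
Proof.
move=> Zw [s r] _; rewrite /shr /= psi0 !scaler0; split=> //.
by have := fX Zw; rewrite /f /= psi0.
Qed.

Let zsec (V : normedModType K) (W : topologicalType) (A : set W) (B : set (W * V)) :
  (forall w, A w -> B (w, 0)) -> (forall p, B p -> A p.1) ->
  (forall t p, unitI t -> B p -> B (shr t p)) ->
  qis (fun w => (w, 0)) A B.
Proof.
move=> AB BA Bs.
have m1 : maps (fun w => (w, 0)) A B by move=> w Aw; split; [exact: AB|cont].
have m2 : maps fst B A by move=> p Bp; split; [exact: BA|cont].
apply: (qis_hequiv m1 m2); first exact: maps_idK.
exists (fun t p => shr t p); split=> [t p tI Bp|p Bp|p Bp].
- by split; [exact: Bs|exact: ca_shr].
- by rewrite shr0.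
- by rewrite shr1.
Qed.

Let qcore : qis (fun w => (w, 0)) Z core.
Proof. exact: zsec. Qed.
Let qcore' : qis (fun w => (w, 0)) Z' core'.
Proof. exact: zsec. Qed.

(** Both [B] and the full product over [A] contract onto the zero section, so the inclusion between
    them is an isomorphism, and excision carries this over to the complements of the section. *)
Let exc (V : normedModType K) (W : topologicalType) (A : set W) (B : set (W * V)) :
  open B -> (forall w, A w -> B (w, 0)) -> (forall p, B p -> A p.1) ->
  (forall t p, unitI t -> B p -> B (shr t p)) ->
  qis id (B `&` [set p | p.2 != 0]) (A `*` [set u | u != 0]).
Proof.
move=> oB AB BA Bs.
have q1 : qis id ((A `*` setT) `&` B) (A `*` setT).
  have -> : (A `*` setT) `&` B = B.
    by apply/seteqP; split=> [p []//|p Bp]; split=> //; split=> //; exact: BA.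
  apply: (@qis_cancel_r _ _ _ _ (fun w => (w, 0)) id A B (A `*` setT)).
  - by move=> w Aw; split; [exact: AB|cont].
  - by move=> p Bp; split; [split=> //; exact: BA|cont].
  - exact: zsec.
  - by apply: zsec => [w Aw|p []|t p tI []].
have := @qis_excision _ _ (A `*` setT) [set p | p.2 != 0] B (@open_neq0X _ _) oB.
have -> : (A `*` setT) `&` ([set p : W * V | p.2 != 0] `&` B) = B `&` [set p | p.2 != 0].
  by apply/seteqP; split=> [p [_ []]//|p [Bp p0]]; split=> //; split=> //; exact: BA.
have -> : (A `*` setT) `&` [set p : W * V | p.2 != 0] = A `*` [set u | u != 0].
  by apply/seteqP; split=> [p [[]]|p []].
apply=> // p [Ap _]; have [p0|p0] := eqVneq p.2 0; [right|by left].
by have := AB p.1 Ap; rewrite -p0; case: p {Ap p0}.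
Qed.

(** Mayer-Vietoris for the complement of the stratum and the core. On the core only the restriction
    to the zero section matters; the intersection is, by excision, a product with the punctured
    normal space. *)
Lemma qis_strata : qis (fun w => g (w, 0)) Z' Z ->
  qis f (X' `&` [set p | p.2 != 0]) (X `&` [set p | p.2 != 0]) -> qis f X' X.
Proof.
move=> qZ qN; have [pc pz pM pq] := pw.
have cf p : X' p -> contat p f.
  move=> Xp; apply: ca_pair; first exact: cg.
  by apply: (@ca_comp _ p _ _ snd psi); [cont|exact: pc].
have fcore p : core' p -> core (f p).
  by move=> cp s sI; have [_] := cp (1, s) (conj unitI1 sI); rewrite shr1.
have mcore : maps f core' core.
  by move=> p cp; split; [exact: fcore|exact/cf/core'_sub].
have gZ w : Z' w -> Z (g (w, 0)).
  by move=> Zw; have := fX Zw; rewrite /f /= psi0.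
have mZ : maps (fun w => g (w, 0)) Z' Z.
  move=> w Zw; split; first exact: gZ.
  by apply: (@ca_comp _ w _ _ (fun w => (w, 0)) g); [cont|exact: cg].
have q2 : qis f core' core.
  apply: (iffLR (qis_square mZ mcore _ _ qcore' qcore _) qZ).
  - by move=> w Zw; split; [exact: core'_zero|cont].
  - by move=> w Zw; split; [exact: core_zero|cont].
  - by move=> w Zw; rewrite /f /= psi0.
have f0 p : (f p).2 != 0 <-> p.2 != 0.
  by split; apply: contra_neq => /pz.
(* The product model of [f] near the stratum; it is an isomorphism by the last clause of
   [powlike]. *)
pose h (p : T' * U') := (g (p.1, 0), psi p.2).
have mh : maps h (Z' `*` [set u | u != 0]) (Z `*` [set u | u != 0]).
  move=> p [Zp p0]; split; first by split; [exact: gZ|exact/f0].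
  apply: ca_pair; last by apply: (@ca_comp _ p _ _ snd psi); [cont|exact: pc].
  by apply: (@ca_comp _ p _ _ (fun p => (p.1, 0)) g); [cont|exact: cg].
have qh : qis h (Z' `*` [set u | u != 0]) (Z `*` [set u | u != 0]).
  exact: (pq _ _ _ _ _ mZ qZ).
have e' := exc open_core' core'_zero core'_fst core'_shr.
have e := exc open_core core_zero core_fst core_shr.
have m1 : maps f (core' `&` [set p | p.2 != 0]) (core `&` [set p | p.2 != 0]).
  move=> p [cp p0]; split; last exact/cf/core'_sub.
  by split; [exact: fcore|exact/f0].
have m2 : maps id (core' `&` [set p | p.2 != 0]) (Z' `*` [set u | u != 0]).
  by move=> p [cp p0]; split; [split=> //; exact: core'_fst|cont].
have m3 : maps id (core `&` [set p | p.2 != 0]) (Z `*` [set u | u != 0]).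
  by move=> p [cp p0]; split; [split=> //; exact: core_fst|cont].
have q12 : qis f (core' `&` [set p | p.2 != 0]) (core `&` [set p | p.2 != 0]).
  apply: (qis_cancel_l m1 m3 e).
  have := qis_comp m2 mh e' qh; apply: iffLR; apply: qis_homotopic.
  (* Only the argument of [g] is shrunk, so that the normal coordinate [psi p.2] never vanishes. *)
  exists (fun t p => (g (shr t p), psi p.2)); split=> [t p tI [cp p0]|p [cp p0]|p [cp p0]].
  - have [X1 X2] := cp (t, 0) (conj tI unitI0); split.
      by split; [move: X2; rewrite /= rmorph0 scale0r|exact/f0].
    apply: ca_pair; first exact: (ca_comp (@ca_shr _ _ (t, p)) (g := g) (cg X1)).
    by apply: (@ca_comp _ (t, p) _ _ (fun q : R * (T' * U') => q.2.2) psi); [cont|exact: pc].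
  - by rewrite shr0.
  - by rewrite shr1.
have Xc : X `&` core = core by apply/setIidPr; exact: core_sub.
have Xc' : X' `&` core' = core' by apply/setIidPr; exact: core'_sub.
have I' : X' `&` ([set p | p.2 != 0] `&` core') = core' `&` [set p | p.2 != 0].
  by rewrite [_ `&` core']setIC setIA Xc'.
have I : X `&` ([set p | p.2 != 0] `&` core) = core `&` [set p | p.2 != 0].
  by rewrite [_ `&` core]setIC setIA Xc.
apply: (qis_mv (@open_neq0X _ _) open_core' _ (@open_neq0X _ _) open_core) => //.
- move=> p Xp; have [p0|p0] := eqVneq p.2 0; [right|by left].
  by have := @core'_zero p.1; rewrite /Z' /= -p0; case: p Xp {p0} => ? ? /= ?; apply.
- move=> p Xp; have [p0|p0] := eqVneq p.2 0; [right|by left].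
  by have := @core_zero p.1; rewrite /Z /= -p0; case: p Xp {p0} => ? ? /= ?; apply.
- by move=> p [Xp p0]; split; [split; [exact: fX|exact/f0]|exact: cf].
- by rewrite Xc Xc'.
- by rewrite Xc Xc'.
- by rewrite I I'.
Qed.

End Stratum.

End Strata.

(** * Power maps of the punctured plane, by transfer *)

Section Power.
Variables (R : realType) (K : numClosedFieldType) (C : cplx R K).
Notation qis := (qis R).
Notation Delta k := (stdsimplex R k).

Lemma re_toC a : re C (toC C a) = a.
Proof. by have := reD C a 0 1 0; rewrite mulr1 mulr0 addr0 re1 mulr1 mul0r addr0. Qed.

Lemma im_toC a : im C (toC C a) = 0.
Proof. by have := imD C a 0 1 0; rewrite mulr1 mulr0 addr0 im1 mulr0 mul0r addr0. Qed.

Definition polar (s t : R) : K := toC C s * (toC C (cos t) + 'i * toC C (sin t)).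

Lemma polarX s t n : polar s t ^+ n = polar (s ^+ n) (n%:R * t).
Proof.
elim: n => [|n IHn].
  by rewrite /polar !expr0 mul0r cos0 sin0 rmorph0 rmorph1 mulr0 addr0 mulr1.
rewrite exprS IHn /polar -natr1 mulrDl mul1r cosD sinD exprS !(rmorphM, rmorphB, rmorphD).
have i2 : ('i : K) * 'i = -1 by rewrite -expr2 sqrCi.
ring: i2.
Qed.

(* The principal [n]-th root on the right half-plane. *)
Definition proot n (z : K) : K :=
  polar (expR (ln (re C z ^+ 2 + im C z ^+ 2) / 2 / n%:R)) (atan (im C z / re C z) / n%:R).

Lemma prootX n z : (0 < n)%N -> 0 < re C z -> proot n z ^+ n = z.
Proof.
move=> n0 rz; have n0' : n%:R != 0 :> R by rewrite pnatr_eq0 -lt0n.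
rewrite polarX -expRM_natl ![n%:R * _]mulrC !divfK //.
set x := re C z in rz *; set y := im C z.
have s0 : 0 < x ^+ 2 + y ^+ 2 by rewrite ltr_wpDr ?sqr_ge0 // exprn_gt0.
have -> : expR (ln (x ^+ 2 + y ^+ 2) / 2) = Num.sqrt (x ^+ 2 + y ^+ 2).
  apply/eqP; rewrite -(eqrXn2 (ltn0Sn 1)) ?expR_ge0 ?sqrtr_ge0 //.
  rewrite sqr_sqrtr ?(ltW s0) // -expRM_natl [2 * _]mulrC divfK ?pnatr_eq0 //.
  by rewrite lnK // posrE.
have cE : Num.sqrt (x ^+ 2 + y ^+ 2) * cos (atan (y / x)) = x.
  rewrite cos_atan (_ : x ^+ 2 + y ^+ 2 = x ^+ 2 * (1 + (y / x) ^+ 2)).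
    rewrite sqrtrM ?sqr_ge0 // sqrtr_sqr gtr0_norm // mulfK //.
    by rewrite gt_eqF // sqrtr_gt0 ltr_wpDr ?sqr_ge0.
  by field; rewrite gt_eqF.
have sE : Num.sqrt (x ^+ 2 + y ^+ 2) * sin (atan (y / x)) = y.
  have := atanK (y / x); rewrite /tan => /(canRL (divfK _)) -> //.
    by rewrite mulrCA cE divfK ?gt_eqF.
  by rewrite cos_atan invr_eq0 gt_eqF // sqrtr_gt0 ltr_wpDr ?sqr_ge0.
by rewrite /polar mulrDr -rmorphM mulrCA -rmorphM cE sE -reim.
Qed.

Lemma ca_re (T : topologicalType) (x : T) (f : T -> K) :
  contat x f -> contat x (fun p => re C (f p)).
Proof. by move=> fc; apply: (ca_comp fc); exact: re_cont. Qed.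

Lemma ca_im (T : topologicalType) (x : T) (f : T -> K) :
  contat x f -> contat x (fun p => im C (f p)).
Proof. by move=> fc; apply: (ca_comp fc); exact: im_cont. Qed.

Section RealFunctions.
Variables (T : topologicalType) (x : T) (f : T -> R).
Hypothesis fc : contat x f.
Lemma ca_ln : 0 < f x -> contat x (fun p => ln (f p)).
Proof. by move=> f0; apply: (ca_comp fc); exact: continuous_ln. Qed.
Lemma ca_expR : contat x (fun p => expR (f p)).
Proof. by apply: (ca_comp fc); exact: continuous_expR. Qed.
Lemma ca_cos : contat x (fun p => cos (f p)).
Proof. by apply: (ca_comp fc); exact: continuous_cos. Qed.
Lemma ca_sin : contat x (fun p => sin (f p)).
Proof. by apply: (ca_comp fc); exact: continuous_sin. Qed.
Lemma ca_atan : contat x (fun p => atan (f p)).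
Proof. by apply: (ca_comp fc); exact: continuous_atan. Qed.
End RealFunctions.

Lemma proot_cont n z : 0 < re C z -> contat z (proot n).
Proof.
move=> rz; have s0 : 0 < re C z ^+ 2 + im C z ^+ 2.
  by rewrite ltr_wpDr ?sqr_ge0 // exprn_gt0.
have cre : contat z (re C) by exact: re_cont.
have cim : contat z (im C) by exact: im_cont.
rewrite /proot /polar; cont.
- apply: ca_toC; apply: ca_expR; cont; apply: ca_ln => //; cont.
- by apply: ca_toC; apply: ca_cos; cont; apply: ca_atan; cont; rewrite ?gt_eqF.
- by apply: ca_toC; apply: ca_sin; cont; apply: ca_atan; cont; rewrite ?gt_eqF.
Qed.

Lemma unity_roots n : (0 < n)%N -> exists2 rs : seq K, uniq rs &
  forall z, (z \in rs) = (z ^+ n == 1).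
Proof.
move=> n0; have [rs rsE] := closed_field_poly_normal ('X^n - 1 : {poly K}).
have := monic_Xn_sub_1 K n0; rewrite monicE => /eqP l1.
rewrite l1 scale1r in rsE; exists rs => [|z].
  rewrite -separable_prod_XsubC -rsE separable_Xn_sub_1 //.
  by rewrite pnatr_eq0 -lt0n.
by rewrite -root_prod_XsubC -rsE rootE !hornerE subr_eq0.
Qed.

(** The image of the segment between two points is a connected subset of the finite, hence discrete,
    set of roots of unity. *)
Lemma unity_const n k (h : 'rV[R]_k.+1 -> K) : (0 < n)%N ->
  {within Delta k, continuous h} -> (forall x, Delta k x -> h x ^+ n = 1) ->
  forall x y, Delta k x -> Delta k y -> h x = h y.
Proof.
move=> n0 hc h1 x y Dx Dy; have [rs urs rsP] := unity_roots n0.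
pose ga (t : R) := t *: x + (1 - t) *: y.
have gaD t : `[0, 1]%classic t -> Delta k (ga t).
  by rewrite /= in_itv /= => /andP[t0 t1]; exact: cvx_Delta.
have gac : continuous ga.
  by move=> t; have : contat t ga; [rewrite /ga; cont|].
pose S := [set h (ga t) | t in `[0, 1]%classic].
have cS : connected S.
  have H : {within `[0, 1]%classic, continuous (h \o ga)}; last first.
    exact: (connected_continuous_connected (@segment_connected R 0 1) H).
  apply/within_contP => t It B /=.
  move/within_contP: hc => /(_ (ga t) (gaD t It) B) hB /hB Hn.
  by apply: (@filterS _ (nbhs t) _ _ _ _ (gac t _ Hn)) => u Hu /gaD; exact: Hu.
have acc : accessible_space K by exact/hausdorff_accessible/norm_hausdorff.
have : [set h y] = S.
  apply: cS; first by exists (h y).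
    exists (~` [set` rem (h y) rs]).
      apply: closed_openC; apply: (iffLR accessible_finite_set_closed acc).
      exact: finite_seq.
    apply/seteqP; split=> [z ->|z [[t It <-]]].
      split; last by rewrite /= mem_rem_uniqF.
      by exists 0; rewrite /= ?in_itv /= ?lexx ?ler01 // /ga scale0r subr0 scale1r add0r.
    move=> /= nrem; apply: contra_notP nrem => /eqP hne.
    by rewrite (rem_filter _ urs) mem_filter /= hne rsP h1 ?eqxx //; exact: gaD.
  exists [set h y]; first exact: accessible_closed_set1.
  apply/seteqP; split=> [z ->|z []//]; split=> //.
  by exists 0; rewrite /= ?in_itv /= ?lexx ?ler01 // /ga scale0r subr0 scale1r add0r.
move=> SE; have : S (h x).
  by exists 1; rewrite /= ?in_itv /= ?lexx ?ler01 // /ga scale1r subrr scale0r addr0.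
by rewrite -SE.
Qed.

Section Transfer.
Variables (n : nat) (n0 : (0 < n)%N) (rs : seq K) (urs : uniq rs).
Hypothesis rsP : forall z, (z \in rs) = (z ^+ n == 1).
Variables (T : topologicalType) (X : set T).

Let Y : set (T * K) := X `*` [set z | z != 0].
Let pw (p : T * K) : T * K := (p.1, p.2 ^+ n).
Let act (z : K) (p : T * K) : T * K := (p.1, z * p.2).

Let maps_pw : maps pw Y Y.
Proof.
move=> p [Xp p0]; split; last by rewrite /pw; cont.
by split=> //=; rewrite expf_neq0.
Qed.

Let maps_act z : z != 0 -> maps (act z) Y Y.
Proof.
move=> z0 p [Xp p0]; split; last by rewrite /act; cont.
by split=> //=; rewrite mulf_neq0.
Qed.

Let rs_neq0 z : z \in rs -> z != 0.
Proof.
rewrite rsP; apply: contraTneq => ->.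
by rewrite expr0n gtn_eqF //= eq_sym oner_eq0.
Qed.

Let is_lift k (s t : 'rV[R]_k.+1 -> T * K) := sing Y t /\ pw \o t = s.

Let lift_unique k (s t t' : 'rV[R]_k.+1 -> T * K) : is_lift s t -> is_lift s t' ->
  exists2 z, z \in rs & t' = act z \o t.
Proof.
move=> [Yt ts] [Yt' t's]; pose h x := (t' x).2 / (t x).2.
have t0 x : (t x).2 != 0 by have [] := sing_all x Yt.
have E x : (t' x).1 = (t x).1 /\ (t' x).2 ^+ n = (t x).2 ^+ n.
  by have := congr1 (fun u => u x) ts; rewrite -t's /pw /= => -[-> ->].
have h1 x : h x ^+ n = 1 by rewrite exprMn exprVn (E x).2 mulfV // expf_neq0.
have hc : {within Delta k, continuous h}.
  apply/within_contP => x Dx B hB.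
  have dc : contat (t' x, t x) (fun p : (T * K) * (T * K) => p.1.2 / p.2.2) by cont; exact: t0.
  have [[A1 A2] [/= NA1 NA2] A12] := dc B hB.
  have [_ _ /within_contP/(_ x Dx A2 NA2) H2] := Yt.
  have [_ _ /within_contP/(_ x Dx A1 NA1) H1] := Yt'.
  apply: filterS (filterI H1 H2) => y [H1y H2y] Dy.
  by apply: (A12 (t' y, t y)); split; [exact: H1y|exact: H2y].
have hk x : h x = h (clamp 0).
  have [tc _ _] := Yt; have [tc' _ _] := Yt'.
  rewrite /h -(tc x) -(tc' x) -/(h (clamp x)).
  by apply: (unity_const n0 hc) => //; exact: clamp_in.
exists (h (clamp 0)); first by rewrite rsP h1.
apply/funext => x; rewrite /act /= -(hk x) -(E x).1 /h divfK //.
by case: (t' x).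
Qed.

Let lift k (s : 'rV[R]_k.+1 -> T * K) := xget s [set t | is_lift s t].

(** The transfer of the covering [pw], a sum over all lifts. By [trE] it does not depend on the
    chosen lift; a simplex without lift gets a junk value. *)
Let tr (b : cochains R (T * K)) : cochains R (T * K) := fun k s =>
  \sum_(z <- rs) b k (act z \o lift s).

Let trE b k (s t : 'rV[R]_k.+1 -> T * K) : is_lift s t ->
  tr b s = \sum_(z <- rs) b k (act z \o t).
Proof.
move=> st; have sl : is_lift s (lift s) by exact: (xgetPex s (ex_intro _ t st)).
rewrite /tr; have [z0 z0rs ->] := lift_unique st sl.
have -> : \sum_(z <- rs) b k (act z \o (act z0 \o t)) =
    \sum_(z <- [seq z * z0 | z <- rs]) b k (act z \o t).
  rewrite big_map; apply: eq_bigr => z _; congr (b k _).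
  by apply/funext => x; rewrite /act /= mulrA.
apply: perm_big; apply: uniq_perm => //.
  by rewrite map_inj_uniq //; apply: mulIf; exact: rs_neq0.
move=> z; apply/mapP/idP => [[w wrs ->]|zrs].
  by move: wrs z0rs; rewrite !rsP exprMn => /eqP-> /eqP->; rewrite mulr1.
have z0n := rs_neq0 z0rs; exists (z / z0); last by rewrite divfK.
by move: zrs z0rs; rewrite !rsP exprMn exprVn => /eqP-> /eqP->; rewrite invr1 mulr1.
Qed.

Let cob_tr b k (s t : 'rV[R]_k.+1 -> T * K) : is_lift s t ->
  cob (tr b) s = tr (cob b) s.
Proof.
case: k s t => [|k] s t st; first by rewrite (trE _ st) big1.
rewrite (trE _ st) /= exchange_big /=; apply: eq_bigr => j _.
rewrite (@trE _ _ _ (sface j t)) ?mulr_sumr //.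
by split; [apply: sing_face; case: st|case: st => _ <-].
Qed.

(** Half-planes on which a branch of the root is given by [proot]. Lifts are constructed only for
    simplices inside one of them; the theorem of small simplices takes the place of lifting
    arbitrary simplices. *)
Let U : set (set (T * K)) := [set O | exists2 w, w != 0 &
  O = [set p | 0 < re C (p.2 / w ^+ n)]].

Let U_open O : U O -> open O.
Proof.
move=> [w w0 ->]; apply: open_near => p /= p0.
apply: (ca_near (f := fun p : T * K => re C (p.2 / w ^+ n)) _ (@open_gt R 0)) p0.
by apply: ca_re; cont; rewrite expf_neq0.
Qed.

Let U_cover p : Y p -> exists2 W, U W & W p.
Proof.
move=> [Xp p0]; pose w := n.-root p.2.
have wn : w ^+ n = p.2 by rewrite rootCK.
have w0 : w != 0 by apply: contraNneq p0 => w0; rewrite /= -wn w0 expr0n gtn_eqF.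
exists [set p | 0 < re C (p.2 / w ^+ n)]; first by exists w.
by rewrite /= wn divff // re1.
Qed.

Let small_lift k (s : 'rV[R]_k.+1 -> T * K) : sing Y s -> small U s ->
  exists t, is_lift s t.
Proof.
move=> Ys [W [w w0 ->] sW]; pose l (p : T * K) : T * K := (p.1, w * proot n (p.2 / w ^+ n)).
have wn0 : w ^+ n != 0 by rewrite expf_neq0.
have ml : maps l (Y `&` [set p | 0 < re C (p.2 / w ^+ n)]) Y.
  move=> p [[Xp p0] /= rp]; split.
    split=> //=; rewrite mulf_neq0 //.
    have : p.2 / w ^+ n != 0 by rewrite mulf_neq0 ?invr_neq0.
    by apply: contraNneq => r0; rewrite -(prootX n0 rp) r0 expr0n gtn_eqF.
  rewrite /l; cont; apply: (@ca_comp _ p _ _ (fun p : T * K => p.2 / w ^+ n) (proot n)).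
    by cont; rewrite expf_neq0.
  exact: proot_cont.
exists (l \o s); split.
  by apply: (sing_comp ml); apply/singI; split.
apply/funext => x; have [sc _ _] := Ys; rewrite /l /pw /= exprMn prootX //.
  by rewrite mulrCA divff // mulr1; case: (s x).
by rewrite -(sc x); apply: sW; exact: clamp_in.
Qed.

Let seg_path (z z' : K) (c : cochains R (T * K)) : cocyc Y c ->
  (forall t, unitI t -> toC C (1 - t) * z + toC C t * z' != 0) ->
  exists e, ceq Y (cochB (pull (act z') c) (pull (act z) c)) (cob e).
Proof.
move=> cc zz'; pose H t p := act (toC C (1 - t) * z + toC C t * z') p.
have hH : homot Y Y H.
  move=> t p tI [Xp p0]; split; first by split=> //=; rewrite mulf_neq0 ?zz'.
  by rewrite /H /act; cont; apply: ca_toC; cont.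
exists (prc H c) => k s Ys; rewrite /cochB /pull.
have -> : act z = H 0.
  by apply/funext => p; rewrite /H subr0 rmorph1 rmorph0 mul1r mul0r addr0.
have -> : act z' = H 1.
  by apply/funext => p; rewrite /H subrr rmorph1 rmorph0 mul1r mul0r add0r.
rewrite (prc_homotopy H c Ys) /cochD (prc_ceq hH cc Ys) /prc.
rewrite (_ : evc (@coch0 R _) _ = fun=> 0); last exact: evc0.
have := prfB (fun=> 0) (fun=> 0) (verts R k); rewrite subrr => ->.
by rewrite subrr addr0.
Qed.

Let rotation z (c : cochains R (T * K)) : z != 0 -> cocyc Y c ->
  exists e, ceq Y (cochB (pull (act z) c) c) (cob e).
Proof.
move=> z0 cc.
have act1 : act 1 = id by apply/funext => -[x y]; rewrite /act /= mul1r.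
have imE a b x : im C (toC C a * x + toC C b * z) = a * im C x + b * im C z := imD C a b x z.
have reE a b x : re C (toC C a * x + toC C b * z) = a * re C x + b * re C z := reD C a b x z.
have im0 : im C 0 = 0 by rewrite -(rmorph0 (toC C)) im_toC.
have re0 : re C 0 = 0 by rewrite -(rmorph0 (toC C)) re_toC.
have [good|bad] := pselect (im C z <> 0 \/ 0 < re C z).
  have [t [t0 t1]|e ee] := @seg_path 1 z c cc.
    apply/eqP => E; have := imE (1 - t) t 1; have := reE (1 - t) t 1.
    rewrite E im0 re0 re1 im1 mulr1 mulr0 add0r => /eqP rE /eqP.
    rewrite eq_sym mulf_eq0 => /orP[/eqP tz|/eqP iz].
      by move: rE; rewrite tz mul0r subr0 addr0 eq_sym oner_eq0.
    by case: good => // rz; move/eqP: rE; nra.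
  by exists e; rewrite act1 in ee.
have iz : im C z = 0 by apply: contrapT => iz; apply: bad; left.
(* For [z] on the negative real axis the segment from 1 to [z] passes through 0, hence the detour
   through ['i]. *)
have [t [t0 t1]|e1 ee1] := @seg_path 1 'i c cc.
  apply/eqP => E; have := imD C (1 - t) t 1 'i; have := reD C (1 - t) t 1 'i.
  by rewrite E im0 re0 re1 im1 rei imi; lra.
have [t [t0 t1]|e2 ee2] := @seg_path 'i z c cc.
  apply/eqP => E; have := imE (1 - t) t 'i; rewrite E im0 imi iz => tE.
  have t1' : t = 1 by lra.
  by move: E; rewrite t1' subrr rmorph0 rmorph1 mul0r mul1r add0r => /eqP; rewrite (negbTE z0).
exists (cochD e1 e2) => k s Ys; rewrite cobD -(ee1 _ _ Ys) -(ee2 _ _ Ys) act1.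
rewrite /cochB /pull /=; ring.
Qed.

Let N : rat := (size rs)%:R.

Let N0 : N != 0.
Proof.
rewrite /N pnatr_eq0 size_eq0; apply/eqP => rs0.
by have := rsP 1; rewrite rs0 in_nil expr1n eqxx.
Qed.

Let avg (b : cochains R (T * K)) : cochains R (T * K) := cochZ N^-1 (tr b).

Let cob_avg b k (s : 'rV[R]_k.+1 -> T * K) : sing Y s -> small U s ->
  cob (avg b) s = avg (cob b) s.
Proof.
by move=> Ys sU; have [t st] := small_lift Ys sU; rewrite cobZ (cob_tr b st).
Qed.

Let tr_eq0 b k (s : 'rV[R]_k.+1 -> T * K) : ceq Y b (@coch0 R _) -> sing Y s ->
  small U s -> tr b s = 0.
Proof.
move=> b0 Ys sU; have [t st] := small_lift Ys sU; rewrite (trE _ st).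
rewrite big_seq big1 // => z zrs; apply: b0; case: st => Yt _.
exact: sing_comp (maps_act (rs_neq0 zrs)) Yt.
Qed.

Let lift_pw k (t : 'rV[R]_k.+1 -> T * K) : sing Y t -> is_lift (pw \o t) t.
Proof. by []. Qed.

Lemma qis_power_aux : qis pw Y Y.
Proof.
(* On small simplices averaging a pullback over the lifts gives the cochain back, so there [a] is
   the coboundary of the average of [b]. *)
have inj (a b : cochains R (T * K)) : cocyc Y a -> ceq Y (pull pw a) (cob b) ->
    exists a' : cochains R (T * K), ceq Y a (cob a').
  move=> ca ab.
  have [||e ee e0] := small_acyclic U_open U_cover (c := cochB a (cob (avg b))).
  - by move=> k s Ys; rewrite cobB ca // (cob_cob _ Ys) subrr.
  - move=> k s Ys sU; rewrite /cochB cob_avg // /avg /cochZ.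
    have [t st] := small_lift Ys sU; rewrite (trE _ st).
    rewrite big_seq (eq_bigr (fun=> a k s)) => [|z zrs].
      rewrite -big_seq big_const_seq count_predT iter_addr_0 -mulr_natl.
      by rewrite -/N mulKf ?subrr.
    have [Yt ts] := st; have z0 := rs_neq0 zrs.
    rewrite -(ab _ _ (sing_comp (maps_act z0) Yt)) /pull; congr (a k _).
    rewrite -ts; apply/funext => x; rewrite /pw /act /= exprMn.
    by move: zrs; rewrite rsP => /eqP ->; rewrite mul1r.
  exists (cochD (avg b) e) => k s Ys; rewrite cobD -ee // /cochB; ring.
(* The pullback of the average of [b] is the mean of the rotated copies of [b], and each rotation is
   homotopic to the identity. *)
have surj (b : cochains R (T * K)) : cocyc Y b ->
    exists a b' : cochains R (T * K), cocyc Y a /\ ceq Y b (cochD (pull pw a) (cob b')).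
  move=> cb.
  have [||e ee e0] := small_acyclic U_open U_cover (c := cob (avg b)).
  - by move=> k s Ys; exact: cob_cob Ys.
  - by move=> k s Ys sU; rewrite cob_avg // /avg /cochZ tr_eq0 ?mulr0.
  (* The average is known to be a cocycle on small simplices only; [e] repairs it and vanishes on
     those. *)
  pose a := cochB (avg b) e.
  have ca : cocyc Y a by move=> k s Ys; rewrite cobB ee // subrr.
  have rot z : exists e' : cochains R (T * K), z \in rs -> ceq Y (cochB (pull (act z) b) b) (cob e').
    have [/rs_neq0 z0|_] := boolP (z \in rs); last by exists b.
    by have [e' He'] := rotation z0 cb; exists e'.
  have [er erP] := choice rot.
  pose es : cochains R (T * K) := fun k s => \sum_(z <- rs) er z k s.
  have cob_es k (s : 'rV[R]_k.+1 -> T * K) : cob es s = \sum_(z <- rs) cob (er z) s.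
    case: k s => [|k] s /=; first by rewrite big1.
    by rewrite exchange_big /=; apply: eq_bigr => j _; rewrite mulr_sumr.
  pose d := cochB (cochB (pull pw a) b) (cochZ N^-1 (cob es)).
  pose U' : set (set (T * K)) := [set O | exists2 W, U W & O = (Y `&` pw @^-1` W)].
  have pwc : continuous pw by move=> p; have : contat p pw; [rewrite /pw; cont|].
  pose U'' : set (set (T * K)) := [set O | exists2 W, U W & O = pw @^-1` W].
  have oU W : U'' W -> open W.
    by move=> [V UV ->]; apply: open_comp => [p _|]; [exact: pwc|exact: U_open].
  have cU p : Y p -> exists2 W, U'' W & W p.
    move=> Yp; have [Ypw _] := maps_pw Yp; have [W UW Wp] := U_cover Ypw.
    by exists (pw @^-1` W) => //; exists W.
  have [||e' ee' _] := small_acyclic oU cU (c := d).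
  - move=> k s Ys; rewrite 2!cobB cobZ (cob_cob es Ys) mulr0 subr0 cb // subr0 cob_pull.
    exact: (ca _ _ (sing_comp maps_pw Ys)).
  - move=> k t Yt [W [V UV ->] tW]; rewrite /d /cochB /pull.
    have Ypt := sing_comp maps_pw Yt.
    have sU : small U (pw \o t) by exists V.
    rewrite /a /cochB e0 // subr0 /avg /cochZ (trE _ (lift_pw Yt)) cob_es.
    have -> : \sum_(z <- rs) cob (er z) t = \sum_(z <- rs) b k (act z \o t) - N * b k t.
      transitivity (\sum_(z <- rs) (b k (act z \o t) - b k t)).
        by apply: eq_big_seq => z zrs; rewrite -(erP z zrs _ _ Yt).
      by rewrite sumrB big_const_seq count_predT iter_addr_0 mulr_natl.
    by rewrite mulrBr mulKf // subrr.
  exists a, (cochB (cochZ (- N^-1) es) e'); split=> // k s Ys.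
  have := ee' _ _ Ys; rewrite /d /cochB /cochD cobB cobZ /cochZ => <-; ring.
move=> a b ca ab; have [a1 aa1] := inj a b ca ab.
have [|a2 [b2 [ca2 bb2]]] := surj (cochB b (pull pw a1)).
  move=> k s Ys; rewrite cobB -ab // cob_pull /pull.
  by rewrite aa1 ?subrr //; exact: sing_comp maps_pw Ys.
exists (cochD a1 a2), b2; split=> k s Ys.
  by rewrite cobD ca2 // addr0 aa1.
have := bb2 _ _ Ys; rewrite /cochB /cochD /pull => /(canRL (subrK _)) ->; ring.
Qed.

End Transfer.

Lemma qis_power n (T : topologicalType) (X : set T) : (0 < n)%N ->
  qis (fun p : T * K => (p.1, p.2 ^+ n)) (X `*` [set z | z != 0]) (X `*` [set z | z != 0]).
Proof.
by move=> n0; have [rs urs rsP] := unity_roots n0; exact: (qis_power_aux n0 urs rsP).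
Qed.

End Power.

(** * Betti numbers and their invariance *)

Section Betti.
Variable R : realType.
Notation qis := (qis R).

Section Graded.
Variable T : topologicalType.
Implicit Types (X : set T) (c : cochains R T).

Definition ceqk X k c c' := forall f : 'rV[R]_k.+1 -> T, sing X f -> c k f = c' k f.

Definition cobd X k c := exists b, ceqk X k c (cob b).

(** Betti numbers concern one degree while cocycles and [qis] concern all of them; truncation makes
    a condition in one degree into a condition on a whole family. *)
Definition trunc k c : cochains R T := fun m f => if m == k then c m f else 0.

Lemma cob_trunc k c m (f : 'rV[R]_m.+1 -> T) :
  cob (trunc k c) f = if m == k.+1 then cob c f else 0.
Proof.
case: m f => [//|m] f; rewrite eqSS /= /trunc; case: eqP => // _.
by rewrite big1 // => j _; rewrite mulr0.
Qed.

Lemma cobd_full X k c : cobd X k c -> exists b, ceq X (trunc k c) (cob b).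
Proof.
move=> [b cb]; case: k cb => [|k] cb.
  exists (@coch0 R T) => m f Xf; rewrite cob0 /trunc; case: eqP => // m0.
  by move: f Xf; rewrite m0 => f Xf; rewrite cb.
exists (trunc k b) => m f Xf; rewrite cob_trunc /trunc; case: eqP => // mk.
by move: f Xf; rewrite mk => f Xf; rewrite cb.
Qed.

Lemma cobd_ceqk X k c c' : ceqk X k c c' -> cobd X k c -> cobd X k c'.
Proof. by move=> cc [b cb]; exists b => f Xf; rewrite -cc ?cb. Qed.

Lemma cocyc_trunc X k c : ceqk X k.+1 (cob c) (@coch0 R T) -> cocyc X (trunc k c).
Proof.
move=> cc m f Xf; rewrite cob_trunc; case: eqP => // mk.
by move: f Xf; rewrite mk => f Xf; rewrite cc.
Qed.

Lemma ceqk_trunc X k c : ceqk X k (trunc k c) c.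
Proof. by move=> f _; rewrite /trunc eqxx. Qed.

Lemma cobdD X k c c' : cobd X k c -> cobd X k c' -> cobd X k (cochD c c').
Proof.
by move=> [b cb] [b' cb']; exists (cochD b b') => f Xf; rewrite cobD /cochD cb // cb'.
Qed.

Lemma cobdB X k c c' : cobd X k c -> cobd X k c' -> cobd X k (cochB c c').
Proof.
by move=> [b cb] [b' cb']; exists (cochB b b') => f Xf; rewrite cobB /cochB cb // cb'.
Qed.

Lemma cobd_sub X Y k c : X `<=` Y -> cobd Y k c -> cobd X k c.
Proof. by move=> XY [b cb]; exists b => f /(sing_sub XY) /cb. Qed.

Lemma cocycD X c c' : cocyc X c -> cocyc X c' -> cocyc X (cochD c c').
Proof. by move=> cc cc' k f Xf; rewrite cobD cc // cc' // addr0. Qed.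

Lemma cocycB X c c' : cocyc X c -> cocyc X c' -> cocyc X (cochB c c').
Proof. by move=> cc cc' k f Xf; rewrite cobB cc // cc' // subrr. Qed.

Definition lin b (q : 'I_b -> rat) (c : 'I_b -> cochains R T) : cochains R T :=
  fun k f => \sum_i q i * c i k f.

Lemma cob_lin b (q : 'I_b -> rat) (c : 'I_b -> cochains R T) k (f : 'rV[R]_k.+1 -> T) :
  cob (lin q c) f = \sum_i q i * cob (c i) f.
Proof.
case: k f => [|k] f /=; first by rewrite big1 // => i _; rewrite mulr0.
rewrite (eq_bigr (fun j : 'I_k.+2 => \sum_i (-1) ^+ j * (q i * c i k (sface j f)))).
  rewrite exchange_big /=; apply: eq_bigr => i _; rewrite mulr_sumr.
  by apply: eq_bigr => j _; rewrite mulrCA.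
by move=> j _; rewrite mulr_sumr.
Qed.

Lemma cocyc_lin X b (q : 'I_b -> rat) (c : 'I_b -> cochains R T) : (forall i, cocyc X (c i)) -> cocyc X (lin q c).
Proof.
by move=> cc k f Xf; rewrite cob_lin big1 // => i _; rewrite cc // mulr0.
Qed.

Definition betti X k b := exists c : 'I_b -> cochains R T,
  [/\ forall i, cocyc X (c i),
      (forall z, cocyc X z -> exists q, cobd X k (cochB z (lin q c))) &
      (forall q, cobd X k (lin q c) -> forall i, q i = 0)].

End Graded.

Section Transfer.
Variables (T T' : topologicalType) (f : T -> T') (X : set T) (Y : set T').
Hypotheses (mf : maps f X Y) (qf : qis f X Y).

Lemma cocyc_pull c : cocyc Y c -> cocyc X (pull f c : cochains R T).
Proof. by move=> cc; rewrite /cocyc cob_pull; exact: pull_ceq cc. Qed.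

Lemma cobd_pull k c : cobd Y k c -> cobd X k (pull f c : cochains R T).
Proof.
move=> [b cb]; exists (pull f b) => s Xs; rewrite cob_pull /pull.
by rewrite cb //; exact: sing_comp Xs.
Qed.

Lemma qis_inj k (a : cochains R T') : cocyc Y a -> cobd X k (pull f a) -> cobd Y k a.
Proof.
move=> ca /cobd_full[b ab].
have [||a' [_ [aa' _]]] := qf (a := trunc k a) (b := b).
- by apply: cocyc_trunc => s Ys; exact: ca.
- by move=> m s Xs; rewrite -ab.
by exists a' => s Ys; rewrite -aa' // (ceqk_trunc _ Ys).
Qed.

Lemma qis_surj (b : cochains R T) : cocyc X b -> exists (a : cochains R T') (b' : cochains R T),
  cocyc Y a /\ ceq X b (cochD (pull f a) (cob b')).
Proof.
move=> cb; have [||a [b' [ca bb]]] := qf (a := @coch0 R T') (b := b).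
- by move=> k s _; rewrite cob0.
- by move=> k s Xs; rewrite cb.
by exists a, b'; split=> // k s Ys; rewrite -ca.
Qed.

Lemma betti_qis k b : betti X k b -> betti Y k b.
Proof.
move=> [c [cc csp cin]].
have [a aP] := choice (fun i => qis_surj (cc i)).
have [b' bP] := choice aP.
have ca i : cocyc Y (a i) by have [] := bP i.
have sim (q : 'I_b -> rat) : cobd X k (cochB (lin q c) (pull f (lin q a))).
  exists (lin q b') => s Xs; rewrite cob_lin /cochB /pull -sumrB.
  apply: eq_bigr => i _; have [_ /(_ k s Xs) ->] := bP i.
  by rewrite /cochD /pull; ring.
exists a; split=> // [z cz|q qa].
  have [q zq] := csp _ (cocyc_pull cz); exists q.
  apply: qis_inj; first by apply: cocycB => //; exact: cocyc_lin.
  apply: cobd_ceqk (cobdD zq (sim q)) => s Xs.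
  by rewrite /cochD /cochB /pull; ring.
apply: cin; apply: cobd_ceqk (cobdD (sim q) (cobd_pull qa)) => s Xs.
by rewrite /cochD /cochB /pull; ring.
Qed.

End Transfer.

Section Point.
Variables (T : topologicalType) (x0 : T).

Lemma sing_point k (f : 'rV[R]_k.+1 -> T) : sing [set x0] f -> f = fun=> x0.
Proof. by move=> Xf; apply/funext => x; have := sing_all x Xf. Qed.

Lemma sing_cst k : sing [set x0] (fun _ : 'rV[R]_k.+1 => x0).
Proof.
split=> //; apply/within_contP => x _ B /nbhs_singleton Bx.
exact: (@filterE _ (nbhs x)).
Qed.

Lemma sum_signs n : \sum_(j < n) (-1 : rat) ^+ j = (odd n)%:R.
Proof.
elim: n => [|n IHn]; first by rewrite big_ord0.
by rewrite big_ord_recr /= IHn -signr_odd; case: (odd n); rewrite /= ?expr0 ?expr1 ?subrr ?add0r.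
Qed.

Lemma cob_point (c : cochains R T) k (f : 'rV[R]_k.+2 -> T) : sing [set x0] f ->
  cob c f = (odd k)%:R * c k (fun=> x0).
Proof.
move=> /sing_point -> /=.
rewrite (eq_bigr (fun j : 'I_k.+2 => (-1) ^+ j * c k (fun=> x0))) //.
by rewrite -mulr_suml sum_signs /= negbK.
Qed.

Lemma betti_point k : betti [set x0] k (k == 0)%N.
Proof.
case: k => [|k] /=.
  exists (fun _ => trunc 0 (fun _ _ => 1)); split=> [_|z cz|q [b qb] i].
  - by apply: cocyc_trunc => f /cob_point ->; rewrite mul0r.
  - exists (fun _ => z 0%N (fun=> x0)), (@coch0 R T) => f /sing_point ->.
    by rewrite /cochB /lin /trunc /= big_ord1 mulr1 subrr.
  - have Xp : sing [set x0] (fun _ : 'rV[R]_1 => x0).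
      exact: sing_cst.
    have := qb _ Xp; rewrite /lin /trunc /= big_ord1 mulr1 => q0.
    by rewrite -[RHS]q0; congr (q _); apply: val_inj; case: i => -[].
exists (fun=> @coch0 R T); split=> [[]//|z cz|q _ []//].
exists (fun=> 0); have Xp m : sing [set x0] (fun _ : 'rV[R]_m.+1 => x0).
  exact: sing_cst.
(* On a point the differentials are alternately zero and the identity. At degree [k.+1] the outgoing
   one is the identity for even [k], the incoming one for odd [k]. *)
case ok : (odd k); last first.
  have := cz k.+2 _ (Xp _); rewrite (cob_point _ (Xp _)) /= ok mul1r => z0.
  exists (@coch0 R T) => f /sing_point ->.
  by rewrite cob0 /cochB /lin big_ord0 subr0; exact: z0.
exists (fun _ _ => z k.+1 (fun=> x0)) => f Xf; rewrite (cob_point _ Xf) ok mul1r.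
by rewrite (sing_point Xf) /cochB /lin big_ord0 subr0.
Qed.

End Point.

End Betti.

Lemma cocyc_sub (R : realType) (T : topologicalType) (X Y : set T) (c : cochains R T) :
  X `<=` Y -> cocyc Y c -> cocyc X c.
Proof. exact: ceq_sub. Qed.

(** * Betti numbers of products with spheres *)

Section Suspension.
Variables (R : realType) (K : numClosedFieldType) (C : cplx R K).
Notation homotopic := (homotopic R).
Notation betti := (@betti R _).
Variables (T : topologicalType) (X : set T) (E : normedModType K).
Notation pr := (pull (fst : T * E -> T)).

(* [b] is the dimension of the cokernel of [H^k(X) -> H^k(X x D)]. *)
Definition cokb (D : set E) k b := exists y : 'I_b -> cochains R (T * E)%type,
  [/\ forall i, cocyc (X `*` D) (y i),
      (forall z, cocyc (X `*` D) z -> exists (x : cochains R T) q, cocyc X x /\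
        cobd (X `*` D) k (cochB (cochB z (pr x)) (lin q y))) &
      (forall (x : cochains R T) q, cocyc X x ->
        cobd (X `*` D) k (cochD (pr x) (lin q y)) -> forall i, q i = 0)].

Lemma slice_cobd (D : set E) e k (x : cochains R T) : D e ->
  cobd (X `*` D) k (pr x) -> cobd X k x.
Proof. by move=> De /(cobd_pull (maps_slice (X := X) De)). Qed.

(** A slice splits the projection, so the cohomology of [X] injects and its dimension adds to that
    of the cokernel. *)
Lemma betti_cokb (D : set E) e k b b' : D e -> betti X k b -> cokb D k b' ->
  betti (X `*` D) k (b + b').
Proof.
move=> De [c [cc csp cin]] [y [cy ysp yin]].
pose d (i : 'I_(b + b')) := match fintype.split i with inl i => pr (c i) | inr j => y j end.
have linE q : lin q d = cochD (pr (lin (fun i => q (lshift b' i)) c))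
    (lin (fun j => q (rshift b j)) y).
  apply: functional_extensionality_dep => m; apply/funext => f.
  rewrite /lin big_split_ord /cochD /pull; congr (_ + _); apply: eq_bigr => i _.
    by rewrite /d (unsplitK (inl i)).
  by rewrite /d (unsplitK (inr i)).
have mf := maps_fst (X := X) (D := D).
exists d; split=> [i|z cz|q qd].
- by rewrite /d; case: fintype.split => j; [exact: (cocyc_pull mf (cc j))|exact: cy].
- have [x [q [cx zq]]] := ysp z cz; have [p xp] := csp x cx.
  exists (fun i => match fintype.split i with inl i => p i | inr j => q j end).
  apply: cobd_ceqk (cobdD zq (cobd_pull mf xp)) => f Xf.
  rewrite linE /cochB /cochD /pull /lin.
  rewrite [X in _ = _ - (X + _)](eq_bigr (fun i => p i * c i k (fst \o f))) => [|i _].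
    rewrite [X in _ = _ - (_ + X)](eq_bigr (fun i => q i * y i k f)) => [|i _]; first ring.
    by rewrite (unsplitK (inr i)).
  by rewrite (unsplitK (inl i)).
rewrite linE in qd.
have cx := cocyc_lin (fun i => q (lshift b' i)) cc.
have q2 := yin _ _ cx qd.
have q1 := cin (fun i => q (lshift b' i)).
move=> i; rewrite -(splitK i); case: (fintype.split i) => j /=; last exact: q2.
apply: q1; apply: (slice_cobd De); apply: cobd_ceqk qd => f Xf.
by rewrite /cochD {2}/lin big1 ?addr0 // => l _; rewrite q2 mul0r.
Qed.

Section Cover.
Variables (U V W D : set E) (u v : E).
Hypotheses (oU : open U) (oV : open V) (DE : D = U `|` V) (WE : U `&` V = W).
Hypotheses (Uu : U u) (hU : homotopic U U (fun=> u) id).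
Hypotheses (Vv : V v) (hV : homotopic V V (fun=> v) id).

Let OU : set (T * E) := setT `*` U.
Let OV : set (T * E) := setT `*` V.
Let Y := X `*` D.

Let YU : Y `&` OU = X `*` U.
Proof. by rewrite /Y setX_TI DE setUK. Qed.
Let YV : Y `&` OV = X `*` V.
Proof. by rewrite /Y setX_TI DE setUC setUK. Qed.
Let YUV : Y `&` (OU `&` OV) = X `*` W.
Proof.
rewrite setX_TI /Y setX_TI DE WE; congr (_ `*` _); apply/setIidPr => e.
by rewrite -WE => -[? _]; left.
Qed.
Let YO : Y `<=` OU `|` OV.
Proof. by rewrite /Y DE => -[x e] [/= _ [?|?]]; [left|right]. Qed.
Let oOU : open OU. Proof. exact: openX. Qed.
Let oOV : open OV. Proof. exact: openX. Qed.

Let surjU (z : cochains R (T * E)) : cocyc (X `*` U) z -> exists (x : cochains R T) (a : cochains R (T * E)),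
  cocyc X x /\ ceq (X `*` U) z (cochD (pr x) (cob a)).
Proof. exact: (qis_surj (qis_fst X Uu hU).1). Qed.

Let surjV (z : cochains R (T * E)) : cocyc (X `*` V) z -> exists (x : cochains R T) (a : cochains R (T * E)),
  cocyc X x /\ ceq (X `*` V) z (cochD (pr x) (cob a)).
Proof. exact: (qis_surj (qis_fst X Vv hV).1). Qed.

Let glue_cobd k (z a1 a2 : cochains R (T * E)) : cocyc Y z -> ceqk (X `*` U) k.+1 z (cob a1) ->
  ceqk (X `*` V) k.+1 z (cob a2) -> ceqk (X `*` W) k a1 a2 -> cobd Y k.+1 z.
Proof.
move=> cz z1 z2 a12.
have full (A : set (T * E)) (a : cochains R (T * E)) : ceqk A k.+1 z (cob a) -> ceq A (trunc k.+1 z) (cob (trunc k a)).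
  move=> za m f Af; rewrite cob_trunc /trunc; case: eqP => // mk.
  by move: f Af; rewrite mk => f Af; rewrite za.
have [||||a [za _ _]] := @mv_cob _ _ Y OU OV oOU oOV YO (trunc k.+1 z) (trunc k a1) (trunc k a2).
- by apply: cocyc_trunc => f Yf; exact: cz.
- by rewrite YU; exact: full.
- by rewrite YV; exact: full.
- rewrite YUV => m f Xf; rewrite /trunc; case: eqP => // mk.
  by move: f Xf; rewrite mk => f Xf; rewrite a12.
by exists a => f Yf; rewrite -za // (ceqk_trunc _ Yf).
Qed.

Section Nonempty.
Variable e0 : E.
Hypothesis We0 : W e0.

(** The connecting homomorphism of the cover by [U] and [V]. Since both are contractible, it
    identifies the classes not coming from [X], with degree raised by one. *)
Lemma cokb_susp k b : cokb W k b -> cokb D k.+1 b.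
Proof.
move=> [y [cy ysp yin]].
have WU : X `*` W `<=` X `*` U by rewrite -WE => -[x e] [? []].
have WV : X `*` W `<=` X `*` V by rewrite -WE => -[x e] [? []].
have UD : X `*` U `<=` Y by rewrite -YU => ? [].
have VD : X `*` V `<=` Y by rewrite -YV => ? [].
pose ext (c : cochains R (T * E)) : cochains R (T * E) := cglue OV c (@coch0 R _).
have extE c : ceq (X `*` W) (ext c) c.
  by rewrite -YUV => m f /singI[_ fO]; rewrite /ext /cglue; case: asboolP => // -[] x /fO [].
(* The connecting map on representatives: extend the cocycle, take its coboundary over [U] and zero
   over [V]. *)
have ex i : exists w : cochains R (T * E), [/\ cocyc Y w, ceq (X `*` U) w (cob (ext (trunc k (y i)))) & ceq (X `*` V) w (@coch0 R _)].
  have [|||w [cw w1 w2]] := @mv_cocyc _ _ Y OU OV oOU oOV YO (cob (ext (trunc k (y i)))) (@coch0 R _).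
  - exact: cob_cob.
  - by move=> m f _; rewrite cob0.
  - rewrite YUV => m f Xf; rewrite (ceq_cob (extE _) Xf) cob_trunc.
    by case: eqP => // _; rewrite cy.
  by exists w; rewrite YU in w1; rewrite YV in w2.
have [w wP] := choice ex.
have cw i : cocyc Y (w i) by have [] := wP i.
have wU i : ceq (X `*` U) (w i) (cob (ext (trunc k (y i)))) by have [] := wP i.
have wV i : ceq (X `*` V) (w i) (@coch0 R _) by have [] := wP i.
have mfst (A : set E) : maps fst (X `*` A) X by exact: maps_fst.
have sl (A : set E) e : A e -> maps (fun x => (x, e)) X (X `*` A) by exact: maps_slice.
(* The classes of [X] found over [U] and over [V] agree, as one sees on the slice through the point
   [e0] of the intersection. *)
have sim (x x' : cochains R T) : cocyc X x -> cocyc X x' -> forall z a a' : cochains R (T * E),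
    ceq (X `*` U) z (cochD (pr x) (cob a)) -> ceq (X `*` V) z (cochD (pr x') (cob a')) ->
    exists h : cochains R T, ceq X (cochB x x') (cob h).
  move=> cx cx' z a a' za za'.
  exists (cochB (pull (fun x => (x, e0)) a') (pull (fun x => (x, e0)) a)) => m f Xf.
  have [Ue Ve] : U e0 /\ V e0 by move: We0; rewrite -WE.
  have := za _ _ (sing_comp (sl U e0 Ue) Xf); rewrite (za' _ _ (sing_comp (sl V e0 Ve) Xf)).
  rewrite cobB !cob_pull /cochB /cochD /pull => E1.
  have -> : x m f = x m (fst \o ((fun x => (x, e0)) \o f)) by [].
  have -> : x' m f = x' m (fst \o ((fun x => (x, e0)) \o f)) by [].
  by lra.
exists w; split=> // [z cz|x q cx [g xg]].
  have [x1 [a1 [cx1 z1]]] := surjU (cocyc_sub UD cz).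
  have [x2 [a2 [cx2 z2]]] := surjV (cocyc_sub VD cz).
  have [h hP] := sim _ _ cx1 cx2 _ _ _ z1 z2.
  pose a2' := cochB a2 (pr h).
  have z2' : ceq (X `*` V) z (cochD (pr x1) (cob a2')).
    move=> m f Xf; rewrite z2 // /cochD cobB cob_pull.
    have := hP _ _ (sing_comp (mfst V) Xf); rewrite /cochB /pull => <-; ring.
  have [|x' [q [cx' zq]]] := ysp (cochB a1 a2').
    move=> m f Xf; rewrite cobB; have := z1 _ _ (sing_sub WU Xf).
    by rewrite (z2' _ _ (sing_sub WV Xf)) /cochD /coch0; lra.
  have [e' eP] := zq.
  exists x1, q; split=> //.
  apply: (@glue_cobd _ _ (cochB (cochB (cochB a1 (lin q (fun i => ext (trunc k (y i))))) (pr x')) (cob (ext e'))) a2').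
  - apply: cocycB; last exact: cocyc_lin.
    by apply: cocycB => //; exact: (cocyc_pull (mfst D)).
  - move=> f Xf; rewrite !cobB (cob_cob _ Xf) cob_pull cob_lin /cochB /pull.
    rewrite (cx' _ _ (sing_comp (mfst U) Xf)) z1 // /cochD /lin /pull.
    rewrite (eq_bigr (fun i => q i * cob (ext (trunc k (y i))) f)) => [|i _]; last by rewrite wU.
    rewrite /coch0; ring.
  - move=> f Xf; rewrite /cochB z2' // /lin big1 => [|i _]; last by rewrite wV // mulr0.
    by rewrite /cochD; ring.
  - move=> f Xf; rewrite /cochB (ceq_cob (extE e') Xf).
    have := eP _ Xf; rewrite /cochB /lin => <-.
    rewrite (eq_bigr (fun i => q i * y i k f)) => [|i _]; first by rewrite /a2' /cochB; ring.
    by rewrite extE // (ceqk_trunc _ Xf).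
have xV : cobd (X `*` V) k.+1 (pr x).
  exists g => f Xf; rewrite -(xg f (sing_sub VD Xf)) /cochD /lin big1 ?addr0 // => i _.
  by rewrite wV // mulr0.
have [g0 xg0] := slice_cobd Vv xV.
pose g' := cochB g (pr g0).
have trcoc (A : set E) (c : cochains R (T * E)) : ceqk (X `*` A) k.+1 (cob c) (@coch0 R _) -> cocyc (X `*` A) (trunc k c).
  exact: cocyc_trunc.
pose G := cochB (lin q (fun i => ext (trunc k (y i)))) g'.
have cG : cocyc (X `*` U) (trunc k G).
  apply: trcoc => f Xf; rewrite cobB cobB cob_lin cob_pull.
  have := xg f (sing_sub UD Xf); rewrite /cochD /lin /pull => <-.
  rewrite -(xg0 _ (sing_comp (mfst U) Xf)).
  rewrite (eq_bigr (fun i => q i * w i k.+1 f)) => [|i _]; last by rewrite wU.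
  by rewrite /coch0; ring.
have cg' : cocyc (X `*` V) (trunc k g').
  apply: trcoc => f Xf; rewrite cobB cob_pull.
  have := xg f (sing_sub VD Xf); rewrite /cochD /lin /pull => <-.
  rewrite -(xg0 _ (sing_comp (mfst V) Xf)) big1 => [|i _]; last by rewrite wV // mulr0.
  by rewrite /coch0; ring.
have [x3 [a3 [cx3 GP]]] := surjU cG.
have [x4 [a4 [cx4 gP]]] := surjV cg'.
apply: (yin (cochB (@coch0 R T) (cochD x3 x4)) q).
  apply: cocycB; last exact: cocycD.
  by move=> m f _; rewrite cob0.
exists (cochD a3 a4) => f Xf.
have := GP _ _ (sing_sub WU Xf); have := gP _ _ (sing_sub WV Xf).
rewrite (ceqk_trunc g' (sing_sub WV Xf)) (ceqk_trunc G (sing_sub WU Xf)).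
rewrite /G /g' cobD /cochD /cochB /pull /coch0 /lin.
rewrite (eq_bigr (fun i => q i * y i k f)) => [|i _]; first lra.
by rewrite extE // (ceqk_trunc _ Xf).
Qed.

(** A 0-simplex lies over [U] or over [V], and the slice through [e0] forces the same function on
    [X] in both cases. *)
Lemma cokb_susp0 : cokb D 0 0.
Proof.
have UD : X `*` U `<=` Y by rewrite -YU => ? [].
have VD : X `*` V `<=` Y by rewrite -YV => ? [].
exists (fun=> @coch0 R _); split=> [[]//|z cz|x q cx _ []//].
have [x1 [a1 [cx1 z1]]] := surjU (cocyc_sub UD cz).
have [x2 [a2 [cx2 z2]]] := surjV (cocyc_sub VD cz).
have [Ue Ve] : U e0 /\ V e0 by move: We0; rewrite -WE.
exists x1, (fun=> 0); split=> //; exists (@coch0 R _) => f Xf.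
rewrite cob0 /cochB /lin big_ord0 subr0.
have fcst (O : set (T * E)) : O (f (clamp 0)) -> forall x, stdsimplex R 0 x -> O (f x).
  move=> Of x [x0 x1']; suff -> : x = clamp 0 by [].
  apply/rowP => j; have [_ c1] := clamp_in (0 : 'rV[R]_1).
  by move: x1' c1; rewrite !big_ord1 !ord1 => -> ->.
have zz : z 0%N f = x1 0%N (fst \o f).
  have /YO[fU|fV] : Y (f (clamp 0)) by exact: sing_all Xf.
    have Uf : sing (X `*` U) f by rewrite -YU; apply/singI; split=> //; exact: fcst.
    by rewrite z1 // /cochD /pull /= addr0.
  have Vf : sing (X `*` V) f by rewrite -YV; apply/singI; split=> //; exact: fcst.
  have Xff := sing_comp (maps_fst (X := X) (D := V)) Vf.
  rewrite z2 // /cochD /pull /= addr0.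
  have := z1 _ _ (sing_comp (maps_slice (X := X) Ue) Xff).
  by rewrite (z2 _ _ (sing_comp (maps_slice (X := X) Ve) Xff)) /cochD /pull /= !addr0.
by rewrite zz /pull subrr.
Qed.

End Nonempty.

(** Here [D] consists of two disjoint contractible pieces, the case of the 0-sphere; the new classes
    are those of [X] placed on [U] alone. *)
Lemma cokb_base k b : W = set0 -> betti X k b -> cokb D k b.
Proof.
move=> W0 [c [cc csp cin]].
have UD : X `*` U `<=` Y by rewrite -YU => ? [].
have VD : X `*` V `<=` Y by rewrite -YV => ? [].
have nW (c1 c2 : cochains R (T * E)) : ceq (Y `&` (OU `&` OV)) c1 c2.
  by rewrite YUV W0 => m f Xf; have [] := sing_all (clamp 0) Xf.
have mfst (A : set E) : maps fst (X `*` A) X by exact: maps_fst.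
have ex i : exists y : cochains R (T * E), [/\ cocyc Y y, ceq (X `*` U) y (pr (c i)) & ceq (X `*` V) y (@coch0 R _)].
  have [|||y [cy y1 y2]] := @mv_cocyc _ _ Y OU OV oOU oOV YO (pr (c i)) (@coch0 R _).
  - by rewrite YU; exact: cocyc_pull.
  - by move=> m f _; rewrite cob0.
  - exact: nW.
  by exists y; rewrite YU in y1; rewrite YV in y2.
have [y yP] := choice ex.
have cy i : cocyc Y (y i) by have [] := yP i.
have yU i : ceq (X `*` U) (y i) (pr (c i)) by have [] := yP i.
have yV i : ceq (X `*` V) (y i) (@coch0 R _) by have [] := yP i.
have glue2 (z : cochains R (T * E)) : cocyc Y z -> cobd (X `*` U) k z -> cobd (X `*` V) k z -> cobd Y k z.
  move=> cz /cobd_full[b1 zb1] /cobd_full[b2 zb2].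
  have [||||a [za _ _]] := @mv_cob _ _ Y OU OV oOU oOV YO (trunc k z) b1 b2.
  - by apply: cocyc_trunc => f Yf; exact: cz.
  - by rewrite YU.
  - by rewrite YV.
  - exact: nW.
  by exists a => f Yf; rewrite -za // (ceqk_trunc _ Yf).
exists y; split=> // [z cz|x q cx xq].
  have [x1 [a1 [cx1 z1]]] := surjU (cocyc_sub UD cz).
  have [x2 [a2 [cx2 z2]]] := surjV (cocyc_sub VD cz).
  have [q [h hP]] := csp _ (cocycB cx1 cx2).
  exists x2, q; split=> //; apply: glue2.
    apply: cocycB; last exact: cocyc_lin.
    by apply: cocycB => //; exact: (cocyc_pull (mfst D)).
    exists (cochD (pr h) a1) => f Xf; rewrite cobD cob_pull /pull.
    rewrite -(hP _ (sing_comp (mfst U) Xf)) /cochB z1 // /cochD /pull /lin.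
    rewrite (eq_bigr (fun i => q i * c i k (fst \o f))) => [|i _]; first ring.
    by rewrite yU.
  exists a2 => f Xf; rewrite /cochB z2 // /cochD /lin big1 => [|i _]; first ring.
  by rewrite yV // mulr0.
have xV : cobd (X `*` V) k (pr x).
  apply: cobd_ceqk (cobd_sub VD xq) => f Xf; rewrite /cochD /lin big1 ?addr0 // => i _.
  by rewrite yV // mulr0.
have xX := slice_cobd Vv xV.
have xU : cobd (X `*` U) k (pr (cochD x (lin q c))).
  apply: cobd_ceqk (cobd_sub UD xq) => f Xf; rewrite /cochD /pull /lin; congr (_ + _).
  by apply: eq_bigr => i _; rewrite yU.
apply: cin; apply: cobd_ceqk (cobdB (slice_cobd Uu xU) xX) => f Xf.
by rewrite /cochB /cochD; ring.
Qed.

End Cover.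

Definition bshift r (b : nat -> nat) k := if (k < r)%N then 0%N else b (k - r)%N.

Lemma frame_pt (l : E -> R) v fr : frame C ((l, v) :: fr) -> nz ((l, v) :: fr) v.
Proof. by move=> [_ lv _ _]; right; rewrite /= lv; exact/eqP/oner_neq0. Qed.

(** One form gives a 0-sphere and each further form suspends once, hence the sphere dimension
    [(size fr).-1]. *)
Lemma cokb_nz (fr : seq ((E -> R) * E)) b : frame C fr -> (0 < size fr)%N ->
  (forall k, betti X k (b k)) -> forall k, cokb (nz fr) k (bshift (size fr).-1 b k).
Proof.
move=> ffr + bX; elim: fr ffr => [//|[l v] fr IHfr] ffr _ k.
have [rl lv v0 fr'] := ffr.
have rN := rformN rl; have fN := frameN rl v0 fr'.
have lN : - l (- v) = 1 by rewrite (rform_opp _ rl) opprK.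
have hU := upper_star rl lv fr' v0; have hV := upper_star rN lN fr' fN.
have oU := open_upper rl fr'; have oV := open_upper rN fr'.
have DE : nz ((l, v) :: fr) = upper l fr `|` upper (fun e => - l e) fr := upper_cover l fr.
have Uv : upper l fr v by right; rewrite /= lv ltr01.
have Vv : upper (fun e => - l e) fr (- v) by right; rewrite /= lN ltr01.
case: fr IHfr ffr fr' v0 fN hU hV oU oV DE Uv Vv => [|[l' v'] fr] IHfr ffr fr' v0 fN hU hV oU oV DE Uv Vv.
  rewrite /bshift /= subn0.
  by apply: (cokb_base oU oV DE (upperI _ _) Uv hU Vv hV).
have Wp := frame_pt fr'; have WE := upperI l ((l', v') :: fr).
case: k => [|k]; first exact: (cokb_susp0 DE WE Uv hU Vv hV Wp).
have := cokb_susp oU oV DE WE Uv hU Vv hV Wp (IHfr fr' isT k).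
by rewrite /bshift /= ltnS subSS.
Qed.

Lemma betti_nz (fr : seq ((E -> R) * E)) b : frame C fr -> (0 < size fr)%N ->
  (forall k, betti X k (b k)) ->
  forall k, betti (X `*` nz fr) k (b k + bshift (size fr).-1 b k).
Proof.
move=> ffr sfr bX k; have ck := cokb_nz ffr sfr bX k.
case: fr ffr sfr ck => [//|[l v] fr] ffr _ ck.
exact: (betti_cokb (frame_pt ffr) (bX k) ck).
Qed.

End Suspension.

(** * Real frames of complex vector spaces *)

Section Frames.
Variables (R : realType) (K : numClosedFieldType) (C : cplx R K).
Notation qis := (qis R).
Notation homotopic := (homotopic R).

Definition full (E : normedModType K) (fr : seq ((E -> R) * E)) :=
  frame C fr /\ nz fr = [set e | e != 0].

Lemma full_scalar : full [:: (im C, 'i : K); (re C, 1)].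
Proof.
have rfr : rform C (re C : K -> R) by split; [exact: re_cont|move=> *; exact: reD].
have rfi : rform C (im C : K -> R) by split; [exact: im_cont|move=> *; exact: imD].
split; first by split; rewrite ?imi //; [constructor; rewrite /= ?rei|split; rewrite ?re1].
apply/seteqP; split=> z /=.
  move=> [[[]//|/eqP]|/eqP] /=; apply: contraNneq => ->.
    by rewrite -(rmorph0 (toC C)) re_toC.
  by rewrite -(rmorph0 (toC C)) im_toC.
have [r0|rz _] := eqVneq (re C z) 0; last by left; right; exact/eqP.
have [i0|iz _] := eqVneq (im C z) 0; last by right; exact/eqP.
by rewrite (reim C z) r0 i0 rmorph0 mulr0 addr0 eqxx.
Qed.

Section Pair.
Variables E F : normedModType K.

Definition frameX (fE : seq ((E -> R) * E)) (fF : seq ((F -> R) * F)) :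
  seq ((E * F -> R) * (E * F)) :=
  [seq (fun e => q.1 e.1, (q.2, 0)) | q <- fE] ++ [seq (fun e => q.1 e.2, (0, q.2)) | q <- fF].

Lemma rform0 (G : normedModType K) (l : G -> R) : rform C l -> l 0 = 0.
Proof. by move=> [_ /(_ 0 0 0 0)]; rewrite !rmorph0 !scale0r addr0 !mul0r addr0. Qed.

Lemma full_prod fE fF : full fE -> full fF -> full (frameX fE fF).
Proof.
move=> [ffE nE] [ffF nF]; split.
  have fF' : frame C [seq (fun e : E * F => q.1 e.2, (0 : E, q.2)) | q <- fF].
    elim: fF ffF {nF} => [//|[l v] fF IH] /= [[lc lD] lv v0 ffF]; split; last exact: IH.
    - by split=> [e|a b x y]; [apply: (ca_comp (ca_snd (@ca_id _ _))); exact: lc|exact: lD].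
    - by [].
    - by elim: fF v0 {IH ffF} => [|q fF IH] v0; inversion_clear v0; constructor; rewrite //=; exact: IH.
  elim: fE ffE {nE} => [//|[l v] fE IH] /= [[lc lD] lv v0 ffE]; split; last exact: IH.
  - by split=> [e|a b x y]; [apply: (ca_comp (ca_fst (@ca_id _ _))); exact: lc|exact: lD].
  - by [].
  elim: fE v0 {IH ffE} => [|q fE IH] v0.
    rewrite /=; elim: fF ffF {nF fF' v0} => [|[l' w] fF IH]; first by constructor.
    by move=> /= [rl _ _ ffF]; constructor; [rewrite /= (rform0 rl)|exact: IH].
  by inversion_clear v0; constructor; rewrite //=; exact: IH.
have nzE p : nz (frameX fE fF) p <-> (nz fE p.1 \/ nz fF p.2).
  rewrite /frameX; elim: fE {ffE nE} => [|[l v] fE IH] /=.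
    elim: fF {ffF nF} => [|[l v] fF IH]; first by rewrite /=; tauto.
    rewrite /=; rewrite /setU /= in IH *; tauto.
  rewrite /setU /= in IH *; tauto.
apply/seteqP; split=> -[x y] /=.
  by move=> /nzE; rewrite nE nF => -[/eqP h|/eqP h]; apply/eqP => -[x0 y0]; apply: h.
move=> xy; apply/nzE; rewrite nE nF /=.
have [x0|] := eqVneq x 0; last by left.
by right; apply: contraNneq xy => ->; rewrite x0.
Qed.
End Pair.

Lemma full_good (E : normedModType K) (fr : seq ((E -> R) * E)) : full fr -> good R [set e : E | e != 0].
Proof. by move=> [ffr <-]; exact: (good_nz ffr). Qed.

Lemma good_neq0 : good R [set z : K | z != 0].
Proof. exact: (full_good full_scalar). Qed.

Lemma good_neq02 : good R [set z : K * K | z != 0].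
Proof. exact: (full_good (full_prod full_scalar full_scalar)). Qed.

Lemma powlike_id (E : normedModType K) : good R [set e : E | e != 0] -> powlike C (id : E -> E).
Proof.
move=> gE; split=> [e|u|t u tI|T T' X Y f mf q].
- exact: (@ca_id _ e).
- by [].
- by exists t.
- exact: (gE _ _ _ _ _ mf q).
Qed.

Lemma powlike_exp n : (0 < n)%N -> powlike C (fun z : K => z ^+ n).
Proof.
move=> n0; split=> [z|u|t u [t0 t1]|T T' X Y f mf q].
- by have : contat z (fun x : K => x ^+ n) by cont.
- by split=> [/eqP|->]; rewrite ?expf_eq0 ?n0 /=; [move/eqP|rewrite expr0n; case: n n0].
- exists (t ^+ n); first by split; [exact: exprn_ge0|exact: exprn_ile1].
  by rewrite /GRing.scale /= exprMn rmorphXn.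
have mp : maps (fun p : T' * K => (p.1, p.2 ^+ n)) (Y `*` [set z | z != 0]) (Y `*` [set z | z != 0]).
  move=> [y z] [/= Yy z0]; split; last by cont.
  by split=> //=; rewrite expf_neq0.
exact: (qis_comp (maps_fxid mf) mp (good_neq0 mf q) (@qis_power _ _ C n _ Y n0)).
Qed.

Lemma toC_real a : (toC C a) \is Num.real.
Proof. by rewrite realE -(rmorph0 (toC C)) !toC_le le_total. Qed.

Lemma conjE z : z^* = toC C (re C z) - 'i * toC C (im C z).
Proof.
rewrite {1}(reim C z) rmorphD rmorphM /= conjCi !(CrealP (toC_real _)); ring.
Qed.

Lemma ca_conj (T : topologicalType) (x : T) (f : T -> K) :
  contat x f -> contat x (fun p => (f p)^*).
Proof.
move=> fc; rewrite (_ : (fun p => _) = fun p => toC C (re C (f p)) - 'i * toC C (im C (f p))).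
  have h1 := @ca_toC _ _ C _ _ _ (@ca_re _ _ C _ _ _ fc); have h2 := @ca_toC _ _ C _ _ _ (@ca_im _ _ C _ _ _ fc); cont.
by apply/funext => p; exact: conjE.
Qed.

Lemma norm2_eq0 (x y : K) : (x * x^* + y * y^* == 0) = (x == 0) && (y == 0).
Proof. by rewrite paddr_eq0 ?mul_conjC_ge0 // !mul_conjC_eq0. Qed.

Section Contractible.
Variable E : normedModType K.

Lemma contr_setT : homotopic [set: E] setT (fun=> 0) id.
Proof. exact: (@star_contr _ _ C). Qed.

Lemma qis_fstT (T : topologicalType) (X : set T) : qis fst (X `*` [set: E]) X.
Proof. exact: (qis_fst X (v := 0) _ contr_setT).1. Qed.

Lemma qis_zeroT (T : topologicalType) (X : set T) : qis (fun x => (x, 0)) X (X `*` [set: E]).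
Proof. exact: (qis_fst X (v := 0) _ contr_setT).2. Qed.

End Contractible.
End Frames.

Ltac conts := repeat (cbn beta; first [ca_step | match goal with
  | |- contat ?x (fun p => (@?f p)^*) => apply: (@ca_conj _ _ _ _ x f); [eassumption|]
  | |- contat ?x (fun p => GRing.RMorphism.sort (toC ?C) (@?f p)) => apply: (@ca_toC _ _ C _ x f)
  | H : continuous ?g |- contat ?x (fun p => ?g (@?f p)) => apply: (@ca_comp _ x _ _ f g); [|exact: H]
  end]); cbn beta.

(** * Values of a linear form at the roots of a quadratic *)

Section Fibres.
Variables (R : realType) (K : numClosedFieldType) (C : cplx R K).
Notation qis := (qis R).

Lemma qis_retract (T T' : topologicalType) (X : set T) (Y : set T') f g (H : R -> T -> T) :
  maps f X Y -> maps g Y X -> homot X X H -> (forall x, X x -> H 0 x = g (f x)) ->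
  (forall x, X x -> H 1 x = x) -> (forall y, Y y -> f (g y) = y) -> qis f X Y.
Proof.
move=> mf mg hH H0 H1 fg; apply: (qis_hequiv mf mg); last exact: maps_idK.
by exists H.
Qed.

Lemma open_neq0_pre (T : topologicalType) (f : T -> K) : continuous f -> open [set x | f x != 0].
Proof. by move=> cf; apply: open_near => x fx; exact: (ca_near (cf x) (@open_neq0 _ K) fx). Qed.

Lemma open_fst (T U : topologicalType) (S : set T) : open S -> open [set p : T * U | S p.1].
Proof.
by move=> oS; apply: open_near => x Sx; exact: (ca_near (ca_fst (@ca_id _ x)) oS Sx).
Qed.

Section Quadratic.
Variables (T : topologicalType) (S : set T).
Hypothesis oS : open S.

(* The product of the values of [al z + be] at the two roots of [z^2 + b z + c], for
   [p = ((((t, be), b), c), al)]. *)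
Definition qnorm (p : T * K * K * K * K) : K :=
  p.1.1.1.2 ^+ 2 - p.2 * p.1.1.1.2 * p.1.1.2 + p.2 ^+ 2 * p.1.2.

(** Stratified by [al]. At [al = 0] the norm is [be ^+ 2] and the power map enters; elsewhere the
    norm is affine in [c] with invertible slope, so [c] can be traded for the norm and the rest
    contracted. *)
Lemma qis_qnorm : qis (fun p => (p.1.1.1.1, qnorm p)) [set p | S p.1.1.1.1 /\ qnorm p != 0]
  [set q | S q.1 /\ q.2 != 0].
Proof.
pose X := [set p | S p.1.1.1.1 /\ qnorm p != 0].
pose Y : set (T * K) := [set q | S q.1 /\ q.2 != 0].
have cn : continuous qnorm by move=> p; change (contat p qnorm); rewrite /qnorm; cont.
have mX : maps (fun p => ((p.1.1.1.1, qnorm p), p.2)) X (Y `*` [set: K]).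
  by move=> p Xp; split; [|conts].
have oX : open X.
  exact: (openI (@open_fst _ K _ (@open_fst _ K _ (@open_fst _ K _ (@open_fst _ K _ oS)))) (open_neq0_pre cn)).
have oY : open (Y `*` [set: K]).
  rewrite (_ : _ `*` _ = [set p | Y p.1]); last by apply/seteqP; split=> -[x y] // [].
  apply: open_fst; apply: (openI (@open_fst _ K _ oS)).
  by apply: open_neq0_pre => p; change (contat p (snd : T * K -> K)); cont.
(* To apply [qis_strata], [al] is kept as a coordinate of the target; this contractible factor is
   projected away here. *)
have q : qis (fun p => ((p.1.1.1.1, qnorm p), p.2)) X (Y `*` [set: K]); last first.
  have h := qis_comp mX (@maps_fst _ _ Y setT) q (@qis_fstT _ _ C K _ Y).
  exact: h.
have qn0 (t : T) (be b c : K) : qnorm ((((t, be), b), c), 0) = be ^+ 2 by rewrite /qnorm /=; ring.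
have YE : Y = S `*` [set z | z != 0] by apply/seteqP; split=> -[].
apply: (@qis_strata _ _ C _ _ _ _ X (Y `*` [set: K]) (fun p => (p.1.1.1.1, qnorm p)) id oX oY _ _ (powlike_id C (good_neq0 C))).
- by move=> p _; conts.
- by move=> p Xp; exact: (mX p Xp).1.
- have -> : [set w | X (w, 0)] = (Y `*` [set: K]) `*` [set: K].
    apply/seteqP; split=> -[[[t be] b] c]; rewrite /X /Y /= qn0.
      by rewrite expf_eq0 /= => -[].
    by move=> [[[St be0] _] _]; rewrite expf_eq0.
  have -> : [set w | (Y `*` [set: K]) (w, 0)] = Y by apply/seteqP; split=> [? []|].
  have m1 := @maps_fst _ _ (Y `*` [set: K]) [set: K].
  have m2 := @maps_fst _ _ Y [set: K].
  have m3 : maps (fun p : T * K => (p.1, p.2 ^+ 2)) Y Y.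
    by move=> [t z] [/= St z0]; split; [split=> //=; rewrite expf_eq0|cont].
  have q3 : qis (fun p : T * K => (p.1, p.2 ^+ 2)) Y Y by rewrite YE; exact: (qis_power C).
  have := qis_comp m1 (maps_comp m2 m3) (@qis_fstT _ _ C K _ _) (qis_comp m2 m3 (@qis_fstT _ _ C K _ _) q3).
  apply: qis_ext => -[[[t be] b] c] _.
  by rewrite /= qn0.
- pose back (q : (T * K) * K) : T * K * K * K * K :=
    ((((q.1.1, 0), 0), q.1.2 / q.2 ^+ 2), q.2).
  (* While [be] and [b] shrink, [c] is solved for so that the norm remains constant. *)
  pose H (s : R) (p : T * K * K * K * K) : T * K * K * K * K :=
    ((((p.1.1.1.1, toC C s * p.1.1.1.2), toC C s * p.1.1.2),
     (qnorm p - (toC C s * p.1.1.1.2) ^+ 2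
       + p.2 * (toC C s * p.1.1.1.2) * (toC C s * p.1.1.2)) / p.2 ^+ 2), p.2).
  have nH s p : p.2 != 0 -> qnorm (H s p) = qnorm p.
    by case: p => [[[[t be] b] c] al] /= al0; rewrite /H /qnorm /=; field.
  apply: (@qis_retract _ _ _ _ _ back H).
  + by move=> p [Xp p0]; split; [split=> //; exact: (mX p Xp).1|conts].
  + move=> [[t r] al] [[[St /= r0] _] /= al0]; split; last by rewrite /back; conts; rewrite expf_neq0.
    split=> //; split=> //.
    by rewrite /qnorm /back /= (_ : _ + _ = r) //; field.
  + move=> s p sI [[Sp np] p0]; split; first by split=> //; split=> //; rewrite nH.
    by rewrite /H /qnorm; conts; rewrite expf_neq0.
  + by move=> p _; rewrite /H /back rmorph0 !mul0r !mulr0 expr0n subr0 addr0.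
  + move=> [[[[t be] b] c] al] [_ /= al0]; rewrite /H /qnorm /= rmorph1 !mul1r.
    by congr (_, _); congr (_, _); field.
  + move=> [[t r] al] [_ /= al0]; rewrite /back /qnorm /=.
    by congr (_, _); congr (_, _); field.
Qed.

End Quadratic.
End Fibres.

(** * Coprime pairs of a binary form and a quadratic form *)

Section GeneralFibre.
Variables (R : realType) (K : numClosedFieldType) (C : cplx R K).
Notation qis := (qis R).

Lemma open_and (T : topologicalType) (A B : T -> Prop) :
  open [set x | A x] -> open [set x | B x] -> open [set x | A x /\ B x].
Proof. exact: openI. Qed.

Lemma open_or (T : topologicalType) (A B : T -> Prop) :
  open [set x | A x] -> open [set x | B x] -> open [set x | A x \/ B x].
Proof. exact: openU. Qed.

Lemma open_nonzero (T : topologicalType) (f : T -> K) : (forall x, contat x f) -> open [set x | f x != 0].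
Proof. exact: open_neq0_pre. Qed.

(** The form has degree [d], coefficients [a0] and [a1] at the two lowest powers of z, and [n ^+ e]
    at the highest; [v] holds the other parameters. The quadratic form is b0 y^2 + b1 y z + u z^2.
    For u <> 0 the resultant is u^d times the norm of the remainder modulo the quadratic. For u = 0
    the quadratic has the roots (0,1) and (b1,-b0), and the resultant is the product of the values
    there, up to the sign [eps]. *)
Variables (V : normedModType K) (d e : nat) (eps : K).
Variables (Res : V * K * K * K * K * K * K -> K) (phi0 phi1 : V * K * K * K -> K).
Variable psi : V * K * K * K * K -> K.
Hypotheses (cR : continuous Res) (c0 : continuous phi0) (c1 : continuous phi1)
  (cpsi : continuous psi).
Hypotheses (eps0 : eps != 0) (d0 : (0 < d)%N) (e0 : (0 < e)%N).
Hypothesis ResU : forall v a0 a1 n b c u, u != 0 ->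
  Res (v, a0, a1, n, c * u, b * u, u) = u ^+ d *
    ((a0 + phi0 (v, n, b, c)) ^+ 2 - (a1 + phi1 (v, n, b, c)) * (a0 + phi0 (v, n, b, c)) * b
      + (a1 + phi1 (v, n, b, c)) ^+ 2 * c).
Hypothesis Res0 : forall v a0 a1 n b0 b1,
  Res (v, a0, a1, n, b0, b1, 0) = n ^+ e * (eps * a0 * b1 ^+ d + psi (v, a1, n, b0, b1)).
Hypothesis psi0 : forall v a1 n b0, psi (v, a1, n, b0, 0) = n ^+ e * b0 ^+ d.

Let W : topologicalType := (V * K * K * K * K * K)%type.
Let X : set (W * K) := [set p | Res p != 0].
Let Y : set (K * K * K) := [set q | (q.1.1 != 0 \/ q.2 != 0) /\ q.1.2 != 0].
Let tau (p : W * K) : K * K * K := ((p.1.1.1.2, Res p), p.2).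

Let oX : open X. Proof. exact: open_neq0_pre. Qed.

Let oY : open Y.
Proof.
by apply: open_and; [apply: open_or|]; apply: open_nonzero => x; conts.
Qed.

Let Res0' v a0 a1 n b0 b1 : Res (v, a0, a1, n, b0, b1, 0) != 0 -> n != 0.
Proof. by rewrite Res0; apply: contraNneq => ->; rewrite expr0n eqn0Ngt e0 mul0r. Qed.

Lemma fibre_maps : maps tau X Y.
Proof.
move=> p Xp; split; last by rewrite /tau; conts.
split=> //=; have [p0|] := eqVneq p.2 0; last by right.
left; case: p p0 Xp => -[[[[[v a0] a1] n] b0] b1] u /= -> .
exact: Res0'.
Qed.

(** Stratified once more, by [b1]. At [b1 = 0] the resultant is a monomial in [n] and [b0], a power
    map followed by a shear; elsewhere [a0] occurs linearly with invertible coefficient and is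
    solved for. *)
Let qis_u0 : qis (fun w : W => (w.1.1.2, Res (w, 0))) [set w | X (w, 0)]
  [set q : K * K | q.1 != 0 /\ q.2 != 0].
Proof.
pose Z : set W := [set w | X (w, 0)].
pose Z2 : set (K * K) := [set q : K * K | q.1 != 0 /\ q.2 != 0].
have cR0 : continuous (fun w : W => Res (w, 0)).
  by move=> w; change (contat w (fun w : W => Res (w, 0))); conts.
have oZ : open Z by exact: open_neq0_pre.
have oZ2 : open Z2 by apply: open_and; apply: open_nonzero => x; conts.
have mZ : maps (fun w : W => ((w.1.1.2, Res (w, 0)), w.2)) Z (Z2 `*` [set: K]).
  move=> [[[[[v a0] a1] n] b0] b1] Xp; split; last by conts.
  by split=> //; split=> //=; exact: (Res0' Xp).
have q : qis (fun w : W => ((w.1.1.2, Res (w, 0)), w.2)) Z (Z2 `*` [set: K]); last first.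
  have h := qis_comp mZ (@maps_fst _ _ Z2 setT) q (@qis_fstT _ _ C K _ Z2).
  exact: h.
have oZT : open (Z2 `*` [set: K]).
  rewrite (_ : _ `*` _ = [set p | Z2 p.1]); last by apply/seteqP; split=> -[x y] // [].
  exact: open_fst.
apply: (@qis_strata _ _ C _ _ _ _ Z (Z2 `*` [set: K]) (fun w => (w.1.1.2, Res (w, 0))) id
  oZ oZT _ _ (powlike_id C (good_neq0 C))).
- by move=> w _; conts.
- by move=> w Zw; exact: (mZ w Zw).1.
- have RE v a0 a1 n b0 : Res (v, a0, a1, n, b0, 0, 0) = n ^+ e * (n ^+ e * b0 ^+ d).
    by rewrite Res0 psi0 expr0n eqn0Ngt d0 mulr0 add0r.
  pose A : set (K * K) := [set z | z != 0] `*` [set z | z != 0].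
  have m1 : maps (fun w : V * K * K * K * K => (w.1.2, w.2)) [set w | Z (w, 0)] A.
    move=> [[[[v a0] a1] n] b0]; rewrite /Z /X /= RE !mulf_eq0 !expf_eq0 !negb_or d0 e0 /=.
    by move=> /and3P[n0 _ b00]; split=> //; conts.
  have m2 : maps (fun q : K * K => (q.1, q.2 ^+ d)) A A.
    by move=> [n b] [/= n0 b00]; split; [split=> //=; rewrite expf_neq0|conts].
  have m3 : maps (fun q : K * K => (q.1, q.1 ^+ e * (q.1 ^+ e * q.2))) A Z2.
    move=> [n b] [/= n0 b00]; split; last by conts.
    by split=> //=; rewrite !mulf_neq0 ?expf_neq0.
  have -> : [set w | (Z2 `*` [set: K]) (w, 0)] = Z2 by apply/seteqP; split=> [? []|].
  have q1 : qis (fun w : V * K * K * K * K => (w.1.2, w.2)) [set w | Z (w, 0)] A.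
    apply: (@qis_retract _ _ _ _ _ _ (fun q : K * K => ((((0 : V, 0 : K), 0 : K), q.1), q.2))
     (fun s w => ((((toC C s *: w.1.1.1.1, toC C s *: w.1.1.1.2), toC C s *: w.1.1.2), w.1.2), w.2)) m1).
    + move=> [n b] [/= n0 b00]; split; last by conts.
      by rewrite /Z /X /= RE !mulf_neq0 ?expf_neq0.
    + move=> s [[[[v a0] a1] n] b0] sI; rewrite /Z /X /= !RE => nz; split=> //; conts.
    + by move=> [[[[v a0] a1] n] b0] _ /=; rewrite rmorph0 !scale0r.
    + by move=> [[[[v a0] a1] n] b0] _ /=; rewrite rmorph1 !scale1r.
    + by case.
  have q3 : qis (fun q : K * K => (q.1, q.1 ^+ e * (q.1 ^+ e * q.2))) A Z2.
    apply: (@qis_homeo _ _ _ _ _ _ (fun q : K * K => (q.1, q.2 / (q.1 ^+ e * q.1 ^+ e))) m3).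
    + move=> [n b] [/= n0 b00]; split; last by conts; rewrite mulf_neq0 ?expf_neq0.
      by split=> //=; rewrite mulf_neq0 ?invr_neq0 ?mulf_neq0 ?expf_neq0.
    + move=> [n b] [/= n0 b00]; congr (_, _); field.
      by rewrite expf_neq0.
    + move=> [n b] [/= n0 b00]; congr (_, _); field.
      by rewrite expf_neq0.
  have := qis_comp m1 (maps_comp m2 m3) q1 (qis_comp m2 m3 (@qis_power _ _ C d _ _ d0) q3).
  by apply: qis_ext => -[[[[v a0] a1] n] b0] _; rewrite /= RE.
- pose rho (w : W) : K := eps * w.1.1.1.1.2 * w.2 ^+ d + psi (w.1.1.1.1.1, w.1.1.1.2, w.1.1.2, w.1.2, w.2).
  have RE (w : W) : Res (w, 0) = w.1.1.2 ^+ e * rho w.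
    by case: w => -[[[[v a0] a1] n] b0] b1; rewrite Res0.
  have crho : continuous rho by move=> w; change (contat w rho); rewrite /rho; conts.
  pose back (q : K * K * K) : W := (((((0, (q.1.2 / q.1.1 ^+ e - psi (0, 0, q.1.1, 0, q.2)) / (eps * q.2 ^+ d)), 0),
    q.1.1), 0), q.2).
  (* All parameters except [n] and [b1] shrink, and [a0] is solved for so that [rho], hence the
     resultant, stays constant. *)
  pose H (s : R) (w : W) : W :=
    (((((toC C s *: w.1.1.1.1.1,
      (rho w - psi (toC C s *: w.1.1.1.1.1, toC C s *: w.1.1.1.2, w.1.1.2, toC C s *: w.1.2, w.2)) / (eps * w.2 ^+ d)),
      toC C s *: w.1.1.1.2), w.1.1.2), toC C s *: w.1.2), w.2).
  have nH s w : w.2 != 0 -> rho (H s w) = rho w.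
    move=> w0; rewrite {1}/rho /H /=; field; rewrite eps0 ?expf_neq0 //.
  have rb n r b : n != 0 -> b != 0 -> rho (back (n, r, b)) = r / n ^+ e.
    by move=> n0 b0; rewrite {1}/rho /back /=; field; rewrite eps0 !expf_neq0.
  have ZE w : Z w -> w.1.1.2 != 0.
    by move: w => -[[[[[v a0] a1] n] b0] b1]; exact: Res0'.
  apply: (@qis_retract _ _ _ _ _ _ back H).
  + by move=> w [Zw w0]; split; [split=> //; exact: (mZ w Zw).1|conts].
  + move=> [[n r] b] [[[/= n0 r0] _] /= b0]; split; last first.
      by rewrite /back; conts; rewrite ?mulf_neq0 ?expf_neq0.
    split=> //; rewrite /Z /X /= RE rb //.
    by rewrite !mulf_neq0 ?invr_neq0 ?expf_neq0.
  + move=> s w sI [Zw w0]; split; last by rewrite /H; conts; rewrite mulf_neq0 ?expf_neq0.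
    by split=> //; rewrite /Z /X /= RE nH //; move: Zw; rewrite /Z /X /= RE.
  + move=> w [Zw /= w0]; have n0 := ZE w Zw; rewrite /H /back rmorph0 !scale0r /= RE.
    by congr (_, _, _, _, _, _); field; rewrite eps0 ?expf_neq0.
  + move=> [[[[[v a0] a1] n] b0] b1] [Zw /= w0]; rewrite /H rmorph1 !scale1r /rho /=.
    by congr (_, _, _, _, _, _); field; rewrite eps0 ?expf_neq0.
  + move=> [[n r] b] [[[/= n0 r0] _] /= b0].
    by rewrite RE rb //= ; congr (_, _, _); field; rewrite expf_neq0.
Qed.

(** Replacing [a0] and [a1] by the coefficients of the remainder modulo the quadratic reduces this
    stratum to [qis_qnorm]; the factor [u ^+ d] is absorbed by a homeomorphism. *)
Let qis_uN0 : qis tau (X `&` [set p | p.2 != 0]) (Y `&` [set q | q.2 != 0]).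
Proof.
pose S : set (K * K) := [set p | p.2 != 0].
have oS : open S by apply: open_nonzero => x; conts.
pose A : set ((K * K) * K * K * K * K) := [set p | S p.1.1.1.1 /\ qnorm p != 0].
pose B : set ((K * K) * K) := [set q | S q.1 /\ q.2 != 0].
pose vnbc (p : W * K) : V * K * K * K := (p.1.1.1.1.1.1, p.1.1.1.2, p.1.2 / p.2, p.1.1.2 / p.2).
pose k (p : W * K) : (K * K) * K * K * K * K :=
  ((((((p.1.1.1.2, p.2), p.1.1.1.1.1.2 + phi0 (vnbc p))), p.1.2 / p.2), p.1.1.2 / p.2),
   p.1.1.1.1.2 + phi1 (vnbc p)).
have RE p : p.2 != 0 -> Res p = p.2 ^+ d * qnorm (k p).
  move: p => [[[[[[v a0] a1] n] b0] b1] u] /= u0.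
  have := ResU v a0 a1 n (b1 / u) (b0 / u) u0; rewrite !divfK // => ->.
have m1 : maps k (X `&` [set p | p.2 != 0]) A.
  move=> p [Xp /= p0]; split; last by rewrite /k /vnbc; conts.
  by split=> //; move: Xp; rewrite /X /= RE // mulf_eq0 negb_or => /andP[].
have m2 : maps (fun p : (K * K) * K * K * K * K => (p.1.1.1.1, qnorm p)) A B.
  by move=> p [Sp np]; split=> //; rewrite /qnorm; conts.
have m3 : maps (fun q : (K * K) * K => ((q.1.1, q.1.2 ^+ d * q.2), q.1.2)) B (Y `&` [set q | q.2 != 0]).
  move=> [[n u] r] [/= u0 r0]; split; last by conts.
  by split=> //; split=> //=; [right|rewrite mulf_neq0 ?expf_neq0].
have q3 : qis (fun q : (K * K) * K => ((q.1.1, q.1.2 ^+ d * q.2), q.1.2)) B (Y `&` [set q | q.2 != 0]).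
  apply: (@qis_homeo _ _ _ _ _ _ (fun q : K * K * K => ((q.1.1, q.2), q.1.2 / q.2 ^+ d)) m3).
  + move=> [[n r] u] [[/= _ r0] u0]; split; last by conts; rewrite expf_neq0.
    by split=> //=; rewrite mulf_neq0 ?invr_neq0 ?expf_neq0.
  + by move=> [[n u] r] [/= u0 _]; congr (_, _); field; rewrite expf_neq0.
  + by move=> [[n r] u] [_ /= u0]; congr (_, _, _); field; rewrite expf_neq0.
have q1 : qis k (X `&` [set p | p.2 != 0]) A.
  pose back (p : (K * K) * K * K * K * K) : W * K :=
    ((((((0, p.1.1.1.2 - phi0 (0, p.1.1.1.1.1, p.1.1.2, p.1.2)),
      p.2 - phi1 (0, p.1.1.1.1.1, p.1.1.2, p.1.2)), p.1.1.1.1.1),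
      p.1.2 * p.1.1.1.1.2), p.1.1.2 * p.1.1.1.1.2), p.1.1.1.1.2).
  pose wnbc s (p : W * K) : V * K * K * K := (toC C s *: p.1.1.1.1.1.1, p.1.1.1.2, p.1.2 / p.2, p.1.1.2 / p.2).
  pose H (s : R) (p : W * K) : W * K :=
    ((((((toC C s *: p.1.1.1.1.1.1, p.1.1.1.1.1.2 + phi0 (vnbc p) - phi0 (wnbc s p)),
      p.1.1.1.1.2 + phi1 (vnbc p) - phi1 (wnbc s p)), p.1.1.1.2), p.1.1.2), p.1.2), p.2).
  have kH s p : p.2 != 0 -> k (H s p) = k p.
    by move: p => [[[[[[v a0] a1] n] b0] b1] u] /= u0; rewrite /H /k /vnbc /wnbc /= !subrK.
  have kb p : p.1.1.1.1.2 != 0 -> k (back p) = p.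
    move: p => [[[[[n u] be] b] c] al] /= u0; rewrite /back /k /vnbc /=.
    by rewrite !mulfK // !subrK.
  apply: (@qis_retract _ _ _ _ _ _ back H) => //.
  + move=> p [Sp np]; split; last by rewrite /back; conts.
    by split=> //; rewrite /X /= RE //= kb // mulf_neq0 ?expf_neq0.
  + move=> s p sI [Xp p0]; split; last by rewrite /H /vnbc /wnbc; conts.
    by split=> //; rewrite /X /= RE //= kH //; move: Xp; rewrite /X /= RE.
  + move=> [[[[[[v a0] a1] n] b0] b1] u] [Xp /= u0].
    by rewrite /H /wnbc /back rmorph0 scale0r /= !divfK.
  + move=> [[[[[[v a0] a1] n] b0] b1] u] [Xp /= u0].
    by rewrite /H /wnbc /back rmorph1 scale1r /= !addrK.
  + by move=> p [Sp _]; exact: kb.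
have := qis_comp m1 (maps_comp m2 m3) q1 (qis_comp m2 m3 (qis_qnorm C oS) q3).
by apply: qis_ext => p [_ p0]; rewrite /tau RE.
Qed.

Lemma qis_fibre : qis tau X Y.
Proof.
apply: (@qis_strata _ _ C W (K * K)%type K K X Y (fun p => (p.1.1.1.2, Res p)) id oX oY _ _
  (powlike_id C (good_neq0 C))).
- by move=> w _; conts.
- by move=> w Xw; exact: (fibre_maps Xw).1.
- rewrite (_ : [set w | Y (w, 0)] = [set q : K * K | q.1 != 0 /\ q.2 != 0]); first exact: qis_u0.
  by apply/seteqP; split=> -[n r] [/= n0 r0]; split=> //; [case: n0 => //; rewrite eqxx|left].
- exact: qis_uN0.
Qed.

Variable A : V * K * K * K -> K -> K -> K.
Hypothesis A_red : forall v a0 a1 n b c z, z ^+ 2 + b * z + c = 0 ->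
  A (v, a0, a1, n) 1 z = (a1 + phi1 (v, n, b, c)) * z + (a0 + phi0 (v, n, b, c)).
Hypothesis A_hom : forall w t y z, A w (t * y) (t * z) = t ^+ d * A w y z.
Hypothesis A_inf : forall v a0 a1 n, A (v, a0, a1, n) 0 1 = n ^+ e.
Hypothesis A_psi : forall v a0 a1 n b0 b1,
  eps * a0 * b1 ^+ d + psi (v, a1, n, b0, b1) = eps * A (v, a0, a1, n) b1 (- b0).
Hypothesis A_root : forall w, exists y z, (y != 0 \/ z != 0) /\ A w y z = 0.

Lemma fibre_coprime v a0 a1 n b0 b1 u :
  Res (v, a0, a1, n, b0, b1, u) = 0 <->
  exists y z, [/\ y != 0 \/ z != 0, A (v, a0, a1, n) y z = 0 &
    b0 * y ^+ 2 + b1 * y * z + u * z ^+ 2 = 0].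
Proof.
have A1 y z : y != 0 -> A (v, a0, a1, n) y z = 0 -> A (v, a0, a1, n) 1 (z / y) = 0.
  move=> y0 Ayz; have := A_hom (v, a0, a1, n) y 1 (z / y).
  rewrite mulr1 mulrCA divff // mulr1 Ayz => /esym/eqP.
  by rewrite mulf_eq0 expf_eq0 (negPf y0) andbF => /eqP.
have [->|u0] := eqVneq u 0.
  rewrite Res0 A_psi; split=> [/eqP|[y [z [yz Ayz]]]].
    rewrite !mulf_eq0 expf_eq0 (negPf eps0) /= => /orP[/andP[_ /eqP n0]|/eqP Ab].
      exists 0, 1; split; [by right; exact: oner_neq0| |by rewrite !mul0r; ring].
      by rewrite A_inf n0 expr0n eqn0Ngt e0.
    have [b10|b10] := eqVneq b1 0; have [b00|b00] := eqVneq b0 0.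
    (* The quadratic form is zero here, so any root of the other form is a common one. *)
    - have [y [z [yz Ayz]]] := A_root (v, a0, a1, n); exists y, z; split=> //.
      by rewrite b00 b10 !mul0r !addr0.
    - by exists b1, (- b0); split=> //; [right; rewrite oppr_eq0|ring].
    - by exists b1, (- b0); split=> //; [left|ring].
    - by exists b1, (- b0); split=> //; [left|ring].
  rewrite mul0r addr0 => B0; have [y0|y0] := eqVneq y 0.
    have z0 : z != 0 by case: yz => //; rewrite y0 eqxx.
    have := A_hom (v, a0, a1, n) z 0 1; rewrite mulr0 mulr1 -y0 Ayz => /esym/eqP.
    by rewrite y0 A_inf mulf_eq0 expf_eq0 (negPf z0) andbF => /eqP ->; rewrite mul0r.
  have B1 : b0 * y + b1 * z = 0.
    apply/eqP; rewrite -(mulIr_eq0 _ (mulIf y0)); apply/eqP; rewrite -B0; ring.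
  have [b10|b10] := eqVneq b1 0.
    have b00 : b0 = 0 by apply/eqP; rewrite -(mulIr_eq0 _ (mulIf y0)) -B1 b10 mul0r addr0.
    rewrite -A_psi b10 psi0 b00 !expr0n eqn0Ngt d0 /=; ring.
  have -> : A (v, a0, a1, n) b1 (- b0) = A (v, a0, a1, n) (b1 / y * y) (b1 / y * z).
    by congr (A _ _ _); rewrite ?divfK // mulrAC -[b1 * z](addKr (b0 * y)) B1; field.
  by rewrite A_hom Ayz !mulr0.
have := ResU v a0 a1 n (b1 / u) (b0 / u) u0; rewrite !divfK // => ->.
set b := b1 / u; set c := b0 / u; set al := a1 + _; set be := a0 + _.
have Au z : z ^+ 2 + b * z + c = 0 -> A (v, a0, a1, n) 1 z = al * z + be by exact: A_red.
have Bu z : z ^+ 2 + b * z + c = 0 -> b0 * 1 ^+ 2 + b1 * 1 * z + u * z ^+ 2 = 0.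
  move=> h; transitivity (u * (z ^+ 2 + b * z + c)); last by rewrite h mulr0.
  by rewrite /b /c; field.
split=> [/eqP|[y [z [yz Ayz Byz]]]].
  rewrite mulf_eq0 expf_eq0 (negPf u0) andbF /= => /eqP P0.
  (* The remainder [al * z + be] has norm zero: either it vanishes identically and every root of the
     quadratic is common, or its own root [- be / al] is. *)
  have [al0|al0] := eqVneq al 0.
    have be0 : be = 0.
      by apply/eqP; have := P0; rewrite al0 => /eqP; rewrite !mul0r subr0 expr0n mul0r addr0 expf_eq0.
    pose z := (sqrtC (b ^+ 2 - 4 * c) - b) / 2.
    have h : z ^+ 2 + b * z + c = 0.
      have s2 := sqrtCK (b ^+ 2 - 4 * c).
      have -> : z ^+ 2 + b * z + c = (sqrtC (b ^+ 2 - 4 * c) ^+ 2 - b ^+ 2 + 4 * c) / 4.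
        by rewrite /z; field.
      by rewrite s2; ring.
    exists 1, z; split; [by left; exact: oner_neq0| |exact: Bu].
    by rewrite Au // al0 be0 mul0r addr0.
  have h : (- be / al) ^+ 2 + b * (- be / al) + c = 0.
    apply: (mulIf (expf_neq0 2 al0)); rewrite mul0r -P0.
    by field.
  by exists 1, (- be / al); split; [left; exact: oner_neq0|rewrite Au //; field|exact: Bu].
have y0 : y != 0.
  apply: contraTneq isT => y0; have z0 : z != 0 by case: yz => //; rewrite y0 eqxx.
  move: Byz; rewrite y0 expr0n /= !mulr0 mul0r !add0r => /eqP.
  by rewrite mulf_eq0 (negPf u0) expf_eq0 (negPf z0).
have h : (z / y) ^+ 2 + b * (z / y) + c = 0.
  apply: (mulIf (mulf_neq0 u0 (expf_neq0 2 y0))); rewrite mul0r -Byz /b /c.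
  by field; rewrite u0 y0.
have := A1 y z y0 Ayz; rewrite Au // => h2.
have -> : be = - al * (z / y) by apply/eqP; rewrite -subr_eq0 mulNr opprK addrC h2.
transitivity (u ^+ d * (al ^+ 2 * ((z / y) ^+ 2 + b * (z / y) + c))); last by rewrite h !mulr0.
by congr (_ * _); ring.
Qed.

End GeneralFibre.

(** * Explicit resultants in degrees two, three and four *)

Section Resultants.
Variables (R : realType) (K : numClosedFieldType) (C : cplx R K).
Notation qis := (qis R).

Section Formulas.
Variables (b0 b1 u : K).
Let q1 := - b1.
Let q2 := b1 ^+ 2 - 2 * b0 * u.
Let q3 := 3 * b0 * b1 * u - b1 ^+ 3.
Let q4 := b1 ^+ 4 - 4 * b1 ^+ 2 * b0 * u + 2 * b0 ^+ 2 * u ^+ 2.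

(* [res a_0 .. a_d b0 b1 u] is the resultant of the forms
   [a_0 y^d + .. + a_d z^d] and [b0 y^2 + b1 y z + u z^2]; [q_k / u^k] is the
   [k]-th power sum of the roots of the latter. *)
Definition res2 a0 a1 a2 : K := a0 ^+ 2 * u ^+ 2 + a1 ^+ 2 * b0 * u + a2 ^+ 2 * b0 ^+ 2
  + a0 * a1 * u * q1 + a0 * a2 * q2 + a1 * a2 * b0 * q1.

Definition res3 a0 a1 a2 a3 : K := a0 ^+ 2 * u ^+ 3 + a1 ^+ 2 * b0 * u ^+ 2
  + a2 ^+ 2 * b0 ^+ 2 * u + a3 ^+ 2 * b0 ^+ 3 + a0 * a1 * u ^+ 2 * q1 + a0 * a2 * u * q2
  + a0 * a3 * q3 + a1 * a2 * b0 * u * q1 + a1 * a3 * b0 * q2 + a2 * a3 * b0 ^+ 2 * q1.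

Definition res4 a0 a1 a2 a3 a4 : K := a0 ^+ 2 * u ^+ 4 + a1 ^+ 2 * b0 * u ^+ 3
  + a2 ^+ 2 * b0 ^+ 2 * u ^+ 2 + a3 ^+ 2 * b0 ^+ 3 * u + a4 ^+ 2 * b0 ^+ 4
  + a0 * a1 * u ^+ 3 * q1 + a0 * a2 * u ^+ 2 * q2 + a0 * a3 * u * q3 + a0 * a4 * q4
  + a1 * a2 * b0 * u ^+ 2 * q1 + a1 * a3 * b0 * u * q2 + a1 * a4 * b0 * q3
  + a2 * a3 * b0 ^+ 2 * u * q1 + a2 * a4 * b0 ^+ 2 * q2 + a3 * a4 * b0 ^+ 3 * q1.
End Formulas.

(* The three families of forms: quadratic, cubic, and quartic of the shape
   [A0 y^4 + A1 y^3 z + A2 y^2 z^2 + 2 m n y z^3 + n^2 z^4].  In the first, the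
   leading component is a dummy. *)
Definition Res2 (p : K * K * K * K * K * K * K) : K :=
  res2 p.1.1.2 p.1.2 p.2 p.1.1.1.1.1.2 p.1.1.1.1.2 p.1.1.1.2.
Definition Res3 (p : K * K * K * K * K * K * K) : K :=
  res3 p.1.1.2 p.1.2 p.2 p.1.1.1.1.1.2 p.1.1.1.1.2 p.1.1.1.1.1.1 p.1.1.1.2.
Definition Res4 (p : (K * K) * K * K * K * K * K * K) : K :=
  res4 p.1.1.2 p.1.2 p.2 p.1.1.1.1.1.2 p.1.1.1.1.2 p.1.1.1.1.1.1.1
    (2 * p.1.1.1.1.1.1.2 * p.1.1.1.2) (p.1.1.1.2 ^+ 2).

Definition form2 (w : K * K * K * K) (y z : K) : K :=
  w.1.1.2 * y ^+ 2 + w.1.2 * y * z + w.2 * z ^+ 2.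
Definition form3 (w : K * K * K * K) (y z : K) : K :=
  w.1.1.2 * y ^+ 3 + w.1.2 * y ^+ 2 * z + w.1.1.1 * y * z ^+ 2 + w.2 * z ^+ 3.
Definition form4 (w : (K * K) * K * K * K) (y z : K) : K :=
  w.1.1.2 * y ^+ 4 + w.1.2 * y ^+ 3 * z + w.1.1.1.1 * y ^+ 2 * z ^+ 2
    + 2 * w.1.1.1.2 * w.2 * y * z ^+ 3 + w.2 ^+ 2 * z ^+ 4.

Definition fibY : set (K * K * K) := [set q | (q.1.1 != 0 \/ q.2 != 0) /\ q.1.2 != 0].

Section Taus.
Variable V : normedModType K.
Definition tau (Res : V * K * K * K * K * K * K -> K) (p : V * K * K * K * K * K * K) : K * K * K :=
  ((p.1.1.1.2, Res p), p.2).
End Taus.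

(** In each of the three families, [phi0] and [phi1] are what the powers of z above the first
    contribute to the remainder modulo [z ^+ 2 + b * z + c], and [psi] is, up to sign, the value of
    the form at (b1,-b0) without its [a0] term. *)
Let phi0_2 (w : K * K * K * K) : K := - (w.1.1.2 * w.2).
Let phi1_2 (w : K * K * K * K) : K := - (w.1.1.2 * w.1.2).
Let psi_2 (w : K * K * K * K * K) : K := w.1.1.2 * w.1.2 ^+ 2 - w.1.1.1.2 * w.1.2 * w.2.

Let phi0_3 (w : K * K * K * K) : K := w.1.1.2 * w.1.2 * w.2 - w.1.1.1 * w.2.
Let phi1_3 (w : K * K * K * K) : K := w.1.1.2 * (w.1.2 ^+ 2 - w.2) - w.1.1.1 * w.1.2.
Let psi_3 (w : K * K * K * K * K) : K := w.1.1.1.2 * w.2 ^+ 2 * w.1.2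
  - w.1.1.1.1 * w.2 * w.1.2 ^+ 2 + w.1.1.2 * w.1.2 ^+ 3.

Let phi0_4 (w : (K * K) * K * K * K) : K := - (w.1.1.1.1 * w.2)
  + 2 * w.1.1.1.2 * w.1.1.2 * w.1.2 * w.2 + w.1.1.2 ^+ 2 * (w.2 ^+ 2 - w.1.2 ^+ 2 * w.2).
Let phi1_4 (w : (K * K) * K * K * K) : K := - (w.1.1.1.1 * w.1.2)
  + 2 * w.1.1.1.2 * w.1.1.2 * (w.1.2 ^+ 2 - w.2) + w.1.1.2 ^+ 2 * (2 * w.1.2 * w.2 - w.1.2 ^+ 3).
Let psi_4 (w : (K * K) * K * K * K * K) : K := - (w.1.1.1.2 * w.2 ^+ 3 * w.1.2)
  + w.1.1.1.1.1 * w.2 ^+ 2 * w.1.2 ^+ 2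
  - 2 * w.1.1.1.1.2 * w.1.1.2 * w.2 * w.1.2 ^+ 3 + w.1.1.2 ^+ 2 * w.1.2 ^+ 4.

Ltac contf f := let p := fresh "p" in move=> p; change (contat p f); unfold f; cont.

Lemma cont_Res2 : continuous Res2.
Proof. move=> p; change (contat p Res2); rewrite /Res2 /res2; cont. Qed.
Lemma cont_Res3 : continuous Res3.
Proof. move=> p; change (contat p Res3); rewrite /Res3 /res3; cont. Qed.
Lemma cont_Res4 : continuous Res4.
Proof. move=> p; change (contat p Res4); rewrite /Res4 /res4; cont. Qed.

Let c02 : continuous phi0_2. Proof. contf phi0_2. Qed.
Let c12 : continuous phi1_2. Proof. contf phi1_2. Qed.
Let cp2 : continuous psi_2. Proof. contf psi_2. Qed.
Let c03 : continuous phi0_3. Proof. contf phi0_3. Qed.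
Let c13 : continuous phi1_3. Proof. contf phi1_3. Qed.
Let cp3 : continuous psi_3. Proof. contf psi_3. Qed.
Let c04 : continuous phi0_4. Proof. contf phi0_4. Qed.
Let c14 : continuous phi1_4. Proof. contf phi1_4. Qed.
Let cp4 : continuous psi_4. Proof. contf psi_4. Qed.

Let one0 : (1 : K) != 0. Proof. exact: oner_neq0. Qed.
Let mone0 : (-1 : K) != 0. Proof. by rewrite oppr_eq0 oner_neq0. Qed.

Let U2 v a0 a1 n b c u : u != 0 -> Res2 (v, a0, a1, n, c * u, b * u, u) = u ^+ 2 *
    ((a0 + phi0_2 (v, n, b, c)) ^+ 2 - (a1 + phi1_2 (v, n, b, c)) * (a0 + phi0_2 (v, n, b, c)) * b
      + (a1 + phi1_2 (v, n, b, c)) ^+ 2 * c).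
Proof. by move=> _; rewrite /Res2 /res2 /phi0_2 /phi1_2 /=; ring. Qed.
Let U3 v a0 a1 n b c u : u != 0 -> Res3 (v, a0, a1, n, c * u, b * u, u) = u ^+ 3 *
    ((a0 + phi0_3 (v, n, b, c)) ^+ 2 - (a1 + phi1_3 (v, n, b, c)) * (a0 + phi0_3 (v, n, b, c)) * b
      + (a1 + phi1_3 (v, n, b, c)) ^+ 2 * c).
Proof. by move=> _; rewrite /Res3 /res3 /phi0_3 /phi1_3 /=; ring. Qed.
Let U4 v a0 a1 n b c u : u != 0 -> Res4 (v, a0, a1, n, c * u, b * u, u) = u ^+ 4 *
    ((a0 + phi0_4 (v, n, b, c)) ^+ 2 - (a1 + phi1_4 (v, n, b, c)) * (a0 + phi0_4 (v, n, b, c)) * b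
      + (a1 + phi1_4 (v, n, b, c)) ^+ 2 * c).
Proof. by move=> _; rewrite /Res4 /res4 /phi0_4 /phi1_4 /=; ring. Qed.

Let Z2 v a0 a1 n b0 b1 : Res2 (v, a0, a1, n, b0, b1, 0) =
  n ^+ 1 * (1 * a0 * b1 ^+ 2 + psi_2 (v, a1, n, b0, b1)).
Proof. rewrite /Res2 /res2 /psi_2 /=; ring. Qed.
Let Z3 v a0 a1 n b0 b1 : Res3 (v, a0, a1, n, b0, b1, 0) =
  n ^+ 1 * (-1 * a0 * b1 ^+ 3 + psi_3 (v, a1, n, b0, b1)).
Proof. rewrite /Res3 /res3 /psi_3 /=; ring. Qed.
Let Z4 v a0 a1 n b0 b1 : Res4 (v, a0, a1, n, b0, b1, 0) =
  n ^+ 2 * (1 * a0 * b1 ^+ 4 + psi_4 (v, a1, n, b0, b1)).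
Proof. rewrite /Res4 /res4 /psi_4 /=; ring. Qed.

Let P2 v a1 n b0 : psi_2 (v, a1, n, b0, 0) = n ^+ 1 * b0 ^+ 2.
Proof. rewrite /psi_2 /=; ring. Qed.
Let P3 v a1 n b0 : psi_3 (v, a1, n, b0, 0) = n ^+ 1 * b0 ^+ 3.
Proof. rewrite /psi_3 /=; ring. Qed.
Let P4 v a1 n b0 : psi_4 (v, a1, n, b0, 0) = n ^+ 2 * b0 ^+ 4.
Proof. rewrite /psi_4 /=; ring. Qed.

Lemma qis_tau2 : qis (tau Res2) [set p | Res2 p != 0] fibY.
Proof. exact (@qis_fibre R K C K 2 1 _ Res2 phi0_2 phi1_2 psi_2 cont_Res2 c02 c12 cp2 one0 isT isT U2 Z2 P2). Qed.
Lemma qis_tau3 : qis (tau Res3) [set p | Res3 p != 0] fibY.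
Proof. exact (@qis_fibre R K C K 3 1 _ Res3 phi0_3 phi1_3 psi_3 cont_Res3 c03 c13 cp3 mone0 isT isT U3 Z3 P3). Qed.
Lemma qis_tau4 : qis (tau Res4) [set p | Res4 p != 0] fibY.
Proof. exact (@qis_fibre R K C (K * K)%type 4 2 _ Res4 phi0_4 phi1_4 psi_4 cont_Res4 c04 c14 cp4 one0 isT isT U4 Z4 P4). Qed.

Lemma maps_tau2 : maps (tau Res2) [set p | Res2 p != 0] fibY.
Proof. exact (@fibre_maps K K 2 1 _ Res2 psi_2 cont_Res2 isT Z2). Qed.
Lemma maps_tau3 : maps (tau Res3) [set p | Res3 p != 0] fibY.
Proof. exact (@fibre_maps K K 3 1 _ Res3 psi_3 cont_Res3 isT Z3). Qed.
Lemma maps_tau4 : maps (tau Res4) [set p | Res4 p != 0] fibY.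
Proof. exact (@fibre_maps K (K * K)%type 4 2 _ Res4 psi_4 cont_Res4 isT Z4). Qed.

Let root_form d (A : nat -> K) : (0 < d)%N -> exists y z, (y != 0 \/ z != 0) /\
  \sum_(i < d.+1) A i * y ^+ (d - i) * z ^+ i = 0.
Proof.
move=> d0; have [A0|A0] := eqVneq (A d) 0.
  exists 0, 1; split; first by right.
  rewrite big_ord_recr /= A0 mul0r mul0r addr0 big1 // => i _.
  by rewrite expr0n subn_eq0 leqNgt ltn_ord /= mulr0 mul0r.
have [z zd] := solve_monicpoly (fun i => - A i / A d) d0.
exists 1, z; split; first by left.
rewrite big_ord_recr /= zd expr1n mulr1 mulr_sumr -big_split /= big1 // => i _.
by rewrite expr1n mulr1; field.
Qed.

Let R2 w : exists y z, (y != 0 \/ z != 0) /\ form2 w y z = 0.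
Proof.
have [y [z [yz h]]] := @root_form 2 (fun i => [:: w.1.1.2; w.1.2; w.2]`_i) isT.
exists y, z; split=> //; rewrite -h !big_ord_recr big_ord0 /form2 /=; ring.
Qed.
Let R3 w : exists y z, (y != 0 \/ z != 0) /\ form3 w y z = 0.
Proof.
have [y [z [yz h]]] := @root_form 3 (fun i => [:: w.1.1.2; w.1.2; w.1.1.1; w.2]`_i) isT.
exists y, z; split=> //; rewrite -h !big_ord_recr big_ord0 /form3 /=; ring.
Qed.
Let R4 w : exists y z, (y != 0 \/ z != 0) /\ form4 w y z = 0.
Proof.
have [y [z [yz h]]] := @root_form 4 (fun i => [:: w.1.1.2; w.1.2; w.1.1.1.1; 2 * w.1.1.1.2 * w.2; w.2 ^+ 2]`_i) isT.
exists y, z; split=> //; rewrite -h !big_ord_recr big_ord0 /form4 /=; ring.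
Qed.

Let solve_c (b c z : K) : z ^+ 2 + b * z + c = 0 -> c = - (z ^+ 2 + b * z).
Proof. by move=> h; apply/eqP; rewrite -subr_eq0 opprK addrC h. Qed.

Lemma coprime2 v a0 a1 n b0 b1 u : Res2 (v, a0, a1, n, b0, b1, u) = 0 <->
  exists y z, [/\ y != 0 \/ z != 0, form2 (v, a0, a1, n) y z = 0 &
    b0 * y ^+ 2 + b1 * y * z + u * z ^+ 2 = 0].
Proof.
apply: (@fibre_coprime K K 2 1 _ Res2 phi0_2 phi1_2 psi_2 one0 isT isT U2 Z2 P2 form2 _ _ _ _ R2) => {a0 a1 n v b0 b1 u}.
- move=> v a0 a1 n b c z /solve_c ->; rewrite /form2 /phi0_2 /phi1_2 /=; ring.
- by move=> w t y z; rewrite /form2; ring.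
- by move=> v a0 a1 n; rewrite /form2 /=; ring.
- by move=> v a0 a1 n b0 b1; rewrite /psi_2 /form2 /=; ring.
Qed.

Lemma coprime3 v a0 a1 n b0 b1 u : Res3 (v, a0, a1, n, b0, b1, u) = 0 <->
  exists y z, [/\ y != 0 \/ z != 0, form3 (v, a0, a1, n) y z = 0 &
    b0 * y ^+ 2 + b1 * y * z + u * z ^+ 2 = 0].
Proof.
apply: (@fibre_coprime K K 3 1 _ Res3 phi0_3 phi1_3 psi_3 mone0 isT isT U3 Z3 P3 form3 _ _ _ _ R3) => {a0 a1 n v b0 b1 u}.
- move=> v a0 a1 n b c z /solve_c ->; rewrite /form3 /phi0_3 /phi1_3 /=; ring.
- by move=> w t y z; rewrite /form3; ring.
- by move=> v a0 a1 n; rewrite /form3 /=; ring.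
- by move=> v a0 a1 n b0 b1; rewrite /psi_3 /form3 /=; ring.
Qed.

Lemma coprime4 v a0 a1 n b0 b1 u : Res4 (v, a0, a1, n, b0, b1, u) = 0 <->
  exists y z, [/\ y != 0 \/ z != 0, form4 (v, a0, a1, n) y z = 0 &
    b0 * y ^+ 2 + b1 * y * z + u * z ^+ 2 = 0].
Proof.
apply: (@fibre_coprime K (K * K)%type 4 2 _ Res4 phi0_4 phi1_4 psi_4 one0 isT isT U4 Z4 P4 form4 _ _ _ _ R4) => {a0 a1 n v b0 b1 u}.
- move=> v a0 a1 n b c z /solve_c ->; rewrite /form4 /phi0_4 /phi1_4 /=; ring.
- by move=> w t y z; rewrite /form4; ring.
- by move=> v a0 a1 n; rewrite /form4 /=; ring.
- by move=> v a0 a1 n b0 b1; rewrite /psi_4 /form4 /=; ring.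
Qed.

End Resultants.

(** * Triples with fixed rows in normal form *)

Section FibreMaps.
Variables (R : realType) (K : numClosedFieldType) (C : cplx R K).
Notation qis := (qis R).
Notation fibY := (@fibY K).

Definition resN (p : K * K * K * K * K * K) : K :=
  res2 p.1.1.2 p.1.2 p.2 p.1.1.1.1.1 p.1.1.1.1.2 p.1.1.1.2.
Definition N2 : set (K * K * K * K * K * K) := [set p | resN p != 0].
Definition tauN (p : K * K * K * K * K * K) : K * K * K := ((p.1.1.1.2, resN p), p.2).

Lemma open_fibY : open fibY.
Proof.
change (open [set q : K * K * K | (q.1.1 != 0 \/ q.2 != 0) /\ q.1.2 != 0]).
by apply: open_and; [apply: open_or|]; apply: open_nonzero => x; conts.
Qed.

Lemma cont_resN : continuous resN.
Proof. move=> p; change (contat p resN); rewrite /resN /res2; cont. Qed.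

Let forget (p : K * K * K * K * K * K * K) : K * K * K * K * K * K :=
  (p.1.1.1.1.1.2, p.1.1.1.1.2, p.1.1.1.2, p.1.1.2, p.1.2, p.2).

Let maps_forget : maps forget [set p | Res2 p != 0] N2.
Proof. by move=> [[[[[[v a0] a1] n] b0] b1] u] Xp; split=> //; rewrite /forget; conts. Qed.

Let qis_forget : qis forget [set p | Res2 p != 0] N2.
Proof.
apply: (@qis_retract _ _ _ _ _ _ (fun p => (0, p.1.1.1.1.1, p.1.1.1.1.2, p.1.1.1.2, p.1.1.2, p.1.2, p.2))
  (fun s p => (toC C s * p.1.1.1.1.1.1, p.1.1.1.1.1.2, p.1.1.1.1.2, p.1.1.1.2, p.1.1.2, p.1.2, p.2)) maps_forget).
- by move=> [[[[[a0 a1] n] b0] b1] u] Xp; split=> //; conts.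
- by move=> s [[[[[[v a0] a1] n] b0] b1] u] sI Xp; split=> //; conts.
- by move=> [[[[[[v a0] a1] n] b0] b1] u] _; rewrite rmorph0 mul0r.
- by move=> [[[[[[v a0] a1] n] b0] b1] u] _; rewrite rmorph1 mul1r.
- by case=> [[[[[a0 a1] n] b0] b1] u].
Qed.

Lemma maps_tauN : maps tauN N2 fibY.
Proof.
move=> [[[[[a0 a1] n] b0] b1] u] Np; split; last first.
  have cR := cont_resN; rewrite /tauN; conts.
have Np' : Res2 (0, a0, a1, n, b0, b1, u) != 0 by [].
exact: (maps_tau2 Np').1.
Qed.

Lemma qis_tauN : qis tauN N2 fibY.
Proof.
apply: (qis_cancel_r maps_forget maps_tauN qis_forget).
by apply: qis_ext (qis_tau2 C) => -[[[[[[v a0] a1] n] b0] b1] u] _.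
Qed.

Lemma qis_sqr_mid : qis (fun q : K * K * K => ((q.1.1, q.1.2 ^+ 2), q.2)) fibY fibY.
Proof.
pose A : set (K * K) := [set q | q.1 != 0 \/ q.2 != 0].
pose s (q : K * K * K) : (K * K) * K := ((q.1.1, q.2), q.1.2).
pose s' (q : (K * K) * K) : K * K * K := ((q.1.1, q.2), q.1.2).
have ms : maps s fibY (A `*` [set z | z != 0]).
  by move=> [[a r] b] [/= ? ?]; split=> //; rewrite /s; conts.
have ms' : maps s' (A `*` [set z | z != 0]) fibY.
  by move=> [[a b] r] [/= ? ?]; split=> //; rewrite /s'; conts.
have qs : qis s fibY (A `*` [set z | z != 0]).
  by apply: (qis_homeo ms ms') => -[[]].
have mp : maps (fun p : (K * K) * K => (p.1, p.2 ^+ 2)) (A `*` [set z | z != 0]) (A `*` [set z | z != 0]).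
  by move=> [[a b] r] [/= ? ?]; split; [split=> //=; rewrite expf_neq0|conts].
have m : maps (fun q : K * K * K => ((q.1.1, q.1.2 ^+ 2), q.2)) fibY fibY.
  by move=> [[a r] b] [/= ? ?]; split; [split=> //=; rewrite expf_neq0|conts].
apply: (iffRL (qis_square m mp ms ms qs qs _)) => //.
exact: (@qis_power _ _ C 2 _ A isT).
Qed.

Lemma maps_sqr_last : maps (fun q : K * K * K => ((- q.1.1, q.1.2), q.2 ^+ 2)) fibY fibY.
Proof.
move=> [[a r] b] [/= ab r0]; split; last by conts.
by split=> //=; rewrite oppr_eq0 expf_eq0.
Qed.

(** This is what the rank two stratum requires: the sign is that of the last coefficient of the
    cubic y c3 - z c2, the square that of the leading term of [S2]. *)
Lemma qis_sqr_last : qis (fun q : K * K * K => ((- q.1.1, q.1.2), q.2 ^+ 2)) fibY fibY.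
Proof.
have m := maps_sqr_last.
apply: (@qis_strata _ _ C (K * K)%type (K * K)%type K K fibY fibY (fun p => (- p.1.1, p.1.2))
  (fun z => z ^+ 2) open_fibY open_fibY _ _ (powlike_exp C (n := 2) isT)).
- by move=> p _; conts.
- by move=> p Yp; exact: (m p Yp).1.
- have md : maps (fun w : K * K => (- w.1, w.2)) [set w | fibY (w, 0)] [set w | fibY (w, 0)].
    by move=> [a r] [/= a0 r0]; split; [split; rewrite //= oppr_eq0|conts].
  by apply: (qis_homeo md md) => -[a r] _ /=; rewrite opprK.
- pose A : set (K * K) := [set w | w.2 != 0].
  have E : fibY `&` [set p | p.2 != 0] = A `*` [set z | z != 0].
    apply/seteqP; split=> -[[a r] b] [/= h1 h2]; first by case: h1.
    split=> //; split=> //; right; exact: h2.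
  rewrite E.
  have md : maps (fun w : K * K => (- w.1, w.2)) A A.
    by move=> [a r] /= r0; split=> //; conts.
  have qd : qis (fun w : K * K => (- w.1, w.2)) A A.
    by apply: (qis_homeo md md) => -[a r] _ /=; rewrite opprK.
  by have [_ _ _ h] := powlike_exp C (n := 2) isT; exact: (h _ _ _ _ _ md qd).
Qed.

Notation T9 := ((K * K * K) * (K * K * K * K * K * K))%type.
Definition inj0 (p : K * K * K * K * K * K) : T9 := ((0, 0, 0), p).

Definition qf (c0 c1 c2 y z : K) : K := c0 * y ^+ 2 + c1 * y * z + c2 * z ^+ 2.

(* The triples [x^2 + c1(y,z)], [x (r1 . (y,z)) + c2(y,z)], [x (r2 . (y,z)) + c3(y,z)]
   with no common zero. *)
Definition setE : set (T9 * (K * K) * (K * K)) := [set p | forall x y z,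
  x ^+ 2 + qf p.1.1.1.1.1 p.1.1.1.1.2 p.1.1.1.2 y z = 0 ->
  x * (p.1.2.1 * y + p.1.2.2 * z) +
    qf p.1.1.2.1.1.1.1.1 p.1.1.2.1.1.1.1.2 p.1.1.2.1.1.1.2 y z = 0 ->
  x * (p.2.1 * y + p.2.2 * z) + qf p.1.1.2.1.1.2 p.1.1.2.1.2 p.1.1.2.2 y z = 0 ->
  y = 0 /\ z = 0].

Let sq0 (x : K) : x ^+ 2 = 0 -> x = 0.
Proof. by move/eqP; rewrite expf_eq0 => /eqP. Qed.

Let neq0_or (y z : K) : y != 0 \/ z != 0 -> ~ (y = 0 /\ z = 0).
Proof. by move=> h [y0 z0]; move: h; rewrite y0 z0 eqxx => -[]. Qed.

Let neq0_orP (y z : K) : ~ (y != 0 \/ z != 0) -> y = 0 /\ z = 0.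
Proof.
by move=> h; split; apply: contrapT => /eqP h'; apply: h; [left|right].
Qed.

(** With zero rows the first equation merely asks for a square root of -c1(y,z), which always
    exists. *)
Lemma setE_00 c n : setE (((c, n), (0, 0)), (0, 0)) <-> N2 n.
Proof.
case: c => -[c10 c11] c12; case: n => -[[[[c20 c21] c22] c30] c31] c32.
have h := coprime2 0 c20 c21 c22 c30 c31 c32.
split=> [E|Nn x y z /= _].
  apply/eqP => /h[y [z [yz h2 h3]]]; apply: (neq0_or yz).
  apply: (E (sqrtC (- qf c10 c11 c12 y z))); rewrite /= ?sqrtCK; first by rewrite addNr.
    by rewrite !mul0r addr0 mulr0 add0r.
  by rewrite !mul0r addr0 mulr0 add0r.
rewrite !mul0r addr0 mulr0 !add0r => h2 h3; apply: neq0_orP => yz.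
by case/eqP: Nn; apply/h; exists y, z.
Qed.

Definition sec (r1 r2 : K * K) : set T9 := [set t | setE ((t, r1), r2)].

Lemma maps_inj0 r1 r2 : maps inj0 N2 (sec r1 r2).
Proof.
move=> n Nn; split; last by rewrite /inj0; conts.
move=> x y z /= x0; have -> : x = 0 by apply: sq0; rewrite -x0 /qf; ring.
rewrite !mul0r !add0r => h2 h3.
have [_ h] := setE_00 (0, 0, 0) n; apply: (h Nn 0 y z) => /=; rewrite ?mul0r ?add0r //.
by rewrite /qf; ring.
Qed.

(** For the rows (1,0) and (0,0), eliminating x = -c2/y from x^2 + c1 leaves the quartic c2^2 + y^2
    c1, to be paired with c3. Its last two coefficients come from c2^2 alone, which is the origin of
    the shape of [form4]. *)
Let kE (t : T9) : (K * K) * K * K * K * K * K * K :=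
  ((2 * t.2.1.1.1.1.1 * t.2.1.1.1.2 + t.2.1.1.1.1.2 ^+ 2 + t.1.2, t.2.1.1.1.1.2),
   t.2.1.1.1.1.1 ^+ 2 + t.1.1.1, 2 * t.2.1.1.1.1.1 * t.2.1.1.1.1.2 + t.1.1.2, t.2.1.1.1.2,
   t.2.1.1.2, t.2.1.2, t.2.2).

Let secE_kE t : sec (1, 0) (0, 0) t <-> Res4 (kE t) != 0.
Proof.
move: t => [[[c10 c11] c12] [[[[[c20 c21] c22] c30] c31] c32]].
have fE y z : form4 ((2 * c20 * c22 + c21 ^+ 2 + c12, c21), c20 ^+ 2 + c10, 2 * c20 * c21 + c11, c22) y z =
    qf c20 c21 c22 y z ^+ 2 + qf c10 c11 c12 y z * y ^+ 2.
  by rewrite /form4 /qf /=; ring.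
have h := coprime4 (2 * c20 * c22 + c21 ^+ 2 + c12, c21) (c20 ^+ 2 + c10) (2 * c20 * c21 + c11) c22 c30 c31 c32.
split=> [E|Nn x y z /= e1 e2 e3].
  apply/eqP => /h[y [z [yz]]]; rewrite fE => h2 h3; apply: (neq0_or yz).
  (* At y = 0 elimination fails, but there the quartic is c22^2 z^4, so c2 vanishes and any square
     root of -c1 serves as x. *)
  have [y0|y0] := eqVneq y 0.
    have z0 : z != 0 by case: yz => //; rewrite y0 eqxx.
    have c220 : c22 = 0.
      apply: sq0; apply: (mulIf (expf_neq0 4 z0)).
      by rewrite mul0r -h2 /qf y0; ring.
    apply: (E (sqrtC (- qf c10 c11 c12 y z))); rewrite /= ?sqrtCK; first by rewrite addNr.
      by rewrite /qf y0 c220; ring.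
    by rewrite -[RHS]h3 /qf; ring.
  apply: (E (- qf c20 c21 c22 y z / y)) => /=.
  - apply: (mulIf (expf_neq0 2 y0)); rewrite mul0r -h2; field.
    by [].
  - by field.
  - by rewrite -[RHS]h3 /qf; ring.
apply: neq0_orP => yz; case/eqP: Nn; apply/h; exists y, z; split=> //.
  rewrite fE; have -> : qf c20 c21 c22 y z = - (x * y).
    by apply/eqP; rewrite -subr_eq0 opprK -e2; apply/eqP; ring.
  by rewrite sqrrN exprMn -mulrDl e1 mul0r.
by rewrite -[RHS]e3 /qf; ring.
Qed.

Let maps_kE : maps kE (sec (1, 0) (0, 0)) [set p | Res4 p != 0].
Proof. by move=> t /secE_kE tE; split=> //; rewrite /kE; conts. Qed.

(** A trivial line bundle: the fibre coordinate is the leading coefficient of c2, and c1 is adjusted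
    along it so that [kE] stays constant. *)
Let qis_kE : qis kE (sec (1, 0) (0, 0)) [set p | Res4 p != 0].
Proof.
pose back (p : (K * K) * K * K * K * K * K * K) : T9 :=
  ((p.1.1.1.1.1.2, p.1.1.1.1.2, p.1.1.1.1.1.1.1 - p.1.1.1.1.1.1.2 ^+ 2),
   (0, p.1.1.1.1.1.1.2, p.1.1.1.2, p.1.1.2, p.1.2, p.2)).
pose H (s : R) (t : T9) : T9 :=
  ((t.2.1.1.1.1.1 ^+ 2 + t.1.1.1 - (toC C s * t.2.1.1.1.1.1) ^+ 2,
    2 * t.2.1.1.1.1.1 * t.2.1.1.1.1.2 + t.1.1.2 - 2 * (toC C s * t.2.1.1.1.1.1) * t.2.1.1.1.1.2,
    2 * t.2.1.1.1.1.1 * t.2.1.1.1.2 + t.1.2 - 2 * (toC C s * t.2.1.1.1.1.1) * t.2.1.1.1.2),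
   (toC C s * t.2.1.1.1.1.1, t.2.1.1.1.1.2, t.2.1.1.1.2, t.2.1.1.2, t.2.1.2, t.2.2)).
have kH s t : kE (H s t) = kE t.
  move: t => [[[c10 c11] c12] [[[[[c20 c21] c22] c30] c31] c32]].
  by rewrite /kE /H /=; congr ((_, _), _, _, _, _, _, _); ring.
have kb p : kE (back p) = p.
  move: p => [[[[[[[A2 m] a0] a1] n] b0] b1] u].
  by rewrite /kE /back /=; congr ((_, _), _, _, _, _, _, _); ring.
apply: (@qis_retract _ _ _ _ _ _ back H maps_kE).
- by move=> p Xp; split; [apply/secE_kE; rewrite kb|rewrite /back; conts].
- by move=> s t sI tE; split; [apply/secE_kE; rewrite kH; exact/secE_kE|rewrite /H; conts].
- move=> [[[c10 c11] c12] [[[[[c20 c21] c22] c30] c31] c32]] _; rewrite /H rmorph0 /back /=.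
  by congr ((_, _, _), (_, _, _, _, _, _)); ring.
- move=> [[[c10 c11] c12] [[[[[c20 c21] c22] c30] c31] c32]] _; rewrite /H rmorph1 /=.
  by congr ((_, _, _), (_, _, _, _, _, _)); ring.
- by move=> p _; exact: kb.
Qed.

(** For c1 = 0 the quartic is c2^2, whose resultant with c3 is the square of that of the pair; the
    composite is therefore squaring of the middle coordinate. *)
Lemma qis_secE : qis inj0 N2 (sec (1, 0) (0, 0)).
Proof.
have m4 := @maps_tau4 K; have mk := maps_comp maps_kE m4.
have qk : qis (tau (@Res4 K) \o kE) (sec (1, 0) (0, 0)) fibY.
  exact: (qis_comp maps_kE m4 qis_kE (qis_tau4 C)).
apply: (qis_cancel_l (maps_inj0 _ _) mk qk).
have q := qis_comp maps_tauN (_ : maps (fun q : K * K * K => ((q.1.1, q.1.2 ^+ 2), q.2)) fibY fibY)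
  qis_tauN qis_sqr_mid.
apply: qis_ext (q _) => [[[[[[c20 c21] c22] c30] c31] c32] _|].
  rewrite /tau /kE /tauN /inj0 /Res4 /resN /=; congr ((_, _), _).
  by rewrite /res4 /res2; ring.
by move=> [[a r] b] [/= ? ?]; split; [split=> //=; rewrite expf_neq0|conts].
Qed.

Let S0 (n : K * K * K * K * K * K) : K :=
  n.1.1.1.1.1 ^+ 2 + (n.1.1.1.1.2 + n.2) * n.1.1.2.
Let S1 (n : K * K * K * K * K * K) : K :=
  n.1.1.1.2 * n.1.1.2 + (n.1.1.1.1.2 + n.2) * (n.1.1.1.1.1 + n.1.2) - 2 * n.1.1.1.1.1 * n.2.
Let S2 (n : K * K * K * K * K * K) : K :=
  n.2 ^+ 2 + n.1.1.1.2 * (n.1.1.1.1.1 + n.1.2).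

(** For the rows (1,0) and (0,1) a common zero satisfies y c3 = z c2. The coefficients of this cubic
    are followed by those of c1 plus the quadratic form of [S0], [S1], [S2]. *)
Let kI (t : T9) : K * K * K * K * K * K * K :=
  (t.2.2 - t.2.1.1.1.1.2, t.2.1.1.2, t.2.1.2 - t.2.1.1.1.1.1, - t.2.1.1.1.2,
   t.1.1.1 + S0 t.2, t.1.1.2 + S1 t.2, t.1.2 + S2 t.2).

(* Writing [(c2, c3) = M (y, z)] with [M] traceless with linear entries, a zero of
   [y c3 - z c2] is an eigenvector of [M], and [M^2] is the scalar with
   coefficients [S0], [S1], [S2]. *)
Let secI_kI t : sec (1, 0) (0, 1) t <-> Res3 (kI t) != 0.
Proof.
move: t => [[[c10 c11] c12] [[[[[c20 c21] c22] c30] c31] c32]].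
set n := (c20, c21, c22, c30, c31, c32).
have fE y z : form3 (c32 - c21, c30, c31 - c20, - c22) y z =
    y * qf c30 c31 c32 y z - z * qf c20 c21 c22 y z.
  by rewrite /form3 /qf /=; ring.
have h := coprime3 (c32 - c21) c30 (c31 - c20) (- c22) (c10 + S0 n) (c11 + S1 n) (c12 + S2 n).
have qE y z : (c10 + S0 n) * y ^+ 2 + (c11 + S1 n) * y * z + (c12 + S2 n) * z ^+ 2 =
    qf c10 c11 c12 y z + qf (S0 n) (S1 n) (S2 n) y z by rewrite /qf; ring.
have eig x y z : y != 0 \/ z != 0 -> qf c20 c21 c22 y z = - x * y -> qf c30 c31 c32 y z = - x * z ->
    qf (S0 n) (S1 n) (S2 n) y z = x ^+ 2.
  move=> yz e2 e3; have [y0|y0] := boolP (y != 0).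
    apply: (mulIf y0).
    transitivity ((c20 * y - c32 * z) * qf c20 c21 c22 y z + (c22 * z + (c21 + c32) * y) * qf c30 c31 c32 y z).
      by rewrite /qf /S0 /S1 /S2 /n /=; ring.
    rewrite e2 e3; transitivity (- x * ((c20 * y - c32 * z) * y + (c22 * z + (c21 + c32) * y) * z)); first ring.
    have -> : (c20 * y - c32 * z) * y + (c22 * z + (c21 + c32) * y) * z = qf c20 c21 c22 y z by rewrite /qf; ring.
    by rewrite e2; ring.
  have z0 : z != 0 by case: yz => // y1; rewrite y1 in y0.
  apply: (mulIf z0).
  transitivity ((c30 * y + (c20 + c31) * z) * qf c20 c21 c22 y z + (c32 * z - c20 * y) * qf c30 c31 c32 y z).
    by rewrite /qf /S0 /S1 /S2 /n /=; ring.
  rewrite e2 e3; transitivity (- x * ((c30 * y + (c20 + c31) * z) * y + (c32 * z - c20 * y) * z)); first ring.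
  have -> : (c30 * y + (c20 + c31) * z) * y + (c32 * z - c20 * y) * z = qf c30 c31 c32 y z by rewrite /qf; ring.
  by rewrite e3; ring.
split=> [E|Nn x y z /= e1 e2 e3].
  apply/eqP => /h[y [z [yz]]]; rewrite fE qE => h2 h3; apply: (neq0_or yz).
  have [x [e2 e3]] : exists x, qf c20 c21 c22 y z = - x * y /\ qf c30 c31 c32 y z = - x * z.
    have h2' : y * qf c30 c31 c32 y z = z * qf c20 c21 c22 y z by apply/eqP; rewrite -subr_eq0 h2.
    have [y0|y0] := eqVneq y 0.
      have z0 : z != 0 by case: yz => //; rewrite y0 eqxx.
      exists (- qf c30 c31 c32 y z / z); split; last by field.
      by apply: (mulIf z0); rewrite mulrC -h2' y0; ring.
    exists (- qf c20 c21 c22 y z / y); split; first by field.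
    by apply: (mulIf y0); rewrite mulrC h2'; field.
  apply: (E x) => /=.
  - by rewrite -(eig x y z yz e2 e3) addrC.
  - by rewrite e2; ring.
  - by rewrite e3; ring.
apply: neq0_orP => yz; case/eqP: Nn; apply/h.
have e2' : qf c20 c21 c22 y z = - x * y.
  by apply/eqP; rewrite -subr_eq0 -e2; apply/eqP; ring.
have e3' : qf c30 c31 c32 y z = - x * z.
  by apply/eqP; rewrite -subr_eq0 -e3; apply/eqP; ring.
exists y, z; split=> //; first by rewrite fE e2' e3'; ring.
by rewrite qE (eig x y z yz e2' e3') addrC.
Qed.

Let cS0 : continuous S0. Proof. by move=> p; change (contat p S0); rewrite /S0; conts. Qed.
Let cS1 : continuous S1. Proof. by move=> p; change (contat p S1); rewrite /S1; conts. Qed.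
Let cS2 : continuous S2. Proof. by move=> p; change (contat p S2); rewrite /S2; conts. Qed.

Let maps_kI : maps kI (sec (1, 0) (0, 1)) [set p | Res3 p != 0].
Proof. by move=> t /secI_kI tE; split=> //; rewrite /kI; conts. Qed.

Let qis_kI : qis kI (sec (1, 0) (0, 1)) [set p | Res3 p != 0].
Proof.
pose bn (p : K * K * K * K * K * K * K) : K * K * K * K * K * K :=
  (0, 0, - p.1.1.1.2, p.1.1.1.1.1.2, p.1.1.1.1.2, p.1.1.1.1.1.1).
pose back (p : K * K * K * K * K * K * K) : T9 :=
  ((p.1.1.2 - S0 (bn p), p.1.2 - S1 (bn p), p.2 - S2 (bn p)), bn p).
pose Hn (s : R) (n : K * K * K * K * K * K) : K * K * K * K * K * K :=
  (toC C s * n.1.1.1.1.1, toC C s * n.1.1.1.1.2, n.1.1.1.2, n.1.1.2,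
   n.1.2 - n.1.1.1.1.1 + toC C s * n.1.1.1.1.1, n.2 - n.1.1.1.1.2 + toC C s * n.1.1.1.1.2).
pose H (s : R) (t : T9) : T9 :=
  ((t.1.1.1 + S0 t.2 - S0 (Hn s t.2), t.1.1.2 + S1 t.2 - S1 (Hn s t.2),
    t.1.2 + S2 t.2 - S2 (Hn s t.2)), Hn s t.2).
have kH s t : kI (H s t) = kI t.
  move: t => [[[c10 c11] c12] [[[[[c20 c21] c22] c30] c31] c32]].
  by rewrite /kI /H /= !subrK; congr (_, _, _, _, _, _, _); ring.
have kb p : kI (back p) = p.
  move: p => [[[[[[A2 a0] a1] n] b0] b1] u].
  by rewrite /kI /back /= !subrK; congr (_, _, _, _, _, _, _); ring.
have Hn1 n : Hn 1 n = n.
  move: n => [[[[[c20 c21] c22] c30] c31] c32].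
  by rewrite /Hn rmorph1 /=; congr (_, _, _, _, _, _); ring.
apply: (@qis_retract _ _ _ _ _ _ back H maps_kI).
- by move=> p Xp; split; [apply/secI_kI; rewrite kb|rewrite /back /bn; conts].
- by move=> s t sI tE; split; [apply/secI_kI; rewrite kH; exact/secI_kI|rewrite /H /Hn; conts].
- move=> t _; have -> : back (kI t) = ((t.1.1.1 + S0 t.2 - S0 (bn (kI t)),
      t.1.1.2 + S1 t.2 - S1 (bn (kI t)), t.1.2 + S2 t.2 - S2 (bn (kI t))), bn (kI t)) by [].
  have -> : bn (kI t) = Hn 0 t.2; last by [].
  move: t => [[[c10 c11] c12] [[[[[c20 c21] c22] c30] c31] c32]].
  by rewrite /Hn /bn /kI rmorph0 /=; congr (_, _, _, _, _, _); ring.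
- move=> t _; rewrite /H Hn1 !addrK.
  by move: t => [[[c10 c11] c12] n].
- by move=> p _; exact: kb.
Qed.

Lemma qis_secI : qis inj0 N2 (sec (1, 0) (0, 1)).
Proof.
have m3 := @maps_tau3 K; have mk := maps_comp maps_kI m3.
have qk : qis (tau (@Res3 K) \o kI) (sec (1, 0) (0, 1)) fibY.
  exact: (qis_comp maps_kI m3 qis_kI (qis_tau3 C)).
apply: (qis_cancel_l (maps_inj0 _ _) mk qk).
have msm : maps (fun q : K * K * K => ((q.1.1, q.1.2 ^+ 2), q.2)) fibY fibY.
  by move=> [[a r] b] [/= ? ?]; split; [split=> //=; rewrite expf_neq0|conts].
have q := qis_comp maps_tauN (maps_comp msm maps_sqr_last) qis_tauN
  (qis_comp msm maps_sqr_last qis_sqr_mid qis_sqr_last).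
have e (n : K * K * K * K * K * K) : (tau (@Res3 K) \o kI \o inj0) n = ((- n.1.1.1.2, resN n ^+ 2), S2 n).
  move: n => [[[[[c20 c21] c22] c30] c31] c32].
  rewrite /tau /kI /inj0 /Res3 /resN /S0 /S1 /S2 /=; congr ((_, _), _); last by ring.
  by rewrite /res3 /res2; ring.
apply: (iffLR (qis_homotopic _) q).
have cR := cont_resN.
(* [S2] differs from [n.2 ^+ 2] by a multiple of the first coordinate, so scaling the difference
   never makes the first and the last coordinate vanish together. *)
exists (fun s n => ((- n.1.1.1.2, resN n ^+ 2), n.2 ^+ 2 + toC C s * (n.1.1.1.2 * (n.1.1.1.1.1 + n.1.2)))).
split=> [s n sI Nn|n _|n _].
- split; last by conts.
  have [[/= ab r0] _] := maps_tauN Nn; split; last by rewrite /= expf_neq0.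
  rewrite /= oppr_eq0; have [n0|] := eqVneq n.1.1.1.2 0; last by left.
  right; rewrite n0 mul0r mulr0 addr0 expf_neq0 //.
  by case: ab => //; rewrite n0 eqxx.
- by rewrite rmorph0 mul0r addr0.
- by rewrite e rmorph1 mul1r.
Qed.

End FibreMaps.

(** * Openness of the non-degenerate locus *)

Section OpenNondeg.
Variables (R : realType) (K : numClosedFieldType) (C : cplx R K).

Let seg : set R := [set t | -1 <= t /\ t <= 1].

Let seg_compact : compact seg.
Proof.
rewrite (_ : seg = `[-1, 1]%classic); first exact: segment_compact.
by apply/seteqP; split=> t; rewrite /= in_itv /= => /andP.
Qed.

Definition box : set K := [set z | seg (re C z) /\ seg (im C z)].

Lemma box_compact : compact box.
Proof.
have -> : box = (fun p : R * R => toC C p.1 + 'i * toC C p.2) @` (seg `*` seg).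
  apply/seteqP; split=> [z [zr zi]|_ [[a b] [/= sa sb] <-]].
    by exists (re C z, im C z); rewrite //= -reim.
  rewrite /box /=; have -> : toC C a + 'i * toC C b = toC C a * 1 + toC C b * 'i by ring.
  by rewrite reD imD re1 im1 rei imi !mulr1 !mulr0 addr0 add0r.
apply: continuous_compact; last exact: compact_setX.
apply: continuous_subspaceT => p; change (contat p (fun p : R * R => toC C p.1 + 'i * toC C p.2)).
conts.
Qed.

Lemma box_le z w : w != 0 -> `|z| <= `|w| -> box (z / w).
Proof.
move=> w0 zw; have zw1 : `|z / w| <= 1 by rewrite normrM normfV ler_pdivrMr ?normr_gt0 // mul1r.
have h a : toC C `|a| <= `|z / w| -> seg a.
  move=> ha; have := le_trans ha zw1; rewrite -(rmorph1 (toC C)) toC_le ler_norml.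
  by move=> /andP.
by split; apply: h; [exact: norm_re|exact: norm_im].
Qed.

Variables (T : topologicalType) (F1 F2 F3 : T * (K * K * K) -> K).
Hypotheses (cF1 : continuous F1) (cF2 : continuous F2) (cF3 : continuous F3).
Hypothesis hF1 : forall t s x y z, F1 (t, (s * x, s * y, s * z)) = s ^+ 2 * F1 (t, (x, y, z)).
Hypothesis hF2 : forall t s x y z, F2 (t, (s * x, s * y, s * z)) = s ^+ 2 * F2 (t, (x, y, z)).
Hypothesis hF3 : forall t s x y z, F3 (t, (s * x, s * y, s * z)) = s ^+ 2 * F3 (t, (x, y, z)).

Definition nondegen : set T := [set t | forall x y z,
  F1 (t, (x, y, z)) = 0 -> F2 (t, (x, y, z)) = 0 -> F3 (t, (x, y, z)) = 0 ->
  [/\ x = 0, y = 0 & z = 0]].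

Let bad (t : T) (w : K * K * K) := (F1 (t, w) != 0 \/ F2 (t, w) != 0) \/ F3 (t, w) != 0.

Let chart (A : set (K * K)) (e : K * K -> K * K * K) : continuous e -> compact A ->
  open [set t | forall s, A s -> bad t (e s)].
Proof.
move=> ce cA; apply: (open_forall cA) => s t As h.
have oB : open [set p : (K * K) * T | bad p.2 (e p.1)].
  by apply: open_or; [apply: open_or|]; apply: open_nonzero => p; conts.
by apply: open_nbhs_nbhs; split=> //; exact: h.
Qed.

Let e1 (s : K * K) : K * K * K := (1, s.1, s.2).
Let e2 (s : K * K) : K * K * K := (s.1, 1, s.2).
Let e3 (s : K * K) : K * K * K := (s.1, s.2, 1).

(** By homogeneity, dividing by the coordinate of largest modulus moves a nontrivial common zero
    into one of three compact charts, and having no zero on a compact chart is an open condition. *)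
Lemma open_nondegen : open nondegen.
Proof.
have cA : compact (box `*` box) by apply: compact_setX; exact: box_compact.
have -> : nondegen = [set t | (forall s, (box `*` box) s -> bad t (e1 s)) /\
   ((forall s, (box `*` box) s -> bad t (e2 s)) /\ (forall s, (box `*` box) s -> bad t (e3 s)))].
  apply/seteqP; split=> t; rewrite /nondegen /=.
    move=> Nt; have nb w : w != (0, 0, 0) -> bad t w.
      move: w => [[x y] z] w0; apply: contrapT => nb; case/eqP: w0.
      have [|||-> -> -> //] := Nt x y z; apply: contrapT => /eqP h; apply: nb.
      - by left; left.
      - by left; right.
      - by right.
    by split; [|split] => -[a b] _; apply: nb; rewrite /e1 /e2 /e3 !xpair_eqE oner_eq0 ?andbF.
  move=> [h1 [h2 h3]] x y z f1 f2 f3.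
  have cx (w v1 v2 : K) (e : K * K -> K * K * K) : (forall s, (box `*` box) s -> bad t (e s)) ->
      (x, y, z) = (w * (e (v1 / w, v2 / w)).1.1, w * (e (v1 / w, v2 / w)).1.2, w * (e (v1 / w, v2 / w)).2) ->
      `|v1| <= `|w| -> `|v2| <= `|w| -> w = 0.
    move=> he E l1 l2; apply: contrapT => /eqP w0.
    have w20 := expf_neq0 2 w0.
    have [[|]|] : bad t (e (v1 / w, v2 / w)) by apply: he; split; exact: box_le.
    - move: f1; rewrite E hF1 -!surjective_pairing => /eqP.
      by rewrite mulf_eq0 (negPf w20) orFb => /eqP ->; rewrite eqxx.
    - move: f2; rewrite E hF2 -!surjective_pairing => /eqP.
      by rewrite mulf_eq0 (negPf w20) orFb => /eqP ->; rewrite eqxx.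
    - move: f3; rewrite E hF3 -!surjective_pairing => /eqP.
      by rewrite mulf_eq0 (negPf w20) orFb => /eqP ->; rewrite eqxx.
  have tot (a b : K) : (`|a| <= `|b|) || (`|b| <= `|a|) by exact: real_leVge.
  have fin (w : K) : `|x| <= `|w| -> `|y| <= `|w| -> `|z| <= `|w| -> w = 0 -> [/\ x = 0, y = 0 & z = 0].
    by move=> l1 l2 l3 w0; move: l1 l2 l3; rewrite w0 normr0 !normr_le0 => /eqP ? /eqP ? /eqP ?.
  have c1 : `|y| <= `|x| -> `|z| <= `|x| -> [/\ x = 0, y = 0 & z = 0].
    move=> l1 l2; apply: (fin x) => //; have [//|x0] := eqVneq x 0.
    by apply: (cx x y z e1) => //=; congr (_, _, _); field.
  have c2 : `|x| <= `|y| -> `|z| <= `|y| -> [/\ x = 0, y = 0 & z = 0].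
    move=> l1 l2; apply: (fin y) => //; have [//|x0] := eqVneq y 0.
    by apply: (cx y x z e2) => //=; congr (_, _, _); field.
  have c3 : `|x| <= `|z| -> `|y| <= `|z| -> [/\ x = 0, y = 0 & z = 0].
    move=> l1 l2; apply: (fin z) => //; have [//|x0] := eqVneq z 0.
    by apply: (cx z x y e3) => //=; congr (_, _, _); field.
  case/orP: (tot x y) => xy; case/orP: (tot y z) => yz; case/orP: (tot x z) => xz;
    by [exact: c1|exact: c2|exact: c3|apply: c1 => //; exact: le_trans xz _|
        apply: c3 => //; exact: le_trans xy yz|apply: c1 => //; exact: le_trans yz xy].
by apply: open_and; [|apply: open_and]; apply: chart => // s;
  [change (contat s e1); rewrite /e1|change (contat s e2); rewrite /e2|change (contat s e3); rewrite /e3]; conts.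
Qed.

End OpenNondeg.

(** * Coprime pairs of quadratic forms and GL_2 *)

Section GL2.
Variables (R : realType) (K : numClosedFieldType) (C : cplx R K).
Notation qis := (qis R).
Notation fibY := (@fibY K).

Definition det2 (h : K * K * K * K) : K := h.1.1.1 * h.2 - h.1.1.2 * h.1.2.
Definition GL2 : set (K * K * K * K) := [set h | det2 h != 0].
Definition sqGL (h : K * K * K * K) : K * K * K * K * K * K :=
  (h.1.1.1, 0, h.1.1.2, h.1.2, 0, h.2).
Definition colGL (h : K * K * K * K) : K * K * K := ((h.1.1.2, det2 h), h.2).

Lemma cont_det2 : continuous det2.
Proof. by move=> h; change (contat h det2); rewrite /det2; conts. Qed.

Lemma maps_sqGL : maps sqGL GL2 (@N2 K).
Proof.
move=> h Gh; split; last by rewrite /sqGL; conts.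
rewrite /N2 /=; have -> : resN (sqGL h) = det2 h ^+ 2.
  by rewrite /resN /res2 /sqGL /det2 /=; ring.
by rewrite expf_neq0.
Qed.

Lemma maps_colGL : maps colGL GL2 fibY.
Proof.
move=> [[[a b] c] d] Gh; split; last by have cd := cont_det2; rewrite /colGL; conts.
split=> //=; have [b0|] := eqVneq b 0; last by left.
right; apply: contraNneq Gh => d0; rewrite /GL2 /det2 /= b0 d0; apply/eqP; ring.
Qed.

(** Given the second column and the determinant, the first column ranges over an affine line, in
    which conjugation of the second column provides a continuous base point. *)
Lemma qis_colGL : qis colGL GL2 fibY.
Proof.
have cd := cont_det2.
pose N (a b : K) := a * a^* + b * b^*.
have N0 (a b : K) : a != 0 \/ b != 0 -> N a b != 0.
  by move=> ab; rewrite norm2_eq0; case: ab => /negPf -> //; rewrite andbF.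
pose back (q : K * K * K) : K * K * K * K :=
  (q.1.2 * q.2^* / N q.1.1 q.2, q.1.1, - (q.1.2 * q.1.1^* / N q.1.1 q.2), q.2).
pose H (s : R) (h : K * K * K * K) : K * K * K * K :=
  (toC C s * h.1.1.1 + (1 - toC C s) * (back (colGL h)).1.1.1, h.1.1.2,
   toC C s * h.1.2 + (1 - toC C s) * (back (colGL h)).1.2, h.2).
have db a r b : a != 0 \/ b != 0 -> det2 (back ((a, r), b)) = r.
  move=> ab; rewrite /det2 /back /=; have := N0 a b ab; rewrite /N => n0.
  by field.
have dH s h : GL2 h -> det2 (H s h) = det2 h.
  move=> Gh; have [[ab _] _] := maps_colGL Gh.
  have E : (back (colGL h)).1.1.1 * h.2 - h.1.1.2 * (back (colGL h)).1.2 = det2 h by exact: db.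
  rewrite [LHS]/det2 /H; set bk := back _ in E *; rewrite /=.
  transitivity (toC C s * det2 h + (1 - toC C s) * (bk.1.1.1 * h.2 - h.1.1.2 * bk.1.2)).
    by rewrite /bk /back /colGL /= /det2; ring.
  by rewrite E; ring.
apply: (@qis_retract _ _ _ _ _ _ back H maps_colGL).
- move=> [[a r] b] [/= ab r0]; split; first by rewrite /GL2 /= db.
  by rewrite /back /N; conts; exact: N0.
- move=> s h sI Gh; split; first by rewrite /GL2 /= dH.
  have [[/= ab _] _] := maps_colGL Gh.
  by rewrite /H /back /colGL /N /=; conts; exact: N0.
- move=> [[[a b] c] d] Gh; rewrite /H rmorph0 subr0 /=.
  by rewrite !mul0r !mul1r !add0r.
- by move=> [[[a b] c] d] Gh; rewrite /H rmorph1 subrr !mul0r !mul1r !addr0.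
- move=> [[a r] b] [/= ab r0]; rewrite /colGL db //.
Qed.

(** The resultant of a y^2 + b z^2 and c y^2 + d z^2 is (a d - b c)^2, so in the coordinates [colGL]
    and [tauN] the map squares the middle coordinate. *)
Lemma qis_sqGL : qis sqGL GL2 (@N2 K).
Proof.
apply: (qis_cancel_l maps_sqGL (@maps_tauN K) (qis_tauN C)).
have m : maps (fun q : K * K * K => ((q.1.1, q.1.2 ^+ 2), q.2)) fibY fibY.
  by move=> [[a r] b] [/= ? ?]; split; [split=> //=; rewrite expf_neq0|conts].
apply: qis_ext (qis_comp maps_colGL m qis_colGL (qis_sqr_mid C)) => h _.
by rewrite /colGL /tauN /resN /res2 /sqGL /det2 /=; congr ((_, _), _); ring.
Qed.

End GL2.

(** * Linear substitutions in y and z *)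

Section Bundle.
Variables (R : realType) (K : numClosedFieldType) (C : cplx R K).
Notation N6 := (K * K * K * K * K * K)%type.
Notation T9 := ((K * K * K) * (K * K * K * K * K * K))%type.
Notation PE := (T9 * (K * K) * (K * K))%type.
Notation N2 := (@N2 K).
Notation setE := (@setE K).
Notation inj0 := (@inj0 K).

Lemma open_setE : open setE.
Proof.
pose F1 (q : PE * (K * K * K)) := q.2.1.1 ^+ 2 + qf q.1.1.1.1.1.1 q.1.1.1.1.1.2 q.1.1.1.1.2 q.2.1.2 q.2.2.
pose F2 (q : PE * (K * K * K)) := q.2.1.1 * (q.1.1.2.1 * q.2.1.2 + q.1.1.2.2 * q.2.2) +
    qf q.1.1.1.2.1.1.1.1.1 q.1.1.1.2.1.1.1.1.2 q.1.1.1.2.1.1.1.2 q.2.1.2 q.2.2.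
pose F3 (q : PE * (K * K * K)) := q.2.1.1 * (q.1.2.1 * q.2.1.2 + q.1.2.2 * q.2.2) +
    qf q.1.1.1.2.1.1.2 q.1.1.1.2.1.2 q.1.1.1.2.2 q.2.1.2 q.2.2.
have -> : setE = nondegen F1 F2 F3.
  apply/seteqP; split=> p Np x y z; last by move=> e1 e2 e3; have [] := Np x y z e1 e2 e3.
  move=> e1 e2 e3; have [y0 z0] := Np x y z e1 e2 e3; split=> //.
  apply/eqP; have : x ^+ 2 = 0 by rewrite -e1 /F1 /= /qf y0 z0; ring.
  by move/eqP; rewrite expf_eq0.
apply: (open_nondegen C).
- by move=> q; change (contat q F1); rewrite /F1 /qf; conts.
- by move=> q; change (contat q F2); rewrite /F2 /qf; conts.
- by move=> q; change (contat q F3); rewrite /F3 /qf; conts.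
- by move=> p s x y z; rewrite /F1 /qf /=; ring.
- by move=> p s x y z; rewrite /F2 /qf /=; ring.
- by move=> p s x y z; rewrite /F3 /qf /=; ring.
Qed.

Lemma open_N2 : open N2.
Proof. by apply: open_neq0_pre; exact: cont_resN. Qed.

(* The coefficients of [a y^2 + b y z + c z^2] after the substitution [(y, z) := g (y, z)]. *)
Definition sub0 (g : K * K * K * K) (a b c : K) := a * g.1.1.1 ^+ 2 + b * g.1.1.1 * g.1.2 + c * g.1.2 ^+ 2.
Definition sub1 (g : K * K * K * K) (a b c : K) := 2 * a * g.1.1.1 * g.1.1.2
  + b * (g.1.1.1 * g.2 + g.1.1.2 * g.1.2) + 2 * c * g.1.2 * g.2.
Definition sub2 (g : K * K * K * K) (a b c : K) := a * g.1.1.2 ^+ 2 + b * g.1.1.2 * g.2 + c * g.2 ^+ 2.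

Definition subN g (n : N6) : N6 :=
  (sub0 g n.1.1.1.1.1 n.1.1.1.1.2 n.1.1.1.2, sub1 g n.1.1.1.1.1 n.1.1.1.1.2 n.1.1.1.2,
   sub2 g n.1.1.1.1.1 n.1.1.1.1.2 n.1.1.1.2,
   sub0 g n.1.1.2 n.1.2 n.2, sub1 g n.1.1.2 n.1.2 n.2, sub2 g n.1.1.2 n.1.2 n.2).
Definition subT g (t : T9) : T9 :=
  ((sub0 g t.1.1.1 t.1.1.2 t.1.2, sub1 g t.1.1.1 t.1.1.2 t.1.2, sub2 g t.1.1.1 t.1.1.2 t.1.2), subN g t.2).
Definition rowg (g : K * K * K * K) (r : K * K) : K * K :=
  (r.1 * g.1.1.1 + r.2 * g.1.2, r.1 * g.1.1.2 + r.2 * g.2).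
Definition ginv (g : K * K * K * K) : K * K * K * K := (g.2, - g.1.1.2, - g.1.2, g.1.1.1).

Lemma det2_ginv g : det2 (ginv g) = det2 g.
Proof. by rewrite /det2 /ginv /=; ring. Qed.

Lemma ginvK g : ginv (ginv g) = g.
Proof. by move: g => [[[a b] c] d]; rewrite /ginv /= !opprK. Qed.

Lemma subNK g n : det2 g = 1 -> subN (ginv g) (subN g n) = n.
Proof.
move=> dg; have k (x y : K) : y = det2 g ^+ 2 * x -> y = x by rewrite dg expr1n mul1r.
move: n => [[[[[a b] c] a'] b'] c'].
rewrite /subN /ginv /= /sub0 /sub1 /sub2 /=.
by congr (_, _, _, _, _, _); apply: k; rewrite /det2; ring.
Qed.

Lemma subTK g t : det2 g = 1 -> subT (ginv g) (subT g t) = t.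
Proof.
move=> dg; have := subNK (t.1, 0, 0, 0) dg; rewrite /subN /= => E.
rewrite /subT /= subNK //; move: t E => [[[a b] c] n] /= E.
by congr (_, _); move: E => -[-> -> ->].
Qed.

Lemma rowgK g r : det2 g = 1 -> rowg (ginv g) (rowg g r) = r.
Proof.
move=> dg; move: r => [a b]; rewrite /rowg /ginv /=.
have k (x y : K) : y = det2 g * x -> y = x by rewrite dg mul1r.
by congr (_, _); apply: k; rewrite /det2; ring.
Qed.

Lemma setE_sub g t r1 r2 : det2 g = 1 ->
  setE ((t, r1), r2) -> setE ((subT g t, rowg g r1), rowg g r2).
Proof.
move=> dg E x y z /= e1 e2 e3.
have [|||h1 h2] := E x (g.1.1.1 * y + g.1.1.2 * z) (g.1.2 * y + g.2 * z).
- by rewrite -[RHS]e1 /= /qf /sub0 /sub1 /sub2; ring.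
- by rewrite -[RHS]e2 /= /qf /sub0 /sub1 /sub2; ring.
- by rewrite -[RHS]e3 /= /qf /sub0 /sub1 /sub2; ring.
split.
  rewrite -[y]mul1r -dg; transitivity (g.2 * (g.1.1.1 * y + g.1.1.2 * z) - g.1.1.2 * (g.1.2 * y + g.2 * z)).
    by rewrite /det2; ring.
  by rewrite h1 h2 !mulr0 subr0.
rewrite -[z]mul1r -dg; transitivity (g.1.1.1 * (g.1.2 * y + g.2 * z) - g.1.2 * (g.1.1.1 * y + g.1.1.2 * z)).
  by rewrite /det2; ring.
by rewrite h1 h2 !mulr0 subr0.
Qed.

Lemma subT_inj0 g n : subT g (inj0 n) = inj0 (subN g n).
Proof. by rewrite /subT /inj0 /sub0 /sub1 /sub2 /=; congr ((_, _, _), _); ring. Qed.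

Lemma rowg00 g : rowg g (0, 0) = (0, 0).
Proof. by rewrite /rowg !mul0r addr0. Qed.

Lemma N2_sub g n : det2 g = 1 -> N2 n -> N2 (subN g n).
Proof.
move=> dg /(setE_00 (0, 0, 0)) /(setE_sub dg); rewrite subT_inj0 rowg00.
by move/setE_00.
Qed.

(** A substitution of determinant 1 taking the row [r] to (1,0); the Hermitian norm makes it
    continuous on all nonzero rows. *)
Definition gr (r : K * K) : K * K * K * K :=
  (r.1^* / (r.1 * r.1^* + r.2 * r.2^*), - r.2, r.2^* / (r.1 * r.1^* + r.2 * r.2^*), r.1).

Lemma norm_row (r : K * K) : r != 0 -> r.1 * r.1^* + r.2 * r.2^* != 0.
Proof. by rewrite norm2_eq0; apply: contraNN => /andP[/eqP a /eqP b]; rewrite (surjective_pairing r) a b. Qed.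

Lemma det2_gr r : r != 0 -> det2 (gr r) = 1.
Proof. by move=> /norm_row r0; rewrite /det2 /gr /=; field. Qed.

Lemma rowg_gr r : r != 0 -> rowg (gr r) r = (1, 0).
Proof. by move=> /norm_row r0; rewrite /rowg /gr /=; congr (_, _); [field|ring]. Qed.

Lemma rowg_grV r : r != 0 -> rowg (ginv (gr r)) (1, 0) = r.
Proof. by move=> r0; rewrite -{1}(rowg_gr r0) rowgK // det2_gr. Qed.

Lemma subVN g n : det2 g = 1 -> subN g (subN (ginv g) n) = n.
Proof. by move=> dg; rewrite -{1}(ginvK g) subNK // det2_ginv. Qed.
Lemma subVT g n : det2 g = 1 -> subT g (subT (ginv g) n) = n.
Proof. by move=> dg; rewrite -{1}(ginvK g) subTK // det2_ginv. Qed.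

Lemma ca_subN (T : topologicalType) (x : T) (g : T -> K * K * K * K) (n : T -> N6) :
  contat x g -> contat x n -> contat x (fun p => subN (g p) (n p)).
Proof. by move=> cg cn; rewrite /subN /sub0 /sub1 /sub2; conts. Qed.

Lemma ca_subT (T : topologicalType) (x : T) (g : T -> K * K * K * K) (t : T -> T9) :
  contat x g -> contat x t -> contat x (fun p => subT (g p) (t p)).
Proof.
move=> cg ct; apply: ca_pair; first by rewrite /sub0 /sub1 /sub2; conts.
by apply: (@ca_subN _ x g (fun p => (t p).2)) => //; exact: ca_snd.
Qed.

Lemma ca_ginv (T : topologicalType) (x : T) (g : T -> K * K * K * K) :
  contat x g -> contat x (fun p => ginv (g p)).
Proof. by move=> cg; rewrite /ginv; conts. Qed.

Lemma ca_rowg (T : topologicalType) (x : T) (g : T -> K * K * K * K) (r : T -> K * K) :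
  contat x g -> contat x r -> contat x (fun p => rowg (g p) (r p)).
Proof. by move=> cg cr; rewrite /rowg; conts. Qed.

Lemma ca_gr (T : topologicalType) (x : T) (r : T -> K * K) : r x != 0 ->
  contat x r -> contat x (fun p => gr (r p)).
Proof. by move=> /norm_row r0 cr; rewrite /gr; conts. Qed.

End Bundle.

Ltac subc := repeat (cbn beta; first [match goal with
  | |- contat ?x (fun p => subN (@?g p) (@?n p)) => apply: (ca_subN (x := x) (g := g) (n := n))
  | |- contat ?x (fun p => subT (@?g p) (@?n p)) => apply: (ca_subT (x := x) (g := g) (t := n))
  | |- contat ?x (fun p => rowg (@?g p) (@?n p)) => apply: (ca_rowg (x := x) (g := g) (r := n))
  | |- contat ?x (fun p => ginv (@?g p)) => apply: (ca_ginv (x := x) (g := g))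
  | |- contat ?x (fun p => gr (@?g p)) => apply: (@ca_gr _ _ _ _ x g); [eassumption|by []|]
  end | progress conts]).

(** * Rank strata of the rows *)

Section Bundle.
Variables (R : realType) (K : numClosedFieldType) (C : cplx R K).
Notation qis := (qis R).
Notation N6 := (K * K * K * K * K * K)%type.
Notation T9 := ((K * K * K) * (K * K * K * K * K * K))%type.
Notation N2 := (@N2 K).
Notation setE := (@setE K).
Notation sec := (@sec K).
Notation inj0 := (@inj0 K).
Notation subT := (@subT K).
Notation subN := (@subN K).

Lemma qis_sec0 : qis inj0 N2 (sec (0, 0) (0, 0)).
Proof.
apply: (qis_hequiv (g := snd) (maps_inj0 _ _)).
- by move=> [c n] /setE_00 Nn; split=> //; conts.
- apply: maps_idK => //.
- exists (fun s t => ((toC C s * t.1.1.1, toC C s * t.1.1.2, toC C s * t.1.2), t.2)).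
  split=> [s [[[a b] c] n] sI /setE_00 Nn|[[[a b] c] n] _|[[[a b] c] n] _].
  + by split; [apply/setE_00|conts].
  + by rewrite /inj0 /= rmorph0 !mul0r.
  + by rewrite /= rmorph1 !mul1r.
Qed.

Let gnz : good R [set r : K * K | r != 0] := good_neq02 C.
Let gnz1 : good R [set r : K | r != 0] := good_neq0 C.

Lemma maps_fxid_inj0 (E : normedModType K) r1 r2 (D : set E) : maps (fxid inj0) (N2 `*` D) (sec r1 r2 `*` D).
Proof. exact: (maps_fxid (maps_inj0 _ _)). Qed.

Lemma qis_sec_row : qis (fxid inj0) (N2 `*` [set r : K * K | r != 0])
  [set p : T9 * (K * K) | setE ((p.1, p.2), (0, 0)) /\ p.2 != 0].
Proof.
pose A := N2 `*` [set r : K * K | r != 0].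
pose B := [set p : T9 * (K * K) | setE ((p.1, p.2), (0, 0)) /\ p.2 != 0].
pose S := sec (1, 0) (0, 0) `*` [set r : K * K | r != 0].
pose u (p : N6 * (K * K)) := (subN (gr p.2) p.1, p.2).
pose u' (p : N6 * (K * K)) := (subN (ginv (gr p.2)) p.1, p.2).
pose v (p : T9 * (K * K)) := (subT (gr p.2) p.1, p.2).
pose v' (p : T9 * (K * K)) := (subT (ginv (gr p.2)) p.1, p.2).
have mu : maps u A A.
  move=> [n r] [Nn /= r0]; split; first by split=> //; exact: (N2_sub (det2_gr r0)).
  by rewrite /u; subc.
have mu' : maps u' A A.
  move=> [n r] [Nn /= r0]; split; last by rewrite /u'; subc.
  by split=> //; apply: N2_sub => //; rewrite det2_ginv det2_gr.
have mv : maps v B S.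
  move=> [t r] [/= tr r0]; split; last by rewrite /v; subc.
  split=> //; have := setE_sub (det2_gr r0) tr; by rewrite rowg00 rowg_gr.
have mv' : maps v' S B.
  move=> [t r] [/= tr r0]; split; last by rewrite /v'; subc.
  have dg : det2 (ginv (gr r)) = 1 by rewrite det2_ginv det2_gr.
  split=> //; have := setE_sub dg tr; by rewrite rowg00 rowg_grV.
have mf : maps (fxid inj0) A B.
  move=> [n r] [Nn r0]; split; last by rewrite /fxid /inj0; conts.
  by split=> //; exact: (maps_inj0 r (0, 0) Nn).1.
have mf' : maps (fxid inj0) A S by exact: maps_fxid_inj0.
apply: (iffRL (qis_square (u := u) (v := v) mf mf' mu mv _ _ _)).
- apply: (qis_homeo mu mu') => -[n r] [Nn /= r0]; rewrite /u /u' /=.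
    by rewrite subNK // det2_gr.
  by rewrite subVN // det2_gr.
- apply: (qis_homeo mv mv') => -[n r] [Nn /= r0]; rewrite /v /v' /=.
    by rewrite subTK // det2_gr.
  by rewrite subVT // det2_gr.
- by move=> [n r] _; rewrite /v /u /fxid /= subT_inj0.
- exact: (gnz (maps_inj0 (1, 0) (0, 0)) (qis_secE C)).
Qed.

Definition swN (n : N6) : N6 := (n.1.1.2, n.1.2, n.2, n.1.1.1.1.1, n.1.1.1.1.2, n.1.1.1.2).
Definition scN m (n : N6) : N6 := (n.1.1.1.1.1, n.1.1.1.1.2, n.1.1.1.2, m * n.1.1.2, m * n.1.2, m * n.2).
Definition shN l (n : N6) : N6 :=
  (n.1.1.1.1.1 - l * n.1.1.2, n.1.1.1.1.2 - l * n.1.2, n.1.1.1.2 - l * n.2, n.1.1.2, n.1.2, n.2).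

Lemma setE_sw c n r1 r2 : setE (((c, n), r1), r2) -> setE (((c, swN n), r2), r1).
Proof. by move=> E x y z e1 e2 e3; exact: (E x y z). Qed.

Lemma setE_sc m c n r1 r2 : m != 0 -> setE (((c, n), r1), r2) ->
  setE (((c, scN m n), r1), (m * r2.1, m * r2.2)).
Proof.
move=> m0 E x y z /= e1 e2 e3; apply: (E x y z) => //=.
by apply: (mulfI m0); rewrite mulr0 -[RHS]e3 /qf; ring.
Qed.

Lemma setE_sh l c n r1 r2 : setE (((c, n), r1), r2) ->
  setE (((c, shN l n), (r1.1 - l * r2.1, r1.2 - l * r2.2)), r2).
Proof.
move=> E x y z /= e1 e2 e3; apply: (E x y z) => //=.
rewrite -[LHS]addr0 -[X in _ + X](mulr0 (- l)) -{1}e3 -[RHS]e2 /qf; ring.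
Qed.

Lemma N2_sw n : N2 n -> N2 (swN n).
Proof. by move=> /(setE_00 (0, 0, 0)) /setE_sw /setE_00. Qed.
Lemma N2_sc m n : m != 0 -> N2 n -> N2 (scN m n).
Proof. by move=> m0 /(setE_00 (0, 0, 0)) /(setE_sc m0) /=; rewrite mulr0 => /setE_00. Qed.
Lemma N2_sh l n : N2 n -> N2 (shN l n).
Proof. by move=> /(setE_00 (0, 0, 0)) /(@setE_sh l _ _ _ _) /=; rewrite mulr0 subr0 => /setE_00. Qed.

Lemma swNK n : swN (swN n) = n. Proof. by move: n => [[[[[a b] c] d] e] f]. Qed.
Lemma scNK m n : m != 0 -> scN m (scN m^-1 n) = n.
Proof. by move=> m0; move: n => [[[[[a b] c] d] e] f]; rewrite /scN /= !mulVKf. Qed.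
Lemma scNV m n : m != 0 -> scN m^-1 (scN m n) = n.
Proof. by move=> m0; move: n => [[[[[a b] c] d] e] f]; rewrite /scN /= !mulKf. Qed.
Lemma shNK l n : shN l (shN (- l) n) = n.
Proof.
by move: n => [[[[[a b] c] d] e] f]; rewrite /shN /=; congr (_, _, _, _, _, _); ring.
Qed.

(** The normal form reached when the second row is nonzero. The parameter is the determinant of the
    rows up to sign: they have rank 1 where it vanishes and rank 2 elsewhere. *)
Definition setE1 : set (T9 * K) := [set p | setE ((p.1, (0, p.2)), (1, 0))].

Lemma open_setE1 : open setE1.
Proof.
apply: open_near => p pE.
have h : contat p (fun p : T9 * K => ((p.1, (0 : K, p.2)), (1 : K, 0 : K))) by conts.
exact: (ca_near h (open_setE C) pE).
Qed.

(** At parameter 0, exchanging the last two forms leads to [qis_secE]; elsewhere, exchanging and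
    rescaling them leads to [qis_secI]. *)
Lemma qis_setE1 : qis (fxid inj0) (N2 `*` [set: K]) setE1.
Proof.
have mX : maps (fxid inj0) (N2 `*` [set: K]) setE1.
  move=> [n m] [Nn _]; split; last by rewrite /fxid /inj0; conts.
  exact: (maps_inj0 (0, m) (1, 0) Nn).1.
have oX : open (N2 `*` [set: K]).
  rewrite (_ : _ `*` _ = [set p | N2 p.1]); last by apply/seteqP; split=> -[x y] // [].
  by apply: open_fst; exact: open_N2.
apply: (@qis_strata _ _ C _ _ _ _ _ _ (fun p => inj0 p.1) id oX open_setE1 _ _ (powlike_id C gnz1)).
- by move=> p _; rewrite /inj0; conts.
- by move=> p Xp; exact: (mX p Xp).1.
- have -> : [set w | (N2 `*` [set: K]) (w, 0)] = N2 by apply/seteqP; split=> [? []|].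
  have sw r1 r2 : maps (fun t : T9 => (t.1, swN t.2)) (sec r1 r2) (sec r2 r1).
    by move=> [c n] tE; split; [exact: setE_sw|rewrite /swN; conts].
  have mN : maps swN N2 N2 by move=> n Nn; split; [exact: N2_sw|rewrite /swN; conts].
  apply: (iffRL (qis_square (maps_inj0 (0, 0) (1, 0)) (maps_inj0 (1, 0) (0, 0)) mN (sw _ _) _ _ _)).
  + by apply: (qis_homeo mN mN) => n _; exact: swNK.
  + by apply: (qis_homeo (sw _ _) (sw _ _)) => -[c n] _ /=; rewrite swNK.
  + by [].
  + exact: (qis_secE C).
- pose A := N2 `*` [set m : K | m != 0].
  have AE : A = (N2 `*` [set: K]) `&` [set p | p.2 != 0].
    by apply/seteqP; split=> -[n m] [] //= [].
  pose B := setE1 `&` [set p | p.2 != 0].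
  pose S := sec (1, 0) (0, 1) `*` [set m : K | m != 0].
  pose u (p : N6 * K) := (scN p.2^-1 (swN p.1), p.2).
  pose u' (p : N6 * K) := (swN (scN p.2 p.1), p.2).
  pose v (p : T9 * K) : T9 * K := ((p.1.1, scN p.2^-1 (swN p.1.2)), p.2).
  pose v' (p : T9 * K) : T9 * K := ((p.1.1, swN (scN p.2 p.1.2)), p.2).
  have mu : maps u A A.
    move=> [n m] [Nn /= m0]; split; last by rewrite /u /scN /swN; conts.
    by split=> //=; apply: N2_sc; [rewrite invr_eq0|exact: N2_sw].
  have mu' : maps u' A A.
    move=> [n m] [Nn /= m0]; split; last by rewrite /u' /scN /swN; conts.
    by split=> //=; apply: N2_sw; exact: N2_sc.
  have mv : maps v B S.
    move=> [[c n] m] [/= tE m0]; split; last by rewrite /v /scN /swN; conts.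
    split=> //=; have m0' : m^-1 != 0 by rewrite invr_eq0.
    by have := setE_sc m0' (setE_sw tE); rewrite /= mulr0 mulVf.
  have mv' : maps v' S B.
    move=> [[c n] m] [/= tE m0]; split; last by rewrite /v' /scN /swN; conts.
    by split=> //=; have := setE_sw (setE_sc m0 tE); rewrite /= mulr0 mulr1.
  have mf : maps (fxid inj0) A B.
    by move=> [n m] [Nn m0]; have [] := mX (n, m) (conj Nn I).
  suff q : qis (fxid inj0) A B by rewrite AE in q; exact: q.
  apply: (iffRL (qis_square (u := u) (v := v) (f' := fxid inj0) (Y' := S) (X' := A) mf _ mu mv _ _ _)).
  + exact: maps_fxid_inj0.
  + apply: (qis_homeo mu mu') => -[n m] [Nn /= m0]; rewrite /u /u' /=.
      by rewrite scNK // swNK.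
    by rewrite swNK scNV.
  + apply: (qis_homeo mv mv') => -[[c n] m] [Nn /= m0]; rewrite /v /v' /=.
      by rewrite scNK // swNK.
    by rewrite swNK scNV.
  + by [].
  + exact: (gnz1 (maps_inj0 (1, 0) (0, 1)) (qis_secI C)).
Qed.

End Bundle.

(** * Arbitrary rows *)

Section Bundle.
Variables (R : realType) (K : numClosedFieldType) (C : cplx R K).
Notation qis := (qis R).
Notation N6 := (K * K * K * K * K * K)%type.
Notation T9 := ((K * K * K) * (K * K * K * K * K * K))%type.
Notation PE := (T9 * (K * K) * (K * K))%type.
Notation N2 := (@N2 K).
Notation setE := (@setE K).
Notation inj0 := (@inj0 K).
Notation subT := (@subT K).
Notation subN := (@subN K).

Notation setE1 := (@setE1 K).

Let gnz : good R [set r : K * K | r != 0] := good_neq02 C.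

Definition jM (p : N6 * (K * K) * (K * K)) : PE := ((inj0 p.1.1, p.1.2), p.2).

Lemma ca_shN (T : topologicalType) (x : T) (l : T -> K) (n : T -> N6) :
  contat x l -> contat x n -> contat x (fun p => shN (l p) (n p)).
Proof. by move=> cl cn; rewrite /shN; conts. Qed.

Ltac subc' := repeat (cbn beta; first [match goal with
  | |- contat ?x (fun p => shN (@?l p) (@?n p)) => apply: (ca_shN (x := x) (l := l) (n := n))
  end | progress subc]).

Lemma maps_jM : maps jM ((N2 `*` setT) `*` setT) setE.
Proof.
move=> [[n r1] r2] [[Nn _] _]; split; last by rewrite /jM /inj0; conts.
exact: (maps_inj0 r1 r2 Nn).1.
Qed.

(** The substitution [gr] makes the second row (1,0); subtracting a multiple of the third form from
    the second then clears the first entry of the other row. The multiple and the original row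
    remain as free factors of a product. *)
Lemma qis_jM_row2 : qis jM ((N2 `*` setT) `*` [set r | r != 0]) (setE `&` [set p | p.2 != 0]).
Proof.
pose A : set (N6 * (K * K) * (K * K)) := (N2 `*` setT) `*` [set r | r != 0].
pose B : set PE := setE `&` [set p | p.2 != 0].
pose A' : set (N6 * K * K * (K * K)) := ((N2 `*` setT) `*` setT) `*` [set r | r != 0].
pose S : set (T9 * K * K * (K * K)) := (setE1 `*` setT) `*` [set r | r != 0].
pose mr (r2 r1 : K * K) : K * K := rowg (gr r2) r1.
pose u (p : N6 * (K * K) * (K * K)) : N6 * K * K * (K * K) :=
  (((shN (mr p.2 p.1.2).1 (subN (gr p.2) p.1.1), (mr p.2 p.1.2).2), (mr p.2 p.1.2).1), p.2).
pose u' (p : N6 * K * K * (K * K)) : N6 * (K * K) * (K * K) :=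
  ((subN (ginv (gr p.2)) (shN (- p.1.2) p.1.1.1), rowg (ginv (gr p.2)) (p.1.2, p.1.1.2)), p.2).
pose v (p : PE) : T9 * K * K * (K * K) :=
  (((((subT (gr p.2) p.1.1).1, shN (mr p.2 p.1.2).1 (subT (gr p.2) p.1.1).2), (mr p.2 p.1.2).2), (mr p.2 p.1.2).1), p.2).
pose v' (p : T9 * K * K * (K * K)) : PE :=
  ((subT (ginv (gr p.2)) (p.1.1.1.1, shN (- p.1.2) p.1.1.1.2), rowg (ginv (gr p.2)) (p.1.2, p.1.1.2)), p.2).
have shV l n : shN (- l) (shN l n) = n by have := shNK (- l) n; rewrite opprK.
have rowVK g r : det2 g = 1 -> rowg g (rowg (ginv g) r) = r.
  by move=> dg; rewrite -{1}(ginvK g) rowgK // det2_ginv.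
have mu : maps u A A'.
  move=> [[n r1] r2] [[Nn _] /= r0]; split; last by rewrite /u /mr; subc'.
  by split=> //; split=> //; split=> //=; apply: N2_sh; apply: N2_sub => //; exact: det2_gr.
have mu' : maps u' A' A.
  move=> [[[n m] l] r] [[[Nn _] _] /= r0]; split; last by rewrite /u'; subc'.
  split=> //; split=> //=; apply: N2_sub; first by rewrite det2_ginv det2_gr.
  exact: N2_sh.
have mv : maps v B S.
  move=> [[t r1] r2] [tE /= r0]; split; last by rewrite /v /mr; subc'.
  split=> //; split=> //.
  have h := setE_sub (det2_gr r0) tE; rewrite rowg_gr // in h.
  have h2 : setE ((((subT (gr r2) t).1, shN (mr r2 r1).1 (subT (gr r2) t).2),
      ((rowg (gr r2) r1).1 - (mr r2 r1).1 * 1, (rowg (gr r2) r1).2 - (mr r2 r1).1 * 0)), (1, 0)).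
    exact: (@setE_sh K (mr r2 r1).1 (subT (gr r2) t).1 (subT (gr r2) t).2 (rowg (gr r2) r1) (1, 0) h).
  have e1 : (rowg (gr r2) r1).1 - (mr r2 r1).1 * 1 = 0 by rewrite mulr1 subrr.
  have e2 : (rowg (gr r2) r1).2 - (mr r2 r1).1 * 0 = (mr r2 r1).2 by rewrite mulr0 subr0.
  by rewrite e1 e2 in h2.
have mv' : maps v' S B.
  move=> [[[[c n] m] l] r] [[tE _] /= r0]; split; last by rewrite /v'; subc'.
  split=> //=; have dg : det2 (ginv (gr r)) = 1 by rewrite det2_ginv det2_gr.
  have h := @setE_sh _ (- l) _ _ _ _ tE.
  have := setE_sub dg h; rewrite rowg_grV //= mulr1 mulr0 subr0 sub0r opprK.
  by [].
have mf : maps jM A B.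
  by move=> [[n r1] r2] [[Nn _] r0]; have [? ?] := @maps_jM ((n, r1), r2) (conj (conj Nn I) I).
have m1 : maps (fxid inj0) (N2 `*` [set: K]) setE1.
  move=> [n m] [Nn _]; split; last by rewrite /fxid /inj0; conts.
  exact: (maps_inj0 (0, m) (1, 0) Nn).1.
have m2 : maps (fxid (fxid inj0)) ((N2 `*` [set: K]) `*` [set: K]) (setE1 `*` [set: K]).
  exact: maps_fxid.
have m3 : maps (fxid (fxid (fxid inj0))) A' S by exact: maps_fxid.
have gT : good R [set: K] := good_contr (v := 0) I (contr_setT C K).
suff : qis jM A B by [].
apply: (iffRL (qis_square (u := u) (v := v) (f' := fxid (fxid (fxid inj0))) (Y' := S) (X' := A') mf m3 mu mv _ _ _)).
- apply: (qis_homeo mu mu') => [[[n r1] r2] [_ /= r0]|[[[n m] l] r] [_ /= r0]]; rewrite /u /u' /mr; cbn [fst snd].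
    by rewrite shV subNK ?det2_gr // -surjective_pairing rowgK ?det2_gr.
  by rewrite subVN ?det2_gr // !rowVK ?det2_gr //= shNK.
- apply: (qis_homeo mv mv') => [[[t r1] r2] [_ /= r0]|[[[[c n] m] l] r] [_ /= r0]]; rewrite /v /v' /mr; cbn [fst snd].
    by rewrite shV -!surjective_pairing subTK ?det2_gr // rowgK ?det2_gr.
  by rewrite subVT ?det2_gr // !rowVK ?det2_gr //= shNK.
- move=> [[n r1] r2] _; rewrite /v /u /mr /jM /fxid; rewrite [_.1.1]/= subT_inj0.
  by [].
- exact: (gnz m2 (gT _ _ _ _ _ m1 (qis_setE1 C))).
Qed.

Lemma qis_jM : qis jM ((N2 `*` setT) `*` setT) setE.
Proof.
have oN := @open_N2 K.
have XE (T : Type) (X : set T) : X `*` [set: K * K] = [set p | X p.1].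
  by apply/seteqP; split=> -[x y] // [].
have oX1 : open (N2 `*` [set: K * K]) by rewrite XE; apply: open_fst.
have oX : open ((N2 `*` [set: K * K]) `*` [set: K * K]) by rewrite XE; apply: open_fst.
apply: (@qis_strata _ _ C _ _ _ _ _ _ (fun p => (inj0 p.1.1, p.1.2)) id oX (open_setE C) _ _ (powlike_id C gnz)).
- by move=> p _; rewrite /inj0; conts.
- by move=> p Xp; exact: (maps_jM Xp).1.
- pose Z : set (T9 * (K * K)) := [set w | setE (w, 0)].
  have -> : [set w | ((N2 `*` [set: K * K]) `*` [set: K * K]) (w, 0)] = N2 `*` [set: K * K].
    by apply/seteqP; split=> [? []|].
  have oZ : open Z.
    apply: open_near => p pE.
    have h : contat p (fun p : T9 * (K * K) => (p, 0 : K * K)) by conts.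
    exact: (ca_near h (open_setE C) pE).
  apply: (@qis_strata _ _ C _ _ _ _ _ Z (fun p => inj0 p.1) id oX1 oZ _ _ (powlike_id C gnz)).
  + by move=> p _; rewrite /inj0; conts.
  + by move=> [n r] [Nn _]; exact: (maps_inj0 r (0, 0) Nn).1.
  + have -> : [set w | (N2 `*` [set: K * K]) (w, 0)] = N2 by apply/seteqP; split=> [? []|].
    exact: (qis_sec0 C).
  + have AE : N2 `*` [set r : K * K | r != 0] = (N2 `*` [set: K * K]) `&` [set p | p.2 != 0].
      by apply/seteqP; split=> -[n m] [] //= [].
    have BE : [set p : T9 * (K * K) | setE ((p.1, p.2), (0, 0)) /\ p.2 != 0] = Z `&` [set p | p.2 != 0].
      by apply/seteqP; split=> -[n m] [].
    by have := qis_sec_row C; rewrite AE BE.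
- have AE : (N2 `*` [set: K * K]) `*` [set r : K * K | r != 0] =
    ((N2 `*` [set: K * K]) `*` [set: K * K]) `&` [set p | p.2 != 0].
    by apply/seteqP; split=> -[n m] [] //= [].
  by have := qis_jM_row2; rewrite AE.
Qed.

Lemma qis_jE : qis (fun n : N6 => ((inj0 n, 0), 0) : PE) N2 setE.
Proof.
have ms (T : topologicalType) (X : set T) : maps (fun x => (x, 0 : K * K)) X (X `*` setT) by exact: maps_slice.
have q1 := qis_comp (ms _ N2) (ms _ _) (@qis_zeroT _ _ C (K * K)%type _ _) (@qis_zeroT _ _ C (K * K)%type _ _).
exact: (qis_comp (maps_comp (ms _ N2) (ms _ _)) maps_jM q1 qis_jM).
Qed.

End Bundle.

(** * Non-degenerate triples, recombination of the forms, completing the square *)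

Section Bundle.
Variables (R : realType) (K : numClosedFieldType) (C : cplx R K).
Notation qis := (qis R).
Notation N6 := (K * K * K * K * K * K)%type.
Notation T9 := ((K * K * K) * (K * K * K * K * K * K))%type.
Notation PE := (T9 * (K * K) * (K * K))%type.
Notation N2 := (@N2 K).
Notation setE := (@setE K).
Notation inj0 := (@inj0 K).

Notation P1 := (PE * (K * K))%type.
Notation P18 := (P1 * (K * K) * K)%type.
Notation GL2 := (@GL2 K).

(* A triple of quadratic forms [a_i x^2 + x (l_i . (y,z)) + c_i (y,z)] is stored as
   [(((((c1, (c2, c3)), l2), l3), l1), (a2, a3)), a1]. *)
Definition tform (a : K) (l : K * K) (c0 c1 c2 x y z : K) : K :=
  a * x ^+ 2 + x * (l.1 * y + l.2 * z) + qf c0 c1 c2 y z.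

Definition mk18 (a1 a2 a3 : K) (l1 l2 l3 : K * K) (c1 : K * K * K) (n : N6) : P18 :=
  ((((((c1, n), l2), l3), l1), (a2, a3)), a1).

Definition q1 (F : P18) x y z := tform F.2 F.1.1.2 F.1.1.1.1.1.1.1.1 F.1.1.1.1.1.1.1.2 F.1.1.1.1.1.1.2 x y z.
Definition q2 (F : P18) x y z := tform F.1.2.1 F.1.1.1.1.2
  F.1.1.1.1.1.2.1.1.1.1.1 F.1.1.1.1.1.2.1.1.1.1.2 F.1.1.1.1.1.2.1.1.1.2 x y z.
Definition q3 (F : P18) x y z := tform F.1.2.2 F.1.1.1.2
  F.1.1.1.1.1.2.1.1.2 F.1.1.1.1.1.2.1.2 F.1.1.1.1.1.2.2 x y z.

Definition setN : set P18 := [set F | forall x y z,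
  q1 F x y z = 0 -> q2 F x y z = 0 -> q3 F x y z = 0 -> [/\ x = 0, y = 0 & z = 0]].

Lemma open_setN : open setN.
Proof.
pose G q (p : P18 * (K * K * K)) : K := q p.1 p.2.1.1 p.2.1.2 p.2.2.
have -> : setN = nondegen (G q1) (G q2) (G q3) by [].
apply: (open_nondegen C).
- by move=> p; change (contat p (G q1)); rewrite /G /q1 /tform /qf; conts.
- by move=> p; change (contat p (G q2)); rewrite /G /q2 /tform /qf; conts.
- by move=> p; change (contat p (G q3)); rewrite /G /q3 /tform /qf; conts.
- move=> F s x y z; move: F => [[[[[[[[c0 c1] c2] [[[[[d0 d1] d2] e0] e1] e2]] [l21 l22]] [l31 l32]] [l11 l12]] [a2 a3]] a1].
  by rewrite /G /q1 /tform /qf /=; ring.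
- move=> F s x y z; move: F => [[[[[[[[c0 c1] c2] [[[[[d0 d1] d2] e0] e1] e2]] [l21 l22]] [l31 l32]] [l11 l12]] [a2 a3]] a1].
  by rewrite /G /q2 /tform /qf /=; ring.
- move=> F s x y z; move: F => [[[[[[[[c0 c1] c2] [[[[[d0 d1] d2] e0] e1] e2]] [l21 l22]] [l31 l32]] [l11 l12]] [a2 a3]] a1].
  by rewrite /G /q3 /tform /qf /=; ring.
Qed.

Record mat3 := Mat3 { m11 : K; m12 : K; m13 : K; m21 : K; m22 : K; m23 : K; m31 : K; m32 : K; m33 : K }.

Definition mul3 (A B : mat3) : mat3 :=
  Mat3 (m11 A * m11 B + m12 A * m21 B + m13 A * m31 B) (m11 A * m12 B + m12 A * m22 B + m13 A * m32 B)
       (m11 A * m13 B + m12 A * m23 B + m13 A * m33 B)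
       (m21 A * m11 B + m22 A * m21 B + m23 A * m31 B) (m21 A * m12 B + m22 A * m22 B + m23 A * m32 B)
       (m21 A * m13 B + m22 A * m23 B + m23 A * m33 B)
       (m31 A * m11 B + m32 A * m21 B + m33 A * m31 B) (m31 A * m12 B + m32 A * m22 B + m33 A * m32 B)
       (m31 A * m13 B + m32 A * m23 B + m33 A * m33 B).
Definition one3 : mat3 := Mat3 1 0 0 0 1 0 0 0 1.

Definition mrow1 M p1 p2 p3 := m11 M * p1 + m12 M * p2 + m13 M * p3.
Definition mrow2 M p1 p2 p3 := m21 M * p1 + m22 M * p2 + m23 M * p3.
Definition mrow3 M p1 p2 p3 := m31 M * p1 + m32 M * p2 + m33 M * p3.

Definition act (M : mat3) (F : P18) : P18 :=
  let c1 := F.1.1.1.1.1.1 in let n := F.1.1.1.1.1.2 in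
  let l2 := F.1.1.1.1.2 in let l3 := F.1.1.1.2 in let l1 := F.1.1.2 in
  let a2 := F.1.2.1 in let a3 := F.1.2.2 in let a1 := F.2 in
  mk18 (mrow1 M a1 a2 a3) (mrow2 M a1 a2 a3) (mrow3 M a1 a2 a3)
    (mrow1 M l1.1 l2.1 l3.1, mrow1 M l1.2 l2.2 l3.2)
    (mrow2 M l1.1 l2.1 l3.1, mrow2 M l1.2 l2.2 l3.2)
    (mrow3 M l1.1 l2.1 l3.1, mrow3 M l1.2 l2.2 l3.2)
    (mrow1 M c1.1.1 n.1.1.1.1.1 n.1.1.2, mrow1 M c1.1.2 n.1.1.1.1.2 n.1.2, mrow1 M c1.2 n.1.1.1.2 n.2)
    (mrow2 M c1.1.1 n.1.1.1.1.1 n.1.1.2, mrow2 M c1.1.2 n.1.1.1.1.2 n.1.2, mrow2 M c1.2 n.1.1.1.2 n.2,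
     mrow3 M c1.1.1 n.1.1.1.1.1 n.1.1.2, mrow3 M c1.1.2 n.1.1.1.1.2 n.1.2, mrow3 M c1.2 n.1.1.1.2 n.2).

Lemma act_q1 M F x y z : q1 (act M F) x y z = mrow1 M (q1 F x y z) (q2 F x y z) (q3 F x y z).
Proof.
move: F => [[[[[[[[c0 c1] c2] [[[[[d0 d1] d2] e0] e1] e2]] [l21 l22]] [l31 l32]] [l11 l12]] [a2 a3]] a1].
by rewrite /act /q1 /q2 /q3 /tform /qf /=; rewrite /mrow1 /mrow2 /mrow3; ring.
Qed.
Lemma act_q2 M F x y z : q2 (act M F) x y z = mrow2 M (q1 F x y z) (q2 F x y z) (q3 F x y z).
Proof.
move: F => [[[[[[[[c0 c1] c2] [[[[[d0 d1] d2] e0] e1] e2]] [l21 l22]] [l31 l32]] [l11 l12]] [a2 a3]] a1].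
by rewrite /act /q1 /q2 /q3 /tform /qf /=; rewrite /mrow1 /mrow2 /mrow3; ring.
Qed.
Lemma act_q3 M F x y z : q3 (act M F) x y z = mrow3 M (q1 F x y z) (q2 F x y z) (q3 F x y z).
Proof.
move: F => [[[[[[[[c0 c1] c2] [[[[[d0 d1] d2] e0] e1] e2]] [l21 l22]] [l31 l32]] [l11 l12]] [a2 a3]] a1].
by rewrite /act /q1 /q2 /q3 /tform /qf /=; rewrite /mrow1 /mrow2 /mrow3; ring.
Qed.

Lemma act_one F : act one3 F = F.
Proof.
move: F => [[[[[[[[c0 c1] c2] [[[[[d0 d1] d2] e0] e1] e2]] [l21 l22]] [l31 l32]] [l11 l12]] [a2 a3]] a1].
rewrite /act /mk18 /mrow1 /mrow2 /mrow3 /=.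
by rewrite !mul1r !mul0r !addr0 !add0r.
Qed.

Lemma act_mul A B F : act A (act B F) = act (mul3 A B) F.
Proof.
move: F => [[[[[[[[c0 c1] c2] [[[[[d0 d1] d2] e0] e1] e2]] [l21 l22]] [l31 l32]] [l11 l12]] [a2 a3]] a1].
rewrite /act /mk18; cbn [fst snd].
have r1 p1 p2 p3 : mrow1 A (mrow1 B p1 p2 p3) (mrow2 B p1 p2 p3) (mrow3 B p1 p2 p3) = mrow1 (mul3 A B) p1 p2 p3.
  by rewrite /mrow1 /mrow2 /mrow3 /=; ring.
have r2 p1 p2 p3 : mrow2 A (mrow1 B p1 p2 p3) (mrow2 B p1 p2 p3) (mrow3 B p1 p2 p3) = mrow2 (mul3 A B) p1 p2 p3.
  by rewrite /mrow1 /mrow2 /mrow3 /=; ring.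
have r3 p1 p2 p3 : mrow3 A (mrow1 B p1 p2 p3) (mrow2 B p1 p2 p3) (mrow3 B p1 p2 p3) = mrow3 (mul3 A B) p1 p2 p3.
  by rewrite /mrow1 /mrow2 /mrow3 /=; ring.
by rewrite !(r1, r2, r3).
Qed.

Lemma setN_act M M' F : mul3 M' M = one3 -> setN F -> setN (act M F).
Proof.
move=> MM NF x y z; rewrite act_q1 act_q2 act_q3 => e1 e2 e3.
have k0 : mrow1 M' 0 0 0 = 0 /\ mrow2 M' 0 0 0 = 0 /\ mrow3 M' 0 0 0 = 0.
  by rewrite /mrow1 /mrow2 /mrow3 !mulr0 !addr0.
have kF : act M' (act M F) = F by rewrite act_mul MM act_one.
have k1 := act_q1 M' (act M F) x y z; rewrite kF act_q1 act_q2 act_q3 e1 e2 e3 in k1.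
have k2 := act_q2 M' (act M F) x y z; rewrite kF act_q1 act_q2 act_q3 e1 e2 e3 in k2.
have k3 := act_q3 M' (act M F) x y z; rewrite kF act_q1 act_q2 act_q3 e1 e2 e3 in k3.
by apply: NF; rewrite ?k1 ?k2 ?k3; tauto.
Qed.

Lemma ca_act (T : topologicalType) (x : T) (M : T -> mat3) (F : T -> P18) :
  contat x (fun p => m11 (M p)) -> contat x (fun p => m12 (M p)) -> contat x (fun p => m13 (M p)) ->
  contat x (fun p => m21 (M p)) -> contat x (fun p => m22 (M p)) -> contat x (fun p => m23 (M p)) ->
  contat x (fun p => m31 (M p)) -> contat x (fun p => m32 (M p)) -> contat x (fun p => m33 (M p)) ->
  contat x F -> contat x (fun p => act (M p) (F p)).
Proof. by move=> *; rewrite /act /mk18 /mrow1 /mrow2 /mrow3 /=; conts. Qed.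

Definition norm1 (G : P1) : P18 := ((G, (0, 0)), 1).
Definition setN1 : set P1 := [set G | setN (norm1 G)].

(* For [s = 1], inverse to completing the square in [x^2 + x (l . (y,z)) + c1]. *)
Definition csq (s : K) (G : P1) : P1 :=
  let l := G.2 in let l2 := G.1.1.2 in let l3 := G.1.2 in
  let c := G.1.1.1.1 in let n := G.1.1.1.2 in
  (((((c.1.1 + s / 4 * l.1 ^+ 2, c.1.2 + s / 2 * l.1 * l.2, c.2 + s / 4 * l.2 ^+ 2),
    (n.1.1.1.1.1 + s / 2 * l.1 * l2.1, n.1.1.1.1.2 + s / 2 * (l.1 * l2.2 + l.2 * l2.1), n.1.1.1.2 + s / 2 * l.2 * l2.2,
     n.1.1.2 + s / 2 * l.1 * l3.1, n.1.2 + s / 2 * (l.1 * l3.2 + l.2 * l3.1), n.2 + s / 2 * l.2 * l3.2)),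
    l2), l3), l).

Lemma csqK s G : csq (- s) (csq s G) = G.
Proof.
move: G => [[[[[[c0 c1] c2] [[[[[d0 d1] d2] e0] e1] e2]] [l21 l22]] [l31 l32]] [l11 l12]].
by rewrite /csq /=; congr (((((_, _, _), (_, _, _, _, _, _)), (_, _)), (_, _)), (_, _)); ring.
Qed.

Lemma ca_csq (T : topologicalType) (x : T) s (F : T -> P1) :
  contat x F -> contat x (fun p => csq s (F p)).
Proof. by move=> cF; rewrite /csq /=; conts. Qed.

Lemma setN1_csq G : setN1 (csq 1 G) <-> setE G.1.
Proof.
move: G => [[[[[[c0 c1] c2] [[[[[d0 d1] d2] e0] e1] e2]] [l21 l22]] [l31 l32]] [l11 l12]].
have two : (2 : K) != 0 by rewrite pnatr_eq0.
have four : (4 : K) != 0 by rewrite pnatr_eq0.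
split=> [N1 x y z /= f1 f2 f3|E x y z /= f1 f2 f3].
  have [|||//] := N1 (x - (l11 * y + l12 * z) / 2) y z.
  - by rewrite -[RHS]f1 /q1 /tform /qf /=; field.
  - by rewrite -[RHS]f2 /q2 /tform /qf /=; field.
  - by rewrite -[RHS]f3 /q3 /tform /qf /=; field.
have [|||y0 z0] := E (x + (l11 * y + l12 * z) / 2) y z.
- by rewrite -[RHS]f1 /q1 /tform /qf /=; field.
- by rewrite -[RHS]f2 /q2 /tform /qf /=; field.
- by rewrite -[RHS]f3 /q3 /tform /qf /=; field.
split=> //; have : x ^+ 2 = 0 by rewrite -f1 /q1 /tform /qf /= y0 z0; ring.
by move/eqP; rewrite expf_eq0 => /eqP.
Qed.

Definition kap (h : K * K * K * K) : P1 := (((inj0 (sqGL h), 0), 0), 0).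

Lemma maps_kap : maps kap GL2 setN1.
Proof.
move=> h Gh; split; last by rewrite /kap /inj0 /sqGL; conts.
have -> : kap h = csq 1 (kap h).
  rewrite /kap /csq /inj0 /sqGL /=.
  by congr (((((_, _, _), (_, _, _, _, _, _)), _), _), _); ring.
apply/setN1_csq; exact: (maps_inj0 0 0 (maps_sqGL Gh).1).1.
Qed.

(** Completing the square changes nothing where the linear part of the first form is zero, so the
    composite of the preceding comparisons is [kap] itself. *)
Lemma qis_kap : qis kap GL2 setN1.
Proof.
pose jE (n : N6) : PE := ((inj0 n, 0), 0).
have mE : maps jE N2 setE.
  by move=> n Nn; split; [exact: (maps_inj0 0 0 Nn).1|rewrite /jE /inj0; conts].
have ms : maps (fun x : PE => (x, 0 : K * K)) setE (setE `*` setT) by exact: maps_slice.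
have mc : maps (csq 1) (setE `*` setT) setN1.
  by move=> G [EG _]; split; [exact/setN1_csq|apply: ca_csq; exact: ca_id].
have mc' : maps (csq (-1)) setN1 (setE `*` setT).
  move=> G NG; split; last by apply: ca_csq; exact: ca_id.
  split=> //; apply/setN1_csq; have := csqK (-1) G; rewrite opprK => ->.
  by [].
have qc : qis (csq 1) (setE `*` setT) setN1.
  apply: (qis_homeo mc mc') => G _; first exact: csqK.
  by have := csqK (-1) G; rewrite opprK.
have q := qis_comp (maps_sqGL (K := K)) (maps_comp mE (maps_comp ms mc)) (qis_sqGL C)
  (qis_comp mE (maps_comp ms mc) (qis_jE C) (qis_comp ms mc (@qis_zeroT _ _ C (K * K)%type _ _) qc)).
apply: qis_ext q => h _; rewrite /kap /csq /inj0 /sqGL /=.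
by congr (((((_, _, _), (_, _, _, _, _, _)), _), _), _); ring.
Qed.

End Bundle.

(** * The matrix family and the triples without x^2 in the first form *)

Section Bundle.
Variables (R : realType) (K : numClosedFieldType) (C : cplx R K).
Notation qis := (qis R).
Notation T9 := ((K * K * K) * (K * K * K * K * K * K))%type.
Notation PE := (T9 * (K * K) * (K * K))%type.
Notation inj0 := (@inj0 K).

Notation P1 := (PE * (K * K))%type.
Notation P18 := (P1 * (K * K) * K)%type.
Notation GL2 := (@GL2 K).

Notation setN := (@setN K).
Notation setN1 := (@setN1 K).

Lemma norm1E (F : P18) : F.2 = 1 -> F.1.2 = (0, 0) -> norm1 F.1.1 = F.
Proof. by move: F => [[G r] a] /= -> ->. Qed.

Section Frame3.
Variables v1 v2 v3 c1 c2 c3 : K.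

(* [v v^T + c x _]; its inverse is [(c c^T - (v . c) v x _) / (v . c)^2]. *)
Definition mat3v : mat3 K := Mat3 (v1 ^+ 2) (v1 * v2 - c3) (v1 * v3 + c2)
  (v1 * v2 + c3) (v2 ^+ 2) (v2 * v3 - c1) (v1 * v3 - c2) (v2 * v3 + c1) (v3 ^+ 2).

Definition dotv := v1 * c1 + v2 * c2 + v3 * c3.

Definition mat3v_inv : mat3 K :=
  Mat3 (c1 ^+ 2 / dotv ^+ 2) ((c1 * c2 + dotv * v3) / dotv ^+ 2) ((c1 * c3 - dotv * v2) / dotv ^+ 2)
    ((c1 * c2 - dotv * v3) / dotv ^+ 2) (c2 ^+ 2 / dotv ^+ 2) ((c2 * c3 + dotv * v1) / dotv ^+ 2)
    ((c1 * c3 + dotv * v2) / dotv ^+ 2) ((c2 * c3 - dotv * v1) / dotv ^+ 2) (c3 ^+ 2 / dotv ^+ 2).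

Hypothesis d0 : dotv != 0.

Lemma mat3v_mulV : mul3 mat3v mat3v_inv = one3 K.
Proof. by move: d0; rewrite /mul3 /one3 /= /dotv => ?; congr Mat3; field. Qed.

Lemma mat3v_mulVl : mul3 mat3v_inv mat3v = one3 K.
Proof. by move: d0; rewrite /mul3 /one3 /= /dotv => ?; congr Mat3; field. Qed.

End Frame3.

Definition low3 (a1 a2 a3 : K) : mat3 K := Mat3 a1 0 0 a2 1 0 a3 0 1.
Definition low3_inv (a1 a2 a3 : K) : mat3 K := Mat3 a1^-1 0 0 (- (a2 / a1)) 1 0 (- (a3 / a1)) 0 1.

Lemma low3_mulV a1 a2 a3 : a1 != 0 -> mul3 (low3 a1 a2 a3) (low3_inv a1 a2 a3) = one3 K.
Proof. by move=> ?; rewrite /mul3 /one3 /=; congr Mat3; field. Qed.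
Lemma low3_mulVl a1 a2 a3 : a1 != 0 -> mul3 (low3_inv a1 a2 a3) (low3 a1 a2 a3) = one3 K.
Proof. by move=> ?; rewrite /mul3 /one3 /=; congr Mat3; field. Qed.

Definition mul2 (B h : K * K * K * K) : K * K * K * K :=
  (B.1.1.1 * h.1.1.1 + B.1.1.2 * h.1.2, B.1.1.1 * h.1.1.2 + B.1.1.2 * h.2,
   B.1.2 * h.1.1.1 + B.2 * h.1.2, B.1.2 * h.1.1.2 + B.2 * h.2).
Definition inv2 (B : K * K * K * K) : K * K * K * K :=
  (B.2 / det2 B, - (B.1.1.2 / det2 B), - (B.1.2 / det2 B), B.1.1.1 / det2 B).

Lemma det2_mul B h : det2 (mul2 B h) = det2 B * det2 h.
Proof. by rewrite /det2 /mul2 /=; ring. Qed.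

Lemma mul2K B h : det2 B != 0 -> mul2 (inv2 B) (mul2 B h) = h.
Proof.
move: B h => [[[a b] c] d] [[[x y] z] t]; rewrite /mul2 /inv2 /det2 /= => ?.
by congr (_, _, _, _); field.
Qed.

Lemma mul2VK B h : det2 B != 0 -> mul2 B (mul2 (inv2 B) h) = h.
Proof.
move: B h => [[[a b] c] d] [[[x y] z] t]; rewrite /mul2 /inv2 /det2 /= => ?.
by congr (_, _, _, _); field.
Qed.

Lemma det2_inv2 B : det2 B != 0 -> det2 (inv2 B) != 0.
Proof.
move=> d0; have : det2 (inv2 B) * det2 B = 1.
  by move: B d0 => [[[a b] c] d]; rewrite /inv2 /det2 /= => ?; field.
by move=> e; apply: contra_eq_neq e => ->; rewrite mul0r eq_sym oner_neq0.
Qed.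

Notation PX := ((K * K * K * K) * (K * K) * K)%type.

Definition matp (p : PX) : mat3 K := mat3v p.2 p.1.2.1 p.1.2.2 p.2^* p.1.2.1^* p.1.2.2^*.
Definition gm (p : PX) : P1 * (K * K) := (act (matp p) (norm1 (kap p.1.1))).1.
Definition srcX : set PX := [set p | GL2 p.1.1 /\ (p.1.2 != 0 \/ p.2 != 0)].

Lemma dot_neq0 (p : PX) : p.1.2 != 0 \/ p.2 != 0 ->
  dotv p.2 p.1.2.1 p.1.2.2 p.2^* p.1.2.1^* p.1.2.2^* != 0.
Proof.
move: p => [[h [v2 v3]] v1] /= v0; rewrite /dotv -addrA paddr_eq0 ?mul_conjC_ge0 //; last first.
  by rewrite addr_ge0 // mul_conjC_ge0.
rewrite mul_conjC_eq0 norm2_eq0; apply/negP => /andP[/eqP e1 /andP[/eqP e2 /eqP e3]].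
by case: v0; rewrite ?e1 ?e2 ?e3 ?eqxx.
Qed.

(** The coefficient of x^2 in the first form is the corner entry of the matrix, a square; this gives
    the comparison the form required by [qis_strata] with a power map. *)
Lemma gmE p : act (matp p) (norm1 (kap p.1.1)) = (gm p, p.2 ^+ 2).
Proof.
rewrite /gm [LHS]surjective_pairing; congr (_, _).
by rewrite /act /mk18 /mrow1 /norm1; cbn [fst snd]; rewrite mulr1 !mulr0 !addr0.
Qed.

Lemma maps_gm : maps (fun p => (gm p, p.2 ^+ 2)) srcX setN.
Proof.
move=> p [Gp vp]; have d0 := dot_neq0 vp; split.
  rewrite -gmE; apply: (setN_act (mat3v_mulVl d0)).
  exact: (maps_kap Gp).1.
apply: ca_pair; last by conts.
apply: ca_fst; apply: ca_act; rewrite /matp /mat3v; cbn [m11 m12 m13 m21 m22 m23 m31 m32 m33]; try by conts.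
by rewrite /norm1 /kap /inj0 /sqGL; conts.
Qed.

Lemma open_srcX : open srcX.
Proof.
have cd : continuous (@det2 K) by exact: cont_det2.
have o2 : open [set p : PX | p.1.2 != 0].
  apply: open_near => p p0.
  have h : contat p (fun p : PX => p.1.2) by conts.
  exact: (ca_near h (@open_neq0 _ (K * K)%type) p0).
have o1 : open [set p : PX | GL2 p.1.1] by apply: open_nonzero => p; conts.
have o3 : open [set p : PX | p.2 != 0] by apply: open_nonzero => p; conts.
exact: open_and o1 (open_or o2 o3).
Qed.

Let gnz : good R [set r : K * K | r != 0] := good_neq02 C.

(** Where v_1 = 0, the first column of the matrix depends on (v_2, v_3) by a conjugate-linear
    bijection. Acting by the matrix therefore identifies the stratum with a product of [setN1] and
    the nonzero rows. *)
Lemma qis_gm0 : qis (fun w => gm (w, 0)) [set w | srcX (w, 0)] [set w | setN (w, 0)].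
Proof.
pose A : set ((K * K * K * K) * (K * K)) := GL2 `*` [set r | r != 0].
pose S : set (P1 * (K * K)) := setN1 `*` [set r | r != 0].
have AE : [set w | srcX (w, 0)] = A.
  by apply/seteqP; split=> [[h r] [Gh /= [r0|/eqP//]]|[h r] [Gh /= r0]] //; split=> //; left.
rewrite AE.
pose M (r : K * K) : mat3 K := mat3v 0 r.1 r.2 0 r.1^* r.2^*.
pose vr (a : K * K) : K * K := (- a.2^*, a.1^*).
pose Mi (r : K * K) : mat3 K := mat3v_inv 0 r.1 r.2 0 r.1^* r.2^*.
pose Phi (q : P1 * (K * K)) : P1 * (K * K) := (act (M q.2) (norm1 q.1)).1.
pose Phi' (q : P1 * (K * K)) : P1 * (K * K) := ((act (Mi (vr q.2)) (q, 0)).1.1, vr q.2).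
have dr (r : K * K) : r != 0 -> dotv 0 r.1 r.2 0 r.1^* r.2^* != 0.
  by move=> r0; have := @dot_neq0 ((0, r), 0) (or_introl r0); rewrite /= conjC0.
have vr0 (a : K * K) : a != 0 -> vr a != 0.
  apply: contra_neq; rewrite /vr => -[/eqP]; rewrite oppr_eq0 => /eqP/(congr1 Num.conj) e1 /(congr1 Num.conj).
  by move: e1; rewrite !conjCK conjC0 => e1 e2; rewrite (surjective_pairing a) e1 e2.
have PE1 q : act (M q.2) (norm1 q.1) = (Phi q, 0).
  rewrite /Phi [LHS]surjective_pairing; congr (_, _).
  by rewrite /act /mk18 /mrow1 /norm1; cbn [fst snd]; rewrite !mulr0 !addr0 mulr1 /= expr0n.
have PE2 G r : (Phi (G, r)).2 = (r.2^*, - r.1^*).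
  by rewrite /Phi /act /mk18 /mrow2 /mrow3 /norm1; cbn [fst snd]; congr (_, _); rewrite mulr1 !mulr0 !addr0 /=; ring.
have PhiV (q : P1 * (K * K)) : q.2 != 0 -> norm1 (Phi' q).1 = act (Mi (vr q.2)) (q, 0).
  move=> q0; have d0 := dr _ (vr0 _ q0); rewrite /= !rmorphN /= !conjCK in d0.
  change (norm1 (act (Mi (vr q.2)) (q, 0)).1.1 = act (Mi (vr q.2)) (q, 0)).
  rewrite /dotv in d0; apply: norm1E; move: q {q0} d0 => [G [a2 a3]] d0; cbn [fst snd] in d0; rewrite /act /mk18 /mrow1 /mrow2 /mrow3 /Mi /mat3v_inv /dotv; cbn [fst snd m11 m12 m13 m21 m22 m23 m31 m32 m33].
    rewrite /vr /= !rmorphN /= !conjCK; move: (a2^* ) (a3^* ) d0 => b2 b3.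
    by rewrite mul0r add0r => d0; field.
  rewrite /vr /=; rewrite !rmorphN /= !conjCK; move: (a2^* ) (a3^* ) d0 => b2 b3.
  by rewrite mul0r add0r => d0; congr (_, _); field.
have mP : maps Phi S [set w | setN (w, 0)].
  move=> [G r] [NG /= r0]; split.
    by rewrite /= -PE1; apply: (setN_act (mat3v_mulVl (dr r r0))).
  apply: ca_fst; apply: ca_act; rewrite /M /mat3v; cbn [m11 m12 m13 m21 m22 m23 m31 m32 m33]; try by conts.
  by rewrite /norm1; conts.
(* If all three coefficients of x^2 vanished, (1,0,0) would be a common zero. *)
have a0 q : setN (q, 0) -> q.2 != 0.
  move=> Nq; apply/eqP => q0; have [|||/eqP] := Nq 1 0 0; rewrite ?oner_eq0 //.
  - by rewrite /q1 /tform /qf /=; ring.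
  - by rewrite /q2 /tform /qf /= q0 /=; ring.
  - by rewrite /q3 /tform /qf /= q0 /=; ring.
have mP' : maps Phi' [set w | setN (w, 0)] S.
  move=> q Nq; have q0 := a0 q Nq; have d0 := dr _ (vr0 _ q0); split.
    split; last exact: vr0.
    change (setN (norm1 (Phi' q).1)); rewrite PhiV //; exact: (setN_act (mat3v_mulV d0)).
  have cv : contat q (fun q : P1 * (K * K) => vr q.2) by rewrite /vr; conts.
  apply: ca_pair => //; do 2!apply: ca_fst.
  apply: ca_act; rewrite /Mi /mat3v_inv /dotv; cbn [m11 m12 m13 m21 m22 m23 m31 m32 m33]; try (conts; rewrite expf_neq0 //; exact: d0).
have qP : qis Phi S [set w | setN (w, 0)].
  apply: (qis_homeo mP mP') => [[G r] [NG /= r0]|q Nq].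
    have e : vr (Phi (G, r)).2 = r by rewrite PE2 /vr /= rmorphN /= !conjCK opprK -surjective_pairing.
    rewrite /Phi' e; congr (_, _).
    by rewrite -(PE1 (G, r)) act_mul mat3v_mulVl ?act_one //; exact: dr.
  have q0 := a0 q Nq; have d0 := dr _ (vr0 _ q0).
  have := PE1 (Phi' q); rewrite PhiV // act_mul mat3v_mulV // act_one => -[].
  by [].
apply: qis_ext (qis_comp (maps_fxid (@maps_kap K)) mP (gnz (@maps_kap K) (qis_kap C)) qP) => -[h r] _.
by rewrite /Phi /gm /fxid /matp /M /= conjC0.
Qed.

End Bundle.

(** * The triples with x^2 in the first form *)

Section Bundle.
Variables (R : realType) (K : numClosedFieldType) (C : cplx R K).
Notation qis := (qis R).
Notation T9 := ((K * K * K) * (K * K * K * K * K * K))%type.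
Notation PE := (T9 * (K * K) * (K * K))%type.
Notation inj0 := (@inj0 K).

Notation P1 := (PE * (K * K))%type.
Notation P18 := (P1 * (K * K) * K)%type.
Notation GL2 := (@GL2 K).

Notation setN := (@setN K).
Notation setN1 := (@setN1 K).

Notation PX := ((K * K * K * K) * (K * K) * K)%type.
Notation srcX := (@srcX K).
Notation gm := (@gm K).

Definition gmA (p : PX) : K * K := (p.2 * p.1.2.1 + p.1.2.2^*, p.2 * p.1.2.2 - p.1.2.1^*).

Lemma gm2 p : (gm p).2 = gmA p.
Proof.
change ((act (matp p) (norm1 (kap p.1.1))).1.2 = gmA p); rewrite /act /mk18 /mrow2 /mrow3 /norm1 /gmA; cbn [fst snd].
by rewrite !mulr0 !addr0 !mulr1.
Qed.

(** The Schur complement of the corner entry of the matrix; its determinant is that of the matrix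
    divided by v_1^2. *)
Definition redB (p : PX) : K * K * K * K :=
  (m22 (matp p) - (gmA p).1 / p.2 ^+ 2 * m12 (matp p), m23 (matp p) - (gmA p).1 / p.2 ^+ 2 * m13 (matp p),
   m32 (matp p) - (gmA p).2 / p.2 ^+ 2 * m12 (matp p), m33 (matp p) - (gmA p).2 / p.2 ^+ 2 * m13 (matp p)).

Lemma det2_redB p : p.2 != 0 -> det2 (redB p) != 0.
Proof.
move=> v0; have d0 := @dot_neq0 _ p (or_intror v0).
have -> : det2 (redB p) = dotv p.2 p.1.2.1 p.1.2.2 p.2^* p.1.2.1^* p.1.2.2^* ^+ 2 / p.2 ^+ 2.
  move: p v0 {d0} => [[h [v2 v3]] v1] /= v0.
  by rewrite /det2 /redB /gmA /matp /mat3v /dotv /=; field.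
by rewrite mulf_neq0 ?invr_neq0 ?expf_neq0.
Qed.

Lemma ca_redB (T : topologicalType) (x : T) (f : T -> PX) :
  (f x).2 != 0 -> contat x f -> contat x (fun p => redB (f p)).
Proof.
by move=> f0 cf; rewrite /redB /gmA /matp /mat3v; cbn [m11 m12 m13 m21 m22 m23 m31 m32 m33 fst snd]; conts; rewrite expf_neq0.
Qed.

Lemma ca_mul2 (T : topologicalType) (x : T) (B h : T -> K * K * K * K) :
  contat x B -> contat x h -> contat x (fun p => mul2 (B p) (h p)).
Proof. by move=> cB ch; rewrite /mul2; conts. Qed.

Lemma ca_inv2 (T : topologicalType) (x : T) (B : T -> K * K * K * K) :
  det2 (B x) != 0 -> contat x B -> contat x (fun p => inv2 (B p)).
Proof.
move=> B0 cB; have cd := @cont_det2 K; rewrite /inv2; conts => //.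
Qed.

(** Clearing the first column with [low3] trivialises the target. In this trivialisation the map
    sends [h] to [redB p] times [h], together with a contribution [gam] to c1 and the column [gmA],
    both of which can be scaled away. *)
Lemma qis_gmU : qis (fun p => (gm p, p.2 ^+ 2)) (srcX `&` [set p | p.2 != 0]) (setN `&` [set F | F.2 != 0]).
Proof.
pose A : set PX := (GL2 `*` setT) `*` [set z | z != 0].
have AE : srcX `&` [set p | p.2 != 0] = A.
  apply/seteqP; split=> -[[h r] v1]; first by case=> -[].
  by case=> -[/= Gh _] v0; split=> //; split=> //; right.
rewrite AE.
pose B : set P18 := setN `&` [set F | F.2 != 0].
pose S : set (P1 * (K * K) * K) := (setN1 `*` setT) `*` [set z | z != 0].
pose Psi (q : P1 * (K * K) * K) : P18 := act (low3 q.2 q.1.2.1 q.1.2.2) (norm1 q.1.1).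
pose Psi' (F : P18) : P1 * (K * K) * K := (((act (low3_inv F.2 F.1.2.1 F.1.2.2) F).1.1, F.1.2), F.2).
have Psi1 q : (Psi q).1.2 = q.1.2.
  move: q => [[G [a2 a3]] a1]; rewrite /Psi /act /mk18 /mrow2 /mrow3 /norm1 /low3; cbn [fst snd m21 m22 m23 m31 m32 m33].
  by rewrite !mulr0 !addr0 !mulr1.
have Psi2 q : (Psi q).2 = q.2.
  move: q => [[G [a2 a3]] a1]; rewrite /Psi /act /mk18 /mrow1 /norm1 /low3; cbn [fst snd m11 m12 m13].
  by rewrite !mulr0 !addr0 !mulr1.
have nP F : F.2 != 0 -> norm1 (Psi' F).1.1 = act (low3_inv F.2 F.1.2.1 F.1.2.2) F.
  move=> F0; change (norm1 (act (low3_inv F.2 F.1.2.1 F.1.2.2) F).1.1 = act (low3_inv F.2 F.1.2.1 F.1.2.2) F); apply: norm1E; move: F F0 => [[G [a2 a3]] a1]; cbn [fst snd] => a0;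
    rewrite /act /mk18 /mrow1 /mrow2 /mrow3 /low3_inv; cbn [fst snd m11 m12 m13 m21 m22 m23 m31 m32 m33].
    by field.
  by congr (_, _); field.
have mP : maps Psi S B.
  move=> [[G r] a] [[NG _] /= a0]; split.
    split; last by change ((Psi ((G, r), a)).2 != 0); rewrite Psi2.
    exact: (setN_act (low3_mulVl _ _ a0)).
  apply: ca_act; rewrite /low3; cbn [m11 m12 m13 m21 m22 m23 m31 m32 m33]; try by conts.
  by rewrite /norm1; conts.
have mP' : maps Psi' B S.
  move=> F [NF /= F0]; split.
    split=> //; split=> //; change (setN (norm1 (Psi' F).1.1)); rewrite nP //.
    exact: (setN_act (low3_mulV _ _ F0)).
  apply: ca_pair; last by conts.
  apply: ca_pair; last by conts.
  do 2!apply: ca_fst.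
  by apply: ca_act; rewrite /low3_inv; cbn [m11 m12 m13 m21 m22 m23 m31 m32 m33]; conts.
have qP : qis Psi S B.
  apply: (qis_homeo mP mP') => [q [_ /= a0]|F [NF /= F0]].
    rewrite /Psi' Psi1 Psi2 /Psi act_mul low3_mulVl // act_one.
    by move: q {a0} => [[G r] a].
  by rewrite /Psi nP // act_mul low3_mulV // act_one.
pose gam (p : PX) : K * K := ((m12 (matp p) * p.1.1.1.1.1 + m13 (matp p) * p.1.1.1.2) / p.2 ^+ 2,
   (m12 (matp p) * p.1.1.1.1.2 + m13 (matp p) * p.1.1.2) / p.2 ^+ 2).
pose H (s : R) (p : PX) : P1 * (K * K) * K :=
  (((((((toC C s * (gam p).1, 0, toC C s * (gam p).2), sqGL (mul2 (redB p) p.1.1)), 0), 0), 0),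
    (toC C s * (gmA p).1, toC C s * (gmA p).2)), p.2 ^+ 2).
have mf : maps (fun p => (gm p, p.2 ^+ 2)) A B.
  by rewrite -AE => p [Xp p0]; have [? ?] := maps_gm C Xp; split=> //; split=> //=; rewrite expf_neq0.
have H1 p : A p -> H 1 p = Psi' (gm p, p.2 ^+ 2).
  move=> [_ /= p0]; rewrite /H /Psi' rmorph1 !mul1r; cbn [fst snd].
  congr (_, _); congr (_, _); last by rewrite gm2; case: (gmA p).
  rewrite gm2 -gmE act_mul; move: p p0 => [[[[[h11 h12] h21] h22] [v2 v3]] v1]; cbn [fst snd] => v0.
  rewrite /act /mk18 /norm1 /kap /inj0 /sqGL /mrow1 /mrow2 /mrow3 /mul3 /low3_inv /gam /redB /gmA /mul2.
  cbn [fst snd m11 m12 m13 m21 m22 m23 m31 m32 m33]; rewrite /=.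
  by congr (((((_, _, _), (_, _, _, _, _, _)), (_, _)), (_, _)), (_, _)); field.
(* By [setE_00] non-degeneracy does not involve c1 when the linear parts vanish, so scaling [gam]
   stays inside [setN1]. *)
have mH s p : A p -> S (H s p).
  move=> [[Gp _] /= p0]; split; last by rewrite /= expf_neq0.
  split=> //; rewrite /H; cbn [fst snd].
  set c : K * K * K := (_, _, _); set n := sqGL _.
  have -> : ((((c, n), 0), 0), 0) = csq 1 ((((c, n), 0), 0), 0).
    rewrite /csq /c /n /sqGL /=.
    by congr (((((_, _, _), (_, _, _, _, _, _)), _), _), _); ring.
  apply/setN1_csq/setE_00; apply: (maps_sqGL _).1.
  by change (det2 (mul2 (redB p) p.1.1) != 0); rewrite det2_mul mulf_neq0 // det2_redB.
(* [redB] depends on v alone, so this twist is a homeomorphism; the map [H 0] is the twist followed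
   by a product of [kap] and squaring. *)
pose b (p : PX) : PX := ((mul2 (redB p) p.1.1, p.1.2), p.2).
pose b' (p : PX) : PX := ((mul2 (inv2 (redB p)) p.1.1, p.1.2), p.2).
have rB p h : redB ((h, p.1.2), p.2) = redB p by [].
have mb : maps b A A.
  move=> p [[Gp _] /= p0]; split.
    by split=> //; split=> //; change (det2 (mul2 (redB p) p.1.1) != 0); rewrite det2_mul mulf_neq0 // det2_redB.
  apply: ca_pair; last by conts.
  apply: ca_pair; last by conts.
  by apply: ca_mul2; [apply: ca_redB => //; exact: ca_id|conts].
have mb' : maps b' A A.
  move=> p [[Gp _] /= p0]; split.
    by split=> //; split=> //; change (det2 (mul2 (inv2 (redB p)) p.1.1) != 0); rewrite det2_mul mulf_neq0 // det2_inv2 // det2_redB.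
  apply: ca_pair; last by conts.
  apply: ca_pair; last by conts.
  apply: ca_mul2; last by conts.
  by apply: ca_inv2; [exact: det2_redB|apply: ca_redB => //; exact: ca_id].
have qb : qis b A A.
  apply: (qis_homeo mb mb') => p [_ /= p0]; rewrite /b /b' rB; cbn [fst snd].
    rewrite mul2K ?det2_redB //; by move: p {p0} => [[? ?] ?].
  rewrite mul2VK ?det2_redB //; by move: p {p0} => [[? ?] ?].
have qd : qis (fun w : (K * K * K * K) * (K * K) => (kap w.1, 0 : K * K)) (GL2 `*` setT) (setN1 `*` setT).
  have m1 := @maps_fst _ _ GL2 [set: K * K]; have m2 := @maps_kap K.
  have m3 : maps (fun x : P1 => (x, 0 : K * K)) setN1 (setN1 `*` setT) by exact: maps_slice.
  exact: (qis_comp m1 (maps_comp m2 m3) (@qis_fstT _ _ C (K * K)%type _ _)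
    (qis_comp m2 m3 (qis_kap C) (@qis_zeroT _ _ C (K * K)%type _ _))).
have md : maps (fun w : (K * K * K * K) * (K * K) => (kap w.1, 0 : K * K)) (GL2 `*` setT) (setN1 `*` setT).
  move=> [h r] [Gh _]; split; first by split=> //; exact: (maps_kap Gh).1.
  by rewrite /kap /inj0 /sqGL; conts.
have mD : maps (fun p : PX => ((kap p.1.1, 0 : K * K), p.2 ^+ 2)) A S.
  move=> p [[Gp _] /= p0]; split; last by rewrite /kap /inj0 /sqGL; conts.
  by split; [split=> //; exact: (maps_kap Gp).1|rewrite /= expf_neq0].
have [_ _ _ pw] := powlike_exp C (n := 2) isT.
have q0 : qis (fun p => H 0 p) A S.
  apply: qis_ext (qis_comp mb mD qb (pw _ _ _ _ _ md qd)) => p _.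
  by rewrite /H rmorph0 /b /kap /inj0 /=; congr ((((((_, _), _), _), _), (_, _)), _); rewrite ?mul0r.
have q1 : qis (fun p => H 1 p) A S.
  apply: (iffLR (qis_homotopic _) q0); exists H; split=> // s p sI Ap; split; first exact: mH.
  have p0 : p.2 != 0 by case: Ap.
  have cr : contat (s, p) (fun q : R * PX => redB q.2) by apply: ca_redB => //; conts.
  have cm : contat (s, p) (fun q : R * PX => mul2 (redB q.2) q.2.1.1) by apply: ca_mul2 => //; conts.
  rewrite /H /sqGL /gam /gmA /matp /mat3v; cbn [m11 m12 m13 m21 m22 m23 m31 m32 m33 fst snd].
  by conts; rewrite expf_neq0.
have m1 : maps (fun p => H 1 p) A S.
  move=> p Ap; split; first exact: mH.
  have p0 : p.2 != 0 by case: Ap.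
  have cr : contat p redB by apply: (ca_redB (f := id)) => //; exact: ca_id.
  have cm : contat p (fun q : PX => mul2 (redB q) q.1.1) by apply: ca_mul2 => //; conts.
  rewrite /H /sqGL /gam /gmA /matp /mat3v; cbn [m11 m12 m13 m21 m22 m23 m31 m32 m33 fst snd].
  by conts; rewrite expf_neq0.
apply: qis_ext (qis_comp m1 mP q1 qP) => p Ap.
have [Np p0] := (mf p Ap).1.
by rewrite [LHS]/= H1 // /Psi nP // act_mul low3_mulV // act_one.
Qed.

Lemma qis_main : qis (fun p => (gm p, p.2 ^+ 2)) srcX setN.
Proof.
apply: (@qis_strata _ _ C _ _ _ _ srcX setN gm (fun z => z ^+ 2) (@open_srcX K) (open_setN C) _ _
  (powlike_exp C (n := 2) isT)).
- move=> p Xp; have [_ c] := maps_gm C Xp; exact: (ca_fst c).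
- by move=> p Xp; exact: (maps_gm C Xp).1.
- exact: qis_gm0.
- exact: qis_gmU.
Qed.

End Bundle.

(** * Betti numbers of the model *)

Section Bundle.
Variables (R : realType) (K : numClosedFieldType) (C : cplx R K).
Notation qis := (qis R).

Notation GL2 := (@GL2 K).

Notation setN := (@setN K).

Notation srcX := (@srcX K).
Notation fibY := (@fibY K).
Notation betti := (@betti R _).

Lemma betti_qis_inv (T T' : topologicalType) (f : T -> T') (X : set T) (Y : set T') k b :
  maps f X Y -> qis f X Y -> betti Y k b -> betti X k b.
Proof.
move=> mf qf [c [cc csp cin]]; exists (fun i => pull f (c i)); split=> [i|z cz|q qc].
- exact: (cocyc_pull mf (cc i)).
- have [a [z' [ca za]]] := qis_surj qf cz.
  have [q aq] := csp a ca; exists q.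
  have e : cobd X k (cob z') by exists z'.
  apply: cobd_ceqk (cobdD (cobd_pull mf aq) e) => s Xs.
  by rewrite /cochD /cochB /pull za // /cochD /pull /lin; ring.
apply: cin; apply: (qis_inj qf); first exact: cocyc_lin.
exact: qc.
Qed.

Definition bpt k : nat := (k == 0)%N.
(** Multiplication of the Poincaré polynomial by 1 + t^r. *)
Definition bmul r (b : nat -> nat) k : nat := (b k + bshift r b k)%N.

Lemma betti_full (T : topologicalType) (X : set T) (E : normedModType K) (fr : seq ((E -> R) * E)) b :
  full C fr -> (0 < size fr)%N -> (forall k, betti X k (b k)) ->
  forall k, betti (X `*` [set e : E | e != 0]) k (bmul (size fr).-1 b k).
Proof. by move=> [ffr <-] sfr bX k; exact: (betti_nz ffr sfr bX). Qed.

Lemma betti_srcX k : betti srcX k (bmul 5 (bmul 1 (bmul 3 bpt)) k).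
Proof.
pose fr2 := frameX [:: (im C, 'i : K); (re C, 1)] [:: (im C, 'i : K); (re C, 1)].
have f1 := full_scalar C; have f2 : full C fr2 := full_prod f1 f1.
have f3 := full_prod f2 f1.
(* From a point, the factors [K * K] and [K] without origin contribute spheres of dimension 3 and 1
   and give [fibY], hence [GL2]; then [K * K * K] without origin contributes dimension 5. *)
have b0 m : betti [set (0 : K)] m (bpt m) by exact: betti_point.
have b1 := betti_full f2 isT b0.
have b2 := betti_full f1 isT b1.
pose B2 : set (K * (K * K) * K) := ([set 0] `*` [set r | r != 0]) `*` [set z | z != 0].
pose D3 : set (K * K * K) := [set r | r != 0].
pose s (p : K * (K * K) * K) : K * K * K := ((p.1.2.1, p.2), p.1.2.2).
pose s' (q : K * K * K) : K * (K * K) * K := ((0, (q.1.1, q.2)), q.1.2).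
have ms : maps s B2 fibY.
  move=> [[x [a b]] r] [[_ /= ab] r0]; split; last by rewrite /s; conts.
  split=> //=; have [a0|] := eqVneq a 0; last by left.
  by right; apply: contraNneq ab => ->; rewrite a0.
have ms' : maps s' fibY B2.
  move=> [[a r] b] [/= ab r0]; split; last by rewrite /s'; conts.
  by split=> //; split=> //=; apply/eqP => -[a0 c0]; move: ab; rewrite a0 c0 eqxx => -[].
have qs : qis s B2 fibY.
  by apply: (qis_homeo ms ms') => [[[x [a b]] r] [[/= -> _] _]|[[a r] b] _].
have bY m := betti_qis ms qs (b2 m).
have bG m := betti_qis_inv (@maps_colGL K) (qis_colGL C) (bY m).
have b3 := betti_full f3 isT bG.
pose t (p : (K * K * K * K) * (K * K * K)) : (K * K * K * K) * (K * K) * K := ((p.1, p.2.1), p.2.2).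
pose t' (p : (K * K * K * K) * (K * K) * K) : (K * K * K * K) * (K * K * K) := (p.1.1, (p.1.2, p.2)).
have mt : maps t (GL2 `*` D3) srcX.
  move=> [h [w v1]] [Gh /= wv]; split; last by rewrite /t; conts.
  split=> //=; have [w0|] := eqVneq w 0; last by left.
  by right; apply: contraNneq wv => ->; rewrite w0.
have mt' : maps t' srcX (GL2 `*` D3).
  move=> [[h w] v1] [Gh /= wv]; split; last by rewrite /t'; conts.
  by split=> //=; apply/eqP => -[w0 c0]; move: wv; rewrite w0 c0 /= !eqxx => -[].
have qt : qis t (GL2 `*` D3) srcX.
  by apply: (qis_homeo mt mt') => [[h [w v1]] _|[[h w] v1] _].
exact: (betti_qis mt qt (b3 k)).
Qed.

Lemma betti_setN k : betti setN k (bmul 5 (bmul 1 (bmul 3 bpt)) k).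
Proof. exact: (betti_qis (@maps_gm _ _ C) (qis_main C) (betti_srcX k)). Qed.

End Bundle.

Lemma bmul_coef r (p : {poly int}) b : (forall k, (b k)%:Z = p`_k) ->
  forall k, (bmul r b k)%:Z = ((1 + 'X^r) * p)`_k.
Proof.
move=> bp k; rewrite /bmul /bshift mulrDl mul1r coefD coefXnM PoszD bp.
by case: ltnP => _; rewrite ?bp.
Qed.

Lemma bettiN_coef k : (bmul 5 (bmul 1 (bmul 3 bpt)) k)%:Z =
  ((1 + 'X) * (1 + 'X ^+ 3) * (1 + 'X ^+ 5) : {poly int})`_k.
Proof.
have h0 j : (bpt j)%:Z = (1 : {poly int})`_j by rewrite coef1 /bpt; case: eqP.
have h3 := bmul_coef 5 (bmul_coef 1 (bmul_coef 3 h0)).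
rewrite h3 expr1 mulr1; congr (_`_k).
by rewrite mulrC.
Qed.

(** * Passage to the normalised simplices of the statement *)

Section Normalised.
Variables (R : realType) (n : nat) (X : set 'rV[R]_n).
Notation V := 'rV[R]_n.
Notation Delta k := (stdsimplex R k).

(** A simplex is extended outside the standard simplex by 0 in the statement and through [clamp] in
    the proof; [cut] and [ext] exchange the two conventions. *)
Definition cut k (f : 'rV[R]_k.+1 -> V) : 'rV[R]_k.+1 -> V :=
  fun x => if x \in Delta k then f x else 0.
Definition ext k (f : 'rV[R]_k.+1 -> V) : 'rV[R]_k.+1 -> V := fun x => f (clamp x).

Lemma cut_in k (f : 'rV[R]_k.+1 -> V) x : Delta k x -> cut f x = f x.
Proof. by move=> Dx; rewrite /cut mem_set. Qed.

Lemma extK k (f : 'rV[R]_k.+1 -> V) : is_simplex R n X k f -> cut (ext f) = f.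
Proof.
move=> [_ _ f0]; apply/funext => x; rewrite /cut; case: ifPn => [/set_mem Dx|/negP nx].
  by rewrite /ext clamp_id.
by rewrite f0 // => Dx; apply: nx; exact: mem_set.
Qed.

Lemma cutK k (f : 'rV[R]_k.+1 -> V) : sing X f -> ext (cut f) = f.
Proof.
move=> [fc _ _]; apply/funext => x; rewrite /ext cut_in ?fc //; exact: clamp_in.
Qed.

Lemma within_eq k (f g : 'rV[R]_k.+1 -> V) : (forall x, Delta k x -> f x = g x) ->
  {within Delta k, continuous f} -> {within Delta k, continuous g}.
Proof.
move=> fg /within_contP fc; apply/within_contP => x Dx B; rewrite -fg // => /(fc x Dx) h.
apply: (@filterS _ (nbhs x) _ _ _ _ h) => y yB Dy; rewrite -fg //; exact: yB.
Qed.

Lemma sing_ext k (f : 'rV[R]_k.+1 -> V) : is_simplex R n X k f -> sing X (ext f).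
Proof.
move=> [fC fX _]; have e x : Delta k x -> f x = ext f x by move=> Dx; rewrite /ext clamp_id.
split=> [x|x Dx|]; last exact: within_eq fC.
  by rewrite /ext clamp_id //; exact: clamp_in.
by rewrite -e //; exact: fX.
Qed.

Lemma simplex_cut k (f : 'rV[R]_k.+1 -> V) : sing X f -> is_simplex R n X k (cut f).
Proof.
move=> [_ fX fC]; split=> [|x Dx|x nD].
- by apply: within_eq fC => x Dx; rewrite cut_in.
- by rewrite cut_in //; exact: fX.
- by rewrite /cut; case: ifPn => // /set_mem.
Qed.

Lemma ext_face k j (f : 'rV[R]_k.+2 -> V) : ext (face R n k j f) = sface j (ext f).
Proof.
apply/funext => x; rewrite /ext /face /sface mem_set; last exact: clamp_in.
by rewrite (clamp_id (Delta_face j (clamp_in x))).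
Qed.

Lemma cut_face k j (f : 'rV[R]_k.+2 -> V) : face R n k j (cut f) = cut (sface j f).
Proof.
apply/funext => x; rewrite /face {2}/cut; case: ifPn => // /set_mem Dx.
by rewrite cut_in ?/sface ?clamp_id //; exact: Delta_face.
Qed.

Definition restr (c : cochains R V) k : cochain R n k := fun f => c k (ext f).
Arguments restr : clear implicits.

Lemma cobound_restr c k f : cobound R n k (restr c k) f = cob c (ext f).
Proof. by rewrite /cobound /=; apply: eq_bigr => j _; rewrite /restr ext_face. Qed.

(** A cochain of one degree becomes a family over all degrees; the transport is needed because the
    type of [z] mentions its degree. *)
Definition extend k (z : cochain R n k) : cochains R V := fun m f =>
  if PeanoNat.Nat.eq_dec k m is left e then eq_rect k (fun m => cochain R n m) z m e (cut f) else 0.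

Lemma extendE k z (f : 'rV[R]_k.+1 -> V) : extend z f = z (cut f).
Proof.
rewrite /extend; case: PeanoNat.Nat.eq_dec => // e.
by rewrite (eq_axiomK e).
Qed.

Lemma cob_extend k z (f : 'rV[R]_k.+2 -> V) : cob (extend z) f = cobound R n k z (cut f).
Proof. by rewrite /cobound /=; apply: eq_bigr => j _; rewrite extendE cut_face. Qed.

Lemma betti_betti_eq k b : @betti R _ X k b -> betti_eq R n X k b.
Proof.
move=> [c [cc csp cin]]; exists (fun i => restr (c i) k); split=> [i f Xf|z cz|a].
- by rewrite cobound_restr (cc i) //; exact: sing_ext.
- have cu : cocyc X (trunc k (extend z)).
    apply: cocyc_trunc => f Xf; rewrite cob_extend cz //; exact: simplex_cut.
  have [q [d dq]] := csp _ cu; exists q.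
  have e f : is_simplex R n X k f -> z f - \sum_i q i * restr (c i) k f = cob d (ext f).
    move=> Xf; rewrite -dq; last exact: sing_ext.
    by rewrite /cochB (ceqk_trunc _ (sing_ext Xf)) extendE (extK Xf).
  (* In degree 0 a coboundary of the statement is a cochain that vanishes on simplices, in agreement
     with the convention that [cob] is zero there. *)
  clear csp cin cz cu dq; case: k z c cc q d e => [|k] z c cc q d e /=.
    by move=> f Xf; rewrite e.
  by exists (restr d k) => f Xf; rewrite e // cobound_restr.
move=> ab; apply: cin.
case: k c cc csp ab => [|k] c cc csp /= ab.
  exists (@coch0 R V) => f Xf; rewrite cob0 /coch0 /lin.
  by have := ab _ (simplex_cut Xf); rewrite /restr (cutK Xf).
have [d dP] := ab; exists (extend d) => f Xf; rewrite cob_extend -dP; last exact: simplex_cut.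
by rewrite /lin /restr (cutK Xf).
Qed.

End Normalised.

Lemma near_dist (F : numFieldType) (V : normedModType F) (z : V) (e : F) : 0 < e ->
  \forall x \near z, `|z - x| < e.
Proof. by move=> e0; apply/nbhs_ballP; exists e => // x; rewrite -ball_normE. Qed.

(** * The complex numbers over [R] *)

Section ComplexNumbers.
Variable R : realType.
Definition Cx : numClosedFieldType := R[i].

Let Cre : Cx -> R := @complex.Re R.
Let Cim : Cx -> R := @complex.Im R.
Let rC : {rmorphism R -> Cx} := real_complex R.

Let norm_i : `|('i : Cx)| = 1. Proof. by rewrite normCi. Qed.

Let CreD a b x y : Cre (rC a * x + rC b * y) = a * Cre x + b * Cre y.
Proof. by case: x y => [x1 x2] [y1 y2]; rewrite /Cre /= !mul0r !subr0. Qed.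
Let CimD a b x y : Cim (rC a * x + rC b * y) = a * Cim x + b * Cim y.
Proof. by case: x y => [x1 x2] [y1 y2]; rewrite /Cim /= !mul0r !addr0. Qed.

Let Cnorm_re (z : Cx) : rC `|Cre z| <= `|z|.
Proof. exact: normc_ge_Re. Qed.

Let Cnorm_im (z : Cx) : rC `|Cim z| <= `|z|.
Proof.
rewrite -[`|z|]mulr1 -norm_i -normrM; have := Cnorm_re (z * 'i).
by rewrite {1}/Cre ReiNIm normrN.
Qed.

Let rC_le a b : (rC a <= rC b) = (a <= b).
Proof. by rewrite lecE /= eqxx. Qed.

Let rC_lt a b : (rC a < rC b) = (a < b).
Proof. by rewrite ltcE /= eqxx. Qed.

Let cont_part (l : Cx -> R) : (forall x y, l (x - y) = l x - l y) ->
  (forall z, rC `|l z| <= `|z|) -> continuous l.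
Proof.
move=> lB ln z B /nbhs_ballP[e /= e0 eB].
have e0' : (0 : Cx) < rC e by rewrite -(rmorph0 rC) rC_lt.
have : \forall x \near z, `|z - x| < rC e.
  exact: near_dist.
apply: (@filterS _ (nbhs z)) => x zx; apply: eB; rewrite -ball_normE /=.
by rewrite -rC_lt; apply: le_lt_trans zx; rewrite -lB; exact: ln.
Qed.

Let CreB x y : Cre (x - y) = Cre x - Cre y.
Proof. by case: x y => [x1 x2] [y1 y2]. Qed.
Let CimB x y : Cim (x - y) = Cim x - Cim y.
Proof. by case: x y => [x1 x2] [y1 y2]. Qed.

Let cont_rC : continuous rC.
Proof.
move=> a B /nbhs_ballP[e /= e0 eB].
(* Radii of balls in the complex field are themselves complex; positivity forces [e] to be real. *)
have [ee0 ie] : 0 < Cre e /\ Cim e = 0.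
  by move: e0; rewrite ltcE /= => /andP[/eqP ? ?].
have : \forall x \near a, `|a - x| < Cre e.
  exact: near_dist.
apply: (@filterS _ (nbhs a)) => x ax; apply: eB; rewrite -ball_normE /=.
have -> : e = rC (Cre e) by case: e ie {e0 ee0 ax} => [e1 e2] /= ->.
have -> : rC a - rC x = rC (a - x) by rewrite rmorphB.
rewrite (_ : `|rC (a - x)| = rC `|a - x|) ?rC_lt //.
by rewrite normc_def /= expr0n addr0 sqrtr_sqr.
Qed.

Definition cplx_Cx : cplx R Cx.
Proof.
exact: (@Cplx R Cx rC Cre Cim cont_rC (cont_part CreB Cnorm_re) (cont_part CimB Cnorm_im)
  CreD CimD erefl erefl erefl erefl (@complexE R) Cnorm_re Cnorm_im rC_le).
Defined.

End ComplexNumbers.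

(** * Real coordinates on the space of triples *)

Section Entries.
Variable K : numClosedFieldType.
Notation P18 := ((K * K * K) * (K * K * K * K * K * K) * (K * K) * (K * K) * (K * K) * (K * K) * K)%type.

(** Row [i] lists the coefficients of a form in the order x^2, y^2, z^2, xy, xz, yz of the
    statement, whereas the nested pairs follow the order of the stratification. *)
Definition crd (F : P18) (i m : nat) : K := nth 0 (nth [::] [::
  [:: F.2; F.1.1.1.1.1.1.1.1; F.1.1.1.1.1.1.2; F.1.1.2.1; F.1.1.2.2; F.1.1.1.1.1.1.1.2];
  [:: F.1.2.1; F.1.1.1.1.1.2.1.1.1.1.1; F.1.1.1.1.1.2.1.1.1.2; F.1.1.1.1.2.1; F.1.1.1.1.2.2;
      F.1.1.1.1.1.2.1.1.1.1.2];
  [:: F.1.2.2; F.1.1.1.1.1.2.1.1.2; F.1.1.1.1.1.2.2; F.1.1.1.2.1; F.1.1.1.2.2;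
      F.1.1.1.1.1.2.1.2]] i) m.

Lemma ca_crd F i m : contat F (fun F => crd F i m).
Proof.
by case: i => [|[|[|i]]]; case: m => [|[|[|[|[|[|m]]]]]]; rewrite /crd /= ?nth_nil; cont.
Qed.

End Entries.

Section Coordinates.
Variable R : realType.
Notation K := (Cx R).
Notation C := (cplx_Cx R).
Notation V := 'rV[R]_36.
Notation P18 := ((K * K * K) * (K * K * K * K * K * K) * (K * K) * (K * K) * (K * K) * (K * K) * K)%type.

Definition cn (v : V) (i m : nat) : K :=
  toC C (v 0 (inord (2 * (6 * i + m)))) + 'i * toC C (v 0 (inord (2 * (6 * i + m) + 1))).

Lemma coefE v (i : 'I_3) (m : 'I_6) : Defs.coef R v i m = cn v i m.
Proof. exact: complexE. Qed.

Definition to18 (v : V) : P18 := mk18 (cn v 0 0) (cn v 1 0) (cn v 2 0)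
  (cn v 0 3, cn v 0 4) (cn v 1 3, cn v 1 4) (cn v 2 3, cn v 2 4) (cn v 0 1, cn v 0 5, cn v 0 2)
  (cn v 1 1, cn v 1 5, cn v 1 2, cn v 2 1, cn v 2 5, cn v 2 2).

Definition part (b : bool) (z : K) : R := if b then im C z else re C z.

Definition of18 (F : P18) : V :=
  \sum_(j < 36) part (odd j) (crd F (j./2 %/ 6) (j./2 %% 6)) *: delta_mx 0 j.

Lemma of18E F j : of18 F 0 j = part (odd j) (crd F (j./2 %/ 6) (j./2 %% 6)).
Proof.
rewrite /of18 summxE (bigD1 j) //= big1 ?addr0; first by rewrite !mxE !eqxx mulr1.
by move=> i ij; rewrite !mxE eqxx eq_sym (negPf ij) mulr0.
Qed.

Lemma cn_of18 F i m : (i < 3)%N -> (m < 6)%N -> cn (of18 F) i m = crd F i m.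
Proof.
move=> i3 m6; rewrite /cn !of18E !inordK; try lia.
have -> : odd (2 * (6 * i + m)) = false by rewrite oddM.
have -> : odd (2 * (6 * i + m) + 1) = true by rewrite oddD oddM.
have -> : ((2 * (6 * i + m))./2 = 6 * i + m)%N by rewrite mul2n doubleK.
have -> : ((2 * (6 * i + m) + 1)./2 = 6 * i + m)%N by rewrite mul2n addn1 /= uphalf_double.
have -> : ((6 * i + m) %/ 6 = i)%N by rewrite mulnC divnMDl // divn_small // addn0.
have -> : ((6 * i + m) %% 6 = m)%N by rewrite mulnC modnMDl modn_small.
by rewrite /part -reim.
Qed.

Lemma crd_to18 v i m : (i < 3)%N -> (m < 6)%N -> crd (to18 v) i m = cn v i m.
Proof. by case: i => [|[|[|]]] // _; case: m => [|[|[|[|[|[|]]]]]]. Qed.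

Lemma part_cn b v i m :
  part b (cn v i m) = v 0 (inord (2 * (6 * i + m) + b)).
Proof.
have e : cn v i m = toC C (v 0 (inord (2 * (6 * i + m)))) * 1 + toC C (v 0 (inord (2 * (6 * i + m) + 1))) * 'i.
  by rewrite /cn mulr1 [in RHS]mulrC addn1.
rewrite /part e; case: b.
  by rewrite imD im1 imi mulr0 add0r mulr1 addn1.
by rewrite reD re1 rei mulr0 addr0 mulr1 addn0.
Qed.

Lemma of18K v : of18 (to18 v) = v.
Proof.
apply/rowP => j; rewrite of18E crd_to18 ?ltn_pmod //; last first.
  have := ltn_ord j; rewrite ltn_divLR //; move: (odd_double_half j); lia.
rewrite part_cn; congr (v 0 _); apply: val_inj => /=.
have -> : (6 * (j./2 %/ 6) + j./2 %% 6 = j./2)%N by rewrite mulnC -divn_eq.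
by rewrite mul2n addnC odd_double_half inordK.
Qed.

Lemma to18K F : to18 (of18 F) = F.
Proof.
rewrite /to18 !cn_of18 //.
by move: F => [[[[[[[[c0 c1] c2] [[[[[d0 d1] d2] e0] e1] e2]] [l21 l22]] [l31 l32]] [l11 l12]] [a2 a3]] a1].
Qed.

Lemma ca_cn (T : topologicalType) (x : T) (f : T -> V) i m :
  contat x f -> contat x (fun p => cn (f p) i m).
Proof.
move=> cf; have cj j : contat x (fun p => f p 0 j).
  by exact: (@ca_comp _ x _ _ f (fun v : V => v 0 j) cf (@coord_continuous _ _ _ 0 j (f x))).
rewrite /cn; have h1 := @ca_toC _ _ C _ x _ (cj (inord (2 * (6 * i + m)))).
by have h2 := @ca_toC _ _ C _ x _ (cj (inord (2 * (6 * i + m) + 1))); conts.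
Qed.

Lemma ca_to18 v : contat v to18.
Proof.
have h i m : contat v (fun v => cn v i m) by apply: ca_cn; exact: ca_id.
by rewrite /to18 /mk18; conts; exact: h.
Qed.

Lemma ca_of18 F : contat F of18.
Proof.
have h (j : 'I_36) : contat F (fun F => part (odd j) (crd F (j./2 %/ 6) (j./2 %% 6)) *: (delta_mx 0 j : V)).
  apply: ca_scale; last exact: ca_cst.
  rewrite /part; case: (odd j).
    by apply: (@ca_im _ _ C); exact: ca_crd.
  by apply: (@ca_re _ _ C); exact: ca_crd.
rewrite /contat /of18; elim: (index_enum _) => [|j s IH].
  rewrite (_ : (fun F => _) = fun=> 0); first exact: ca_cst.
  by apply/funext => G; rewrite big_nil.
rewrite (_ : (fun F => _) = fun G => part (odd j) (crd G (j./2 %/ 6) (j./2 %% 6)) *: (delta_mx 0 j : V) +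
   \sum_(j <- s) part (odd j) (crd G (j./2 %/ 6) (j./2 %% 6)) *: delta_mx 0 j).
  exact: (@ca_add _ F R _ _ _ (h j) IH).
by apply/funext => G; rewrite big_cons.
Qed.

Lemma quadE v (i : 'I_3) (z : 'I_3 -> R[i]) : Defs.quad R v i z =
  tform (cn v i 0 : K) (cn v i 3, cn v i 4) (cn v i 1) (cn v i 5) (cn v i 2) (z (inord 0)) (z (inord 1)) (z (inord 2)).
Proof.
rewrite /Defs.quad !big_ord_recl big_ord0 /monomial !coefE /tform /qf /=.
rewrite /bump /= addr0.
set x := z _; set y := z _; set t := z _.
by move: (cn v i 0) (cn v i 1) (cn v i 2) (cn v i 3) (cn v i 4) (cn v i 5) x y t; rewrite /Cx => *; ring.
Qed.

Lemma nondegE v : nondeg R v <-> setN (to18 v).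
Proof.
split=> [Nv x y z e1 e2 e3|Nv z qz j].
  pose w (j : 'I_3) : K := [:: x; y; z]`_j.
  have wE : [/\ w (inord 0) = x, w (inord 1) = y & w (inord 2) = z] by rewrite /w !inordK.
  have [w0 w1 w2] := wE.
  have w0' : forall i, Defs.quad R v i w = 0.
    case=> [[|[|[|//]]] lt_i]; rewrite quadE w0 w1 w2 /=; [exact: e1|exact: e2|exact: e3].
  have h := Nv w w0'; by rewrite -w0 -w1 -w2; split; exact: h.
have [|||x0 y0 t0] := Nv (z (inord 0)) (z (inord 1)) (z (inord 2)).
- by have := qz (inord 0); rewrite quadE inordK.
- by have := qz (inord 1); rewrite quadE inordK.
- by have := qz (inord 2); rewrite quadE inordK.
have -> : j = inord j by rewrite inord_val.
by case: j => [[|[|[|//]]] lt_j] /=.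
Qed.

Lemma betti_nondeg k : @betti R _ (nondeg R) k (bmul 5 (bmul 1 (bmul 3 bpt)) k).
Proof.
have mT : maps to18 (nondeg R) (@setN K).
  by move=> v /nondegE Nv; split=> //; exact: ca_to18.
have mF : maps of18 (@setN K) (nondeg R).
  by move=> F NF; split; [apply/nondegE; rewrite to18K|exact: ca_of18].
have qT : qis R to18 (nondeg R) (@setN K).
  by apply: (qis_homeo mT mF) => x _; [exact: of18K|exact: to18K].
exact: (betti_qis_inv mT qT (betti_setN C k)).
Qed.

End Coordinates.

Theorem theorem5 (R : realType) :
  @poincare_poly_eq R 36 (nondeg R)
    ((1 + 'X) * (1 + 'X ^+ 3) * (1 + 'X ^+ 5) : {poly int}).
Proof.
move=> k; exists (bmul 5 (bmul 1 (bmul 3 bpt)) k); split.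
  exact: betti_betti_eq (betti_nondeg R k).
exact: bettiN_coef.
Qed.
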